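(* Let $c_1\in[1,2)$ and $c_2=1$, let $h_1\in\mathcal R_{c_1}$ and $h_2\in\mathcal R_{c_2}$, let $\varphi_1,\varphi_2,\psi$ be associated with $h_1,h_2$ as in the context, and let $\mathbf B_N^{\pm}=\mathbf B_{\pm}\cap[1,N]$. Then for every $p\ge 2$ there exists a constant $\mathbf C_p>0$ such that for every $N\in\mathbb N$ and any sequence of complex numbers $(a_n:n\in\mathbb N)$ satisfying $\sup_{n\in\mathbb N}|a_n|\le 1$ we have $$\Big\|\sum_{n\in\mathbf B_N^{\pm}}a_ne^{2\pi i n\xi}\Big\|_{L^p(\mathbb T,\mathrm d\xi)}\le \mathbf C_p\Big\|\sum_{n\in\mathbf B_N^{\pm}}e^{2\pi i n\xi}\Big\|_{L^p(\mathbb T,\mathrm d\xi)}.$$ The inequality is asserted for each of the two choices of sign (the same sign on both sides).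
   Context: $\mathbb T=\mathbb R/\mathbb Z$ with normalized Lebesgue measure; $\lfloor x\rfloor$ is the integer part and $\{x\}=x-\lfloor x\rfloor$ the fractional part of a real number $x$. Throughout $x_0>0$ denotes a starting point of a half-line. Class $\mathcal L$: all functions $\ell:[x_0,\infty)\to(0,\infty)$ of the form $\ell(x)=\exp\big(\int_{x_0}^x\frac{\vartheta(t)}{t}\,\mathrm dt\big)$, where $\vartheta\in\mathcal C^2([x_0,\infty))$ is real-valued with $\lim_{x\to\infty}\vartheta(x)=0$, $\lim_{x\to\infty}x\vartheta'(x)=0$, $\lim_{x\to\infty}x^2\vartheta''(x)=0$. Class $\mathcal L_0$: all functions $\ell:[x_0,\infty)\to(0,\infty)$ of the form $\ell(x)=\exp\big(\int_{x_0}^x\frac{\vartheta(t)}{t}\,\mathrm dt\big)$ with $\lim_{x\to\infty}\ell(x)=\infty$, where $\vartheta\in\mathcal C^2([x_0,\infty))$ is positive, decreasing, with $\lim_{x\to\infty}\vartheta(x)=0$, $\lim_{x\to\infty}\frac{x\vartheta'(x)}{\vartheta(x)}=0$, $\lim_{x\to\infty}\frac{x^2\vartheta''(x)}{\vartheta(x)}=0$, and for every $\varepsilon>0$ there is $C_\varepsilon>0$ such that $1\le C_\varepsilon\vartheta(x)x^{\varepsilon}$. Class $\mathcal R_c$: for $c\in(0,2)\setminus\{1\}$, all increasing, convex functions $h:[x_0,\infty)\to[1,\infty)$ of the form $h(x)=x^cL(x)$ with $L\in\mathcal L$; for $c=1$ the same but with $L\in\mathcal L_0$. Given $h_1\in\mathcal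 R_{c_1}$ and $h_2\in\mathcal R_{c_2}$, $\varphi_1$ and $\varphi_2$ denote the inverse functions of $h_1$ and $h_2$. The function $\psi:[x_0,\infty)\to(0,\infty)$ is twice differentiable, satisfies $\psi(x)\le 1/2$ for all $x\ge x_0$, and $$\lim_{x\to\infty}\frac{\psi(x)}{\varphi_2'(x)}=1,\quad \lim_{x\to\infty}\frac{\psi'(x)}{\varphi_2''(x)}=1,\quad \lim_{x\to\infty}\frac{\psi''(x)}{\varphi_2'''(x)}=1.$$ Define $$\mathbf B_+=\{n\in\mathbb N:\{\varphi_1(n)\}<\psi(n)\},\qquad \mathbf B_-=\{n\in\mathbb N:\{-\varphi_1(n)\}<\psi(n)\},$$ where only those $n\in\mathbb N$ at which both $\varphi_1$ and $\psi$ are defined are considered. The constant $\mathbf C_p$ may depend on $p,h_1,h_2,\psi$. *)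

(* Defs.v *)
From mathcomp Require Import all_boot all_order all_algebra.
From mathcomp Require Import all_classical all_reals all_analysis.
From mathcomp Require Import complex.

Set Implicit Arguments.
Unset Strict Implicit.
Unset Printing Implicit Defensive.

Import Order.TTheory GRing.Theory Num.Theory.
Import numFieldNormedType.Exports.

Local Open Scope classical_set_scope.
Local Open Scope ring_scope.

(* A function on a half-line [x0, oo) is a total function R -> R whose values
   to the left of x0 are never used. *)

Section HalfLine.
Variable R : realType.
Implicit Types (x y b c : R) (f h l theta phi psi : R -> R).

(* Increments u such that x + u stays in the half-line: the derivative below is
   the usual one at x > x0 and the right-hand one at x = x0. *)
Definition increments x0 x : set_system R :=
  within [set u | x0 <= x + u] (0 : R)^'.

Definition diff_quot f x : R -> R := fun u => (f (x + u) - f x) / u.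

Definition differentiable_from x0 f : Prop :=
  forall x, x0 <= x -> cvg (diff_quot f x u @[u --> increments x0 x]).

Definition deriv_from x0 f : R -> R :=
  fun x => lim (diff_quot f x u @[u --> increments x0 x]).

Definition derivn_from x0 (n : nat) f : R -> R := iter n (deriv_from x0) f.

Definition twice_differentiable_from x0 f : Prop :=
  differentiable_from x0 f /\ differentiable_from x0 (deriv_from x0 f).

Definition C2_from x0 f : Prop :=
  twice_differentiable_from x0 f /\
  {within `[x0, +oo[, continuous (derivn_from x0 2 f)}.

Definition exp_rep x0 theta l : Prop :=
  forall x, x0 <= x ->
    l x = expR (\int[lebesgue_measure]_(t in `[x0, x]) (theta t / t)).

Definition class_L x0 l : Prop :=
  exists theta : R -> R,
    [/\ exp_rep x0 theta l,
        C2_from x0 theta,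
        theta x @[x --> +oo] --> (0 : R),
        x * derivn_from x0 1 theta x @[x --> +oo] --> (0 : R) &
        x ^+ 2 * derivn_from x0 2 theta x @[x --> +oo] --> (0 : R)].

Definition class_L0 x0 l : Prop :=
  l x @[x --> +oo] --> +oo /\
  exists theta : R -> R,
    [/\ exp_rep x0 theta l,
        C2_from x0 theta,
        (forall x, x0 <= x -> 0 < theta x),
        {in `[x0, +oo[ &, {homo theta : x y / x <= y >-> y <= x}} &
     [/\ theta x @[x --> +oo] --> (0 : R),
         x * derivn_from x0 1 theta x / theta x @[x --> +oo] --> (0 : R),
         x ^+ 2 * derivn_from x0 2 theta x / theta x @[x --> +oo] --> (0 : R) &
         forall eps : R, 0 < eps -> exists C : R, 0 < C /\
           forall x, x0 <= x -> 1 <= C * theta x * x `^ eps]].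

Definition class_R c x0 h : Prop :=
  [/\ 0 < x0,
      0 < c < 2,
      (forall x, x0 <= x -> 1 <= h x),
      {in `[x0, +oo[ &, {homo h : x y / x <= y}} /\
      convex_function `[x0, +oo[ h &
      exists L : R -> R,
        (if c == 1 then class_L0 x0 L else class_L x0 L) /\
        forall x, x0 <= x -> h x = x `^ c * L x].

(* phi is the inverse of h : [x0, oo) -> [h x0, oo); for h in class_R the map is
   onto, so this determines phi on [h x0, oo), and it forces the
   non-decreasing h to be strictly increasing. *)
Definition inverse_from x0 h phi : Prop :=
  forall x, x0 <= x -> phi (h x) = x.

(* b is the starting point of the domain of phi2, y0 that of psi. Since x / 0 = 0,
   the limit 1 forces the denominators to be nonzero for all large x. *)
Definition approximates_derivative y0 psi b phi2 : Prop :=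
  [/\ psi x / derivn_from b 1 phi2 x @[x --> +oo] --> (1 : R),
      derivn_from y0 1 psi x / derivn_from b 2 phi2 x @[x --> +oo] --> (1 : R) &
      derivn_from y0 2 psi x / derivn_from b 3 phi2 x @[x --> +oo] --> (1 : R)].

Definition frac x : R := x - (Num.floor x)%:~R.

(* b and y0 are the starting points of the domains of phi and psi; only the n at
   which both functions are defined are kept. *)
Definition B_plus b phi y0 psi : set nat :=
  [set n | [/\ b <= n%:R, y0 <= n%:R & frac (phi n%:R) < psi n%:R]].

Definition B_minus b phi y0 psi : set nat :=
  [set n | [/\ b <= n%:R, y0 <= n%:R & frac (- phi n%:R) < psi n%:R]].

Definition e1 x : R[i] := Complex (cos (2 * pi * x)) (sin (2 * pi * x)).

Definition exp_sum (B : set nat) (N : nat) (a : nat -> R[i]) (xi : R) : R[i] :=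
  \sum_(1 <= n < N.+1 | n \in B) a n * e1 (n%:R * xi).

(* T = R/Z is represented by its fundamental domain [0, 1). *)
Definition circle_measure :
    {measure set (g_sigma_algebraType (R.-ocitv.-measurable)) -> \bar R} :=
  mrestr lebesgue_measure (measurable_itv `[0 : R, 1[).

Definition Lp_circle (p : R) (F : R -> R[i]) : \bar R :=
  Lnorm circle_measure p%:E (fun xi => (ComplexField.Normc.normc (F xi))%:E).

End HalfLine.

(* Main.v *)
(* Write B for the set, s(n) for psi(n) (made constant for small n) and f for the sum
   with coefficients a_n. Since - phi_1'' dominates x^(- kappa) for some kappa < 2,
   van der Corput's inequality, applied after a Fejer approximation of the sawtooth,
   gives sum_(n <= N) (1_B(n) - s(n)) e(n xi) = O(N^(1 - chi)) uniformly in xi. By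
   partial summation the same holds, up to a factor 1 / s(N), with the weights
   w = 1_B / s - 1.

   Let X be the integral of |f|^2 over {|f| > lam} with lam = |B_N| N^(-eta). By
   duality and AM-GM, 2 X <= sum_(B_N) s + sum_(B_N) |g^(n)|^2 / s(n) for g the
   restriction of f to that set. Splitting 1_B / s = 1 + w, Bessel bounds the first part
   of the last sum by X, and the power saving bounds the second by X / 2. Hence
   X = O(sum_(B_N) s) = O(N s(N)^2) = O(|B_N|^2 / N); the last steps use that s is slowly
   varying with exponent zero, the effect of c_2 = 1. This gives
   ||f||_p^p = O(|B_N|^p / N) for p > 2, and |B_N|^p / N is a lower bound, up to a
   constant, for the sum with a_n = 1 because that sum has real part at least |B_N| / 2
   on an interval of length 1 / (8 N). For p = 2 the claim is Parseval's identity. *)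
Require Import Defs.
From mathcomp Require Import all_boot all_order all_algebra.
From mathcomp Require Import all_classical all_reals all_analysis.
From mathcomp Require Import complex ring lra zify.
Import Order.TTheory GRing.Theory Num.Theory.
Import numFieldNormedType.Exports.
Local Open Scope classical_set_scope.
Local Open Scope ring_scope.

(** * Exponential sums along concave phases *)

(** The obstacle is that [B] has density tending to zero while the a_n are arbitrary, so f itself
    resembles no model sum; only [B] is regular. Duality takes the a_n out of the way: after AM-GM
    with weight s only the quadratic form of 1_B / s remains, and this weight has mean one along the
    integers, which lets Bessel act as if every integer were present. Each use of the weight costs a
    factor 1 / s(N). As c_2 = 1 makes 1 / s(N) smaller than every positive power of N up to a
    constant, the power saving pays for it, at a threshold lam only slightly below |B_N|. Below lam
    the factor lam^(p-2) gains a power of N, which is what fails at p = 2. The condition kappa < 2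
    is the range where the second-derivative test, which gives N^(kappa/2), beats the trivial bound.
    Trigonometry stays real throughout: the estimates are for cosines with a free phase [al], and
    the phase - pi / 2 yields the sines. *)

Section Trig.
Set Implicit Arguments.
Unset Strict Implicit.
Variable R : realType.
Implicit Types x y t s d : R.
Local Notation frac := (@Defs.frac R).

Lemma two_pi_neq0 : 2 * pi != 0 :> R.
Proof. by rewrite mulf_neq0 ?pnatr_eq0 // gt_eqF // pi_gt0. Qed.

Lemma pi_lt4 : pi < 4 :> R.
Proof. have := pihalf_lt2 R; lra. Qed.

Lemma sin_le_id x : 0 <= x -> sin x <= x.
Proof.
move=> x0; have [|c _] := @MVT_segment R sin cos 0 x x0 (fun y _ => is_derive_sin y).
  by apply: continuous_subspaceT => y; exact: continuous_sin.
by rewrite sin0 !subr0 => ->; rewrite ler_piMl // cos_le1.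
Qed.

Lemma norm_sin_le x : `|sin x| <= `|x|.
Proof.
wlog x0 : x / 0 <= x.
  move=> H; have [/H//|/ltW x0] := leP 0 x.
  by rewrite -normrN -sinN -[`|x|]normrN H // oppr_ge0.
rewrite [`|x|]ger0_norm // ler_norml sin_le_id // andbT.
have [x1|x1] := leP x 2.
  by rewrite (le_trans _ (sin_ge0_pi _)) ?oppr_le0 // x0 (le_trans x1 (pi_ge2 R)).
by have := sin_geN1 x; lra.
Qed.

Lemma cos_ge_quad x : 1 - x ^+ 2 / 2 <= cos x.
Proof.
have -> : cos x = 1 - 2 * sin (x / 2) ^+ 2.
  rewrite {1}(_ : x = (x / 2) *+ 2); last by rewrite -mulr_natr; field.
  by rewrite cos_mulr2n cos2sin2; ring.
have : sin (x / 2) ^+ 2 <= (x / 2) ^+ 2.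
  by rewrite -(real_normK (num_real (sin _))) -(real_normK (num_real (x / 2))) lerXn2r ?nnegrE // norm_sin_le.
rewrite expr_div_n; lra.
Qed.

Lemma sin_ge_half x : 0 <= x <= 1 -> x / 2 <= sin x.
Proof.
move=> /andP[x0 x1]; have [|c] := @MVT_segment R sin cos 0 x x0 (fun y _ => is_derive_sin y).
  by apply: continuous_subspaceT => y; exact: continuous_sin.
rewrite in_itv /= sin0 !subr0 => /andP[c0 cx] ->.
have := cos_ge_quad c; nra.
Qed.

(** The worst case is t = d: the difference from it factors as a cosine times a sine, both
    nonnegative. At t = d, sin x >= x / 2 and pi >= 2 suffice. *)
Lemma sin_pi_ge d t : 0 <= d <= 1 / 4 -> d <= t <= 1 - d -> d <= sin (pi * t).
Proof.
move=> /andP[d0 d1] /andP[dt td].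
have hd : d <= sin (pi * d).
  have p2 := pi_ge2 R; have p4 := pi_lt4.
  apply: le_trans (_ : pi * d / 2 <= _); first by nra.
  by apply: sin_ge_half; apply/andP; split; nra.
apply: le_trans hd _; rewrite -subr_ge0.
have -> : sin (pi * t) - sin (pi * d) = 2 * (cos (pi * (t + d) / 2) * sin (pi * (t - d) / 2)).
  rewrite (_ : pi * t = pi * (t + d) / 2 + pi * (t - d) / 2); last by field.
  rewrite (_ : pi * d = pi * (t + d) / 2 - pi * (t - d) / 2); last by field.
  rewrite sinD sinB; ring.
have p0 := pi_gt0 R.
apply: mulr_ge0 => //; apply: mulr_ge0.
  apply: cos_ge0_pihalf; apply/andP; split; nra.
apply: sin_ge0_pi; apply/andP; split; nra.
Qed.

Lemma fracP x : exists2 k : int, x = frac x + k%:~R & 0 <= frac x < 1.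
Proof.
exists (Num.floor x); first by rewrite /frac subrK.
have := floor_itv x; rewrite /frac intrD => /andP[]; lra.
Qed.

Lemma frac_ge0 x : 0 <= frac x.
Proof. by have [k _ /andP[]] := fracP x. Qed.

Lemma frac_lt1 x : frac x < 1.
Proof. by have [k _ /andP[]] := fracP x. Qed.

Lemma fracE x (k : int) : k%:~R <= x < k%:~R + 1 -> frac x = x - k%:~R.
Proof. by move=> H; rewrite /frac (@floor_def _ _ k) // intrD. Qed.

Lemma frac_id x : 0 <= x < 1 -> frac x = x.
Proof. by move=> H; rewrite (@fracE _ 0) ?subr0 ?add0r. Qed.

Lemma frac_int x (k : int) : frac (x + k%:~R) = frac x.
Proof. by rewrite /frac floorDrz ?intr_int // intrKfloor intrD; ring. Qed.

Lemma cos_nat x (n : nat) : cos (x + 2 * pi * n%:R) = cos x.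
Proof. by rewrite mulr_natr mulr_natl (periodicn (@cosD2pi R)). Qed.

Lemma sin_nat x (n : nat) : sin (x + 2 * pi * n%:R) = sin x.
Proof. by rewrite mulr_natr mulr_natl (periodicn (@sinD2pi R)). Qed.

Lemma cos_int x (k : int) : cos (x + 2 * pi * k%:~R) = cos x.
Proof.
case: k => n; first exact: cos_nat.
by rewrite NegzE mulrNz mulrN -(cos_nat _ n.+1) subrK.
Qed.

Lemma sin_int x (k : int) : sin (x + 2 * pi * k%:~R) = sin x.
Proof.
case: k => n; first exact: sin_nat.
by rewrite NegzE mulrNz mulrN -(sin_nat _ n.+1) subrK.
Qed.

Lemma sin_sqr_frac x : sin (pi * x) ^+ 2 = sin (pi * frac x) ^+ 2.
Proof.
have E (z : R) : sin (pi * z) ^+ 2 = (1 - cos (2 * pi * z)) / 2.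
  have -> : 2 * pi * z = (pi * z) *+ 2 by rewrite -mulrA mulr_natl.
  by rewrite cos_mulr2n cos2sin2; field.
have [k ex _] := fracP x; rewrite [in LHS]ex.
by rewrite !E mulrDr cos_int.
Qed.

Lemma norm_sin_frac x : `|sin (pi * x)| = sin (pi * frac x).
Proof.
apply/eqP; rewrite -(@eqrXn2 _ 2) // ?real_normK ?num_real //; last first.
  have p0 := pi_gt0 R; have := frac_ge0 x; have := frac_lt1 x => a b.
  by apply: sin_ge0_pi; apply/andP; split; nra.
by rewrite sin_sqr_frac.
Qed.

(** Periodicity of the cotangent, cross-multiplied so that neither its poles nor the sign (-1)^k
    appear. *)
Lemma tan_int x (k : int) : cos (pi * x) * sin (pi * (x + k%:~R)) = sin (pi * x) * cos (pi * (x + k%:~R)).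
Proof.
have : sin (pi * k%:~R) = 0 :> R.
  have := sin_sqr_frac (0 + k%:~R); rewrite frac_int add0r frac_id ?lexx //= mulr0 sin0 expr0n /=.
  by move/eqP; rewrite sqrf_eq0 => /eqP.
by rewrite mulrDr sinD cosD => ->; ring.
Qed.

End Trig.

(** * Van der Corput's second-derivative test for sequences *)

Section VanDerCorput.
Set Implicit Arguments.
Unset Strict Implicit.
Variable R : realType.
Implicit Types x y t s d mu : R.
Local Notation frac := (@Defs.frac R).

Lemma abel_sum (w u : nat -> R) (a b : nat) : (a <= b)%N ->
  \sum_(a <= i < b) w i * u i =
  w b * (\sum_(a <= i < b) u i)
  - \sum_(a <= i < b) (\sum_(a <= j < i.+1) u j) * (w i.+1 - w i).
Proof.
elim: b => [|b IH]; first by rewrite leqn0 => /eqP ->; rewrite !big_geq // mulr0 subr0.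
rewrite leq_eqVlt => /orP[/eqP ->|]; first by rewrite !big_geq // mulr0 subr0.
rewrite ltnS => ab; rewrite !(big_nat_recr b) //= IH //; ring.
Qed.

Lemma abel_bound (w u : nat -> R) (K : R) (a b : nat) : (a <= b)%N ->
  (forall n, (a <= n <= b)%N -> `|\sum_(a <= i < n) u i| <= K) ->
  `|\sum_(a <= i < b) w i * u i|
    <= K * (`|w b| + \sum_(a <= i < b) `|w i.+1 - w i|).
Proof.
move=> ab HK; rewrite abel_sum // mulrDr.
apply: le_trans (ler_normB _ _) _; apply: lerD.
  by rewrite normrM mulrC ler_wpM2r // HK // ab leqnn.
apply: le_trans (ler_norm_sum _ _ _) _; rewrite mulr_sumr.
rewrite big_nat [leRHS]big_nat; apply: ler_sum => i /andP[ai ib].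
by rewrite normrM ler_wpM2r // HK // ib ltnW.
Qed.

Lemma variation_nonincreasing (w : nat -> R) (a b : nat) : (a <= b)%N ->
  (forall n, (a <= n < b)%N -> w n.+1 <= w n) ->
  \sum_(a <= i < b) `|w i.+1 - w i| = w a - w b.
Proof.
move=> ab hw; rewrite -opprB -(telescope_sumr _ ab) -sumrN.
by apply: eq_big_nat => i /hw wi; rewrite distrC ger0_norm ?opprB // subr_ge0.
Qed.

Definition clamp d t := Num.max d (Num.min t (1 - d)).

Lemma clamp_id d t : d <= t <= 1 - d -> clamp d t = t.
Proof. by move=> /andP[dt td]; rewrite /clamp min_l // max_r. Qed.

Lemma clampP d t : d <= 1 / 4 -> d <= clamp d t <= 1 - d.
Proof.
move=> d1; rewrite /clamp le_max lexx /= ge_max ge_min lexx orbT andbT; lra.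
Qed.

Lemma clamp_le d s t : s <= t -> clamp d s <= clamp d t.
Proof. by move=> st; rewrite /clamp le_max2 // le_min2. Qed.

(** The cotangent of pi t truncated at height 1 / d: clamping the fractional part keeps the quotient
    away from its poles at the integers. *)
Definition cotc d t := cos (pi * clamp d (frac t)) / sin (pi * clamp d (frac t)).

Lemma cotc_bound d t : 0 < d <= 1 / 4 -> `|cotc d t| <= d^-1.
Proof.
move=> /andP[d0 d1]; have h := clampP (frac t) d1.
have hs : d <= sin (pi * clamp d (frac t)) by apply: sin_pi_ge => //; rewrite (ltW d0).
rewrite /cotc normrM normfV (ger0_norm (le_trans (ltW d0) hs)) -[leRHS]mul1r.
apply: ler_pM => //; first by rewrite invr_ge0 (le_trans (ltW d0)).
  exact: cos_max.
by rewrite lef_pV2 // posrE (lt_le_trans d0).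
Qed.

Lemma cotc_decr d s t : 0 < d <= 1 / 4 -> frac s <= frac t -> cotc d t <= cotc d s.
Proof.
move=> /andP[d0 d1] st; have := clampP (frac t) d1; have := clampP (frac s) d1.
have := clamp_le d st; rewrite /cotc.
move: (clamp d (frac s)) (clamp d (frac t)) => {st}s {}t st hs ht.
have s0 : 0 < sin (pi * s) by apply: (lt_le_trans d0); apply: sin_pi_ge => //; rewrite (ltW d0).
have t0 : 0 < sin (pi * t) by apply: (lt_le_trans d0); apply: sin_pi_ge => //; rewrite (ltW d0).
rewrite ler_pdivrMr // mulrAC ler_pdivlMr // -subr_ge0.
have -> : cos (pi * s) * sin (pi * t) - cos (pi * t) * sin (pi * s) = sin (pi * (t - s)).
  by rewrite mulrBr sinB; ring.
have p0 := pi_gt0 R; apply: sin_ge0_pi; apply/andP; split; nra.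
Qed.

(* The clamped cotangent is a step function minus a nondecreasing one, so along
   a monotone sequence its variation is of order 1 / d per unit of range. *)
Lemma cotc_shift_nondecr d s t : 0 < d <= 1 / 4 -> s <= t ->
  2 / d * (Num.floor s)%:~R - cotc d s <= 2 / d * (Num.floor t)%:~R - cotc d t.
Proof.
move=> hd st; have /andP[d0 d1] := hd.
have := le_floor st; rewrite le_eqVlt => /orP[/eqP e|].
  rewrite e lerD2l lerN2; apply: cotc_decr => //.
  by rewrite /Defs.frac e lerD2r.
rewrite -lez1D -(ler_int R) intrD => h.
have := cotc_bound s hd; have := cotc_bound t hd.
rewrite !ler_norml => /andP[t1 t2] /andP[s1 s2].
have : 2 / d * (1 + (Num.floor s)%:~R) <= 2 / d * (Num.floor t)%:~R.
  by apply: ler_wpM2l => //; rewrite divr_ge0 // ltW.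
rewrite mulrDr mulr1; lra.
Qed.

Lemma floor_diff s t : s <= t -> (Num.floor t)%:~R - (Num.floor s)%:~R <= t - s + 1 :> R.
Proof.
move=> st; have := floor_itv t; have := floor_itv s; rewrite !intrD; lra.
Qed.

(** Both [F] and [V] are nonincreasing along [th] and differ by the cotangent, so the variation is
    at most the sum of their total changes. The floor changes by at most the range plus one, which
    puts the 6 beside 4 times the range. *)
Lemma cotc_variation d (th : nat -> R) (a b : nat) : 0 < d <= 1 / 4 -> (a <= b)%N ->
  (forall n, (a <= n < b)%N -> th n.+1 <= th n) ->
  \sum_(a <= i < b) `|cotc d (th i.+1) - cotc d (th i)|
    <= (4 * (th a - th b) + 6) / d.
Proof.
move=> hd ab hth; have /andP[d0 d1] := hd.
pose F n := 2 / d * (Num.floor (th n))%:~R.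
pose V n := F n - cotc d (th n).
have d2 : 0 <= 2 / d by rewrite divr_ge0 // ltW.
have hF n : (a <= n < b)%N -> F n.+1 <= F n.
  by move=> /hth h; apply: ler_wpM2l; rewrite // ler_int le_floor.
have hV n : (a <= n < b)%N -> V n.+1 <= V n.
  by move=> /hth h; apply: cotc_shift_nondecr.
apply: (@le_trans _ _ (\sum_(a <= i < b) (`|F i.+1 - F i| + `|V i.+1 - V i|))).
  apply: ler_sum => i _; apply: le_trans (ler_normB _ _).
  by rewrite le_eqVlt; apply/orP; left; apply/eqP; congr `|_|; rewrite /V; ring.
rewrite big_split /= (variation_nonincreasing ab hF) (variation_nonincreasing ab hV).
have thab : th b <= th a.
  rewrite -subr_ge0 -(variation_nonincreasing ab hth); exact: sumr_ge0.
have hFF : F a - F b <= 2 / d * (th a - th b + 1).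
  by rewrite /F -mulrBr ler_wpM2l // floor_diff.
have := cotc_bound (th a) hd; have := cotc_bound (th b) hd.
rewrite !ler_norml => /andP[t1 t2] /andP[s1 s2].
have -> : (4 * (th a - th b) + 6) / d = 2 * (2 / d * (th a - th b + 1)) + 2 * d^-1.
  by field; rewrite gt_eqF.
rewrite /V; lra.
Qed.

(* [w * floor x + min (frac x) w] measures the part of [0, x] lying within [w]
   to the right of an integer; it grows by [mu] at each near-integral [th n]. *)
Lemma near_integer_count d mu (th : nat -> R) (a b : nat) :
  0 < mu -> 0 < d -> 2 * d + mu < 1 -> (a <= b)%N ->
  (forall n, (a <= n < b)%N -> mu <= th n - th n.+1) ->
  \sum_(a <= n < b) (~~ (d <= frac (th n) <= 1 - d))%:R * mu
    <= (2 * d + mu) * (th a - th b + 2).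
Proof.
move=> mu0 d0 hd ab hth; set w := 2 * d + mu.
have w0 : 0 < w by rewrite /w; lra.
pose P t := w * (Num.floor t)%:~R + Num.min (frac t) w.
have P_le s t : s <= t -> P s <= P t.
  move=> st; have := le_floor st; rewrite le_eqVlt => /orP[/eqP e|].
    by rewrite /P e lerD2l le_min2 // /Defs.frac e lerD2r.
  rewrite -lez1D -(ler_int R) intrD => h; rewrite /P.
  have : w * (1 + (Num.floor s)%:~R) <= w * (Num.floor t)%:~R by rewrite ler_wpM2l // ltW.
  have : Num.min (frac s) w <= w by rewrite ge_min lexx orbT.
  have : 0 <= Num.min (frac t) w by rewrite le_min frac_ge0 ltW.
  rewrite mulrDr mulr1; lra.
pose x n := th n + d + mu.
apply: (@le_trans _ _ (\sum_(a <= n < b) (P (x n) - P (x n.+1)))).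
  rewrite big_nat [leRHS]big_nat; apply: ler_sum => n /hth hn.
  have hP : P (x n.+1) <= P (x n - mu) by apply: P_le; rewrite /x; lra.
  have [good|bad] := boolP (_ <= _ <= _); rewrite ?mul0r ?mul1r /=.
    by rewrite subr_ge0 (le_trans hP) // P_le //; lra.
  have [k ek /andP[f0 f1]] := fracP (th n).
  suff [k' /andP[l1 l2]] : exists k' : int, k'%:~R <= th n + d < k'%:~R + 2 * d.
    have E1 : frac (x n - mu) = x n - mu - k'%:~R by apply: fracE; rewrite /x; lra.
    have E2 : frac (x n) = x n - k'%:~R by apply: fracE; rewrite /x; lra.
    have F1 : Num.floor (x n - mu) = k' by apply: floor_def; rewrite intrD /x; lra.
    have F2 : Num.floor (x n) = k' by apply: floor_def; rewrite intrD /x; lra.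
    apply: le_trans (lerB _ hP); last exact: lexx.
    rewrite /P E1 E2 F1 F2 !min_l ?opprD /x /w; lra.
  move: bad; rewrite negb_and -!ltNge => /orP[h|h].
    by exists k; lra.
  by exists (k + 1); rewrite intrD; lra.
rewrite (telescope_sumr_eq (fun n => - P (x n))) //; last first.
  by move=> i _; rewrite opprK addrC.
rewrite opprK addrC /P.
have xab : x b <= x a.
  rewrite /x !lerD2r -subr_ge0 -(@variation_nonincreasing th) //; first exact: sumr_ge0.
  by move=> n /hth; lra.
have : w * ((Num.floor (x a))%:~R - (Num.floor (x b))%:~R) <= w * (x a - x b + 1).
  by rewrite ler_wpM2l ?floor_diff // ltW.
have : Num.min (frac (x a)) w <= w by rewrite ge_min lexx orbT.
have : 0 <= Num.min (frac (x b)) w by rewrite le_min frac_ge0 ltW.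
rewrite /x !mulrDr !mulrN; lra.
Qed.

End VanDerCorput.

Section VdC2.
Set Implicit Arguments.
Unset Strict Implicit.
Variable R : realType.
Implicit Types x y t s d mu : R.
Local Notation frac := (@Defs.frac R).

(* cos u_n is split as (cos u_n - cos u_(n+1)) / 2 + (cos u_n + cos u_(n+1)) / 2,
   and the second part is cot ((u_(n+1) - u_n) / 2) (sin u_(n+1) - sin u_n) / 2. *)
Lemma cos_cotc_error d x t : 0 < d <= 1 / 4 ->
  `|cos (2 * pi * x) - (cos (2 * pi * x) - cos (2 * pi * (x + t))) / 2
    - cotc d t * (sin (2 * pi * (x + t)) - sin (2 * pi * x)) / 2|
  <= 5 * (~~ (d <= frac t <= 1 - d))%:R.
Proof.
move=> hd; have /andP[d0 d1] := hd.
have -> : cos (2 * pi * x) - (cos (2 * pi * x) - cos (2 * pi * (x + t))) / 2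
    - cotc d t * (sin (2 * pi * (x + t)) - sin (2 * pi * x)) / 2
  = cos (pi * (2 * x + t)) * (cos (pi * t) - cotc d t * sin (pi * t)).
  rewrite (_ : 2 * pi * (x + t) = pi * (2 * x + t) + pi * t); last by ring.
  rewrite (_ : 2 * pi * x = pi * (2 * x + t) - pi * t); last by ring.
  by rewrite !(cosD, sinD, cosN, sinN); field.
have [good|bad] := boolP (_ <= _ <= _); rewrite /= ?mulr0 ?mulr1.
  suff -> : cos (pi * t) - cotc d t * sin (pi * t) = 0 by rewrite mulr0 normr0.
  rewrite /cotc clamp_id //; have [k ek _] := fracP t.
  have h : 0 < sin (pi * frac t) by apply: (lt_le_trans d0); apply: sin_pi_ge => //; rewrite (ltW d0).
  have := tan_int (frac t) k; rewrite -ek => e.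
  by rewrite mulrAC e; field; rewrite gt_eqF.
rewrite normrM -[leRHS]mul1r; apply: ler_pM => //; first exact: cos_max.
apply: le_trans (ler_normB _ _) _.
have hs : `|sin (pi * t)| <= 4 * d.
  rewrite norm_sin_frac; have p0 := pi_gt0 R; have p4 := pi_lt4 R.
  have f0 := frac_ge0 t; have f1 := frac_lt1 t.
  move: bad; rewrite negb_and -!ltNge => /orP[h|h].
    by apply: le_trans (sin_le_id _) _; nra.
  have -> : sin (pi * frac t) = sin (pi * (1 - frac t)).
    rewrite (_ : pi * (1 - frac t) = pi - pi * frac t); last by ring.
    by rewrite sinB sinpi cospi; ring.
  by apply: le_trans (sin_le_id _) _; nra.
have := cos_max (pi * t).
have : `|cotc d t * sin (pi * t)| <= d^-1 * (4 * d).
  by rewrite normrM ler_pM // cotc_bound.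
rewrite mulrCA mulVf ?gt_eqF //; lra.
Qed.

(** The cutoff d balances two losses. Steps of size at least d^2 leave about (range) d / d^2
    differences within d of an integer; elsewhere the cotangent, of height 1 / d, has variation of
    order (range) / d. *)
Lemma van_der_corput d (g : nat -> R) (a b : nat) (th := fun n => g n.+1 - g n) :
  0 < d <= 1 / 4 -> (a <= b)%N ->
  (forall n, (a <= n < b)%N -> d ^+ 2 <= th n - th n.+1) ->
  `|\sum_(a <= n < b) cos (2 * pi * g n)| <= 40 * (th a - th b + 1) / d.
Proof.
move=> hd ab hth; have /andP[d0 d1] := hd.
pose u n := 2 * pi * g n.
pose e n := cos (u n) - (cos (u n) - cos (u n.+1)) / 2
    - cotc d (th n) * (sin (u n.+1) - sin (u n)) / 2.
have dd : 0 < d ^+ 2 by rewrite exprn_gt0.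
have thd n : (a <= n < b)%N -> th n.+1 <= th n by move=> /hth; lra.
have thab : 0 <= th a - th b.
  by rewrite -(variation_nonincreasing ab thd); exact: sumr_ge0.
rewrite (_ : \sum_(a <= n < b) cos (2 * pi * g n) =
    \sum_(a <= n < b) e n + (cos (u a) - cos (u b)) / 2
    + (\sum_(a <= n < b) cotc d (th n) * (sin (u n.+1) - sin (u n))) / 2); last first.
  have -> : cos (u a) - cos (u b) = \sum_(a <= n < b) (cos (u n) - cos (u n.+1)).
    rewrite (telescope_sumr_eq (fun n => - cos (u n))) //; first by rewrite opprK addrC.
    by move=> n _; rewrite opprK addrC.
  rewrite !mulr_suml -!big_split /=; apply: eq_bigr => n _; rewrite /e; lra.
have B1 : `|\sum_(a <= n < b) e n| <= 5 * ((2 * d + d ^+ 2) * (th a - th b + 2) / d ^+ 2).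
  apply: le_trans (ler_norm_sum _ _ _) _.
  have hc : 2 * d + d ^+ 2 < 1 by nra.
  apply: (@le_trans _ _ (5 * \sum_(a <= n < b) (~~ (d <= frac (th n) <= 1 - d))%:R)).
    rewrite mulr_sumr; apply: ler_sum => n _.
    have := cos_cotc_error (g n) (th n) hd.
    by rewrite {1 3}/th [g n + _]addrC subrK.
  rewrite ler_pM2l // ler_pdivlMr // mulr_suml.
  exact: near_integer_count.
have B2 : `|(cos (u a) - cos (u b)) / 2| <= 1.
  have := cos_le1 (u a); have := cos_le1 (u b); have := cos_geN1 (u a); have := cos_geN1 (u b).
  rewrite ler_norml; lra.
(* The increments of the sine telescope, so their partial sums are at most 2 and only the variation
   and the last value of the cotangent enter. *)
have B3 : `|(\sum_(a <= n < b) cotc d (th n) * (sin (u n.+1) - sin (u n))) / 2|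
    <= (4 * (th a - th b) + 7) / d.
  rewrite normrM [`|2^-1|]gtr0_norm ?invr_gt0 // ler_pdivrMr //.
  apply: le_trans (@abel_bound _ _ _ 2 _ _ ab _) _.
    move=> n /andP[an _]; rewrite (telescope_sumr (fun n => sin (u n))) //.
    have := sin_le1 (u a); have := sin_le1 (u n); have := sin_geN1 (u a); have := sin_geN1 (u n).
    rewrite ler_norml; lra.
  have := cotc_variation hd ab thd; have := cotc_bound (th b) hd.
  have -> : (4 * (th a - th b) + 7) / d = (4 * (th a - th b) + 6) / d + d^-1.
    by field; rewrite gt_eqF.
  lra.
apply: le_trans (ler_normD _ _) _; apply: le_trans (lerD (ler_normD _ _) B3) _.
apply: le_trans (lerD (lerD B1 B2) (lexx _)) _.
have di : 1 <= d^-1 / 4.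
  by rewrite ler_pdivlMr // mul1r -[4]invrK lef_pV2 ?posrE ?invr_gt0 //; lra.
have -> : 5 * ((2 * d + d ^+ 2) * (th a - th b + 2) / d ^+ 2)
   = 5 * (th a - th b + 2) * (2 * d^-1 + 1).
  by field; rewrite gt_eqF.
set T := th a - th b in thab *; nra.
Qed.

End VdC2.

(** * Fejer approximation of the sawtooth *)

Section Fejer.
Set Implicit Arguments.
Unset Strict Implicit.
Variable R : realType.
Implicit Types x y t s d al : R.
Local Notation frac := (@Defs.frac R).

(** The kernel of mean one, 1 / M times the squared modulus of the sum of e(i t) over i < M; the
    double sum displays the frequencies i - j. *)
Definition fejer (M : nat) (t : R) : R :=
  M%:R^-1 * \sum_(i < M) \sum_(j < M) cos (2 * pi * ((i%:R - j%:R) * t)).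

Lemma fejerE M t : fejer M t = M%:R^-1 *
  ((\sum_(i < M) cos (2 * pi * (i%:R * t))) ^+ 2
   + (\sum_(i < M) sin (2 * pi * (i%:R * t))) ^+ 2).
Proof.
congr (_ * _); rewrite !expr2 !mulr_suml -big_split /=; apply: eq_bigr => i _.
rewrite !mulr_sumr -big_split /=; apply: eq_bigr => j _.
by rewrite -cosB; congr cos; ring.
Qed.

Lemma fejer_ge0 M t : 0 <= fejer M t.
Proof. by rewrite fejerE mulr_ge0 ?invr_ge0 // addr_ge0 // sqr_ge0. Qed.

(** Multiplication by 2 sin (pi t) makes the sum telescope. The phase [al] serves cosines and sines
    at once, and keeping the factor on the left avoids dividing by a sine that may vanish. *)
Lemma dirichlet_telescope M t al :
  2 * sin (pi * t) * (\sum_(k < M) cos (2 * pi * (k%:R * t) + al))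
  = sin ((2 * M%:R - 1) * (pi * t) + al) - sin (al - pi * t).
Proof.
elim: M => [|M IH].
  by rewrite big_ord0 !mulr0 sub0r mulN1r [al - _]addrC subrr.
rewrite big_ord_recr /= mulrDr IH -[M.+1%:R]natr1.
rewrite (_ : (2 * (M%:R + 1) - 1) * (pi * t) + al = 2 * pi * (M%:R * t) + al + pi * t); last by ring.
rewrite (_ : (2 * M%:R - 1) * (pi * t) + al = 2 * pi * (M%:R * t) + al - pi * t); last by ring.
by rewrite !(sinD (_ + al)) sinN cosN; ring.
Qed.

Lemma dirichlet_bound M t d al : 0 < d -> d <= `|sin (pi * t)| ->
  `|\sum_(k < M) cos (2 * pi * (k%:R * t) + al)| <= d^-1.
Proof.
move=> d0 hd; rewrite -[leRHS]mul1r ler_pdivlMr // mulrC.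
apply: (@le_trans _ _ (`|sin (pi * t) * \sum_(k < M) cos (2 * pi * (k%:R * t) + al)|)).
  by rewrite normrM ler_wpM2r.
have := dirichlet_telescope M t al; rewrite -mulrA.
set X := sin (pi * t) * _ => e; have -> : X = (2 * X) / 2 by field.
rewrite e; move: ((2 * M%:R - 1) * (pi * t) + al) (al - pi * t) => u v.
have := sin_le1 u; have := sin_le1 v; have := sin_geN1 u; have := sin_geN1 v.
rewrite ler_norml; lra.
Qed.

Lemma fejer_le M t d : 0 < d -> d <= `|sin (pi * t)| -> fejer M t <= 2 / (M%:R * d ^+ 2).
Proof.
move=> d0 hd; rewrite fejerE invfM mulrCA ler_wpM2l ?invr_ge0 //.
have sq x : `|x| <= d^-1 -> x ^+ 2 <= (d ^+ 2)^-1.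
  by move=> h; rewrite -[x ^+ 2]real_normK ?num_real // -exprVn lerXn2r ?nnegrE // invr_ge0 ltW.
rewrite [leRHS]mulr_natl mulr2n; apply: lerD; apply: sq.
  have := dirichlet_bound M 0 d0 hd.
  by congr (`|_| <= _); apply: eq_bigr => i _; rewrite addr0.
have := dirichlet_bound M (- (pi / 2)) d0 hd.
by congr (`|_| <= _); apply: eq_bigr => i _; rewrite cosBpihalf.
Qed.

Lemma fejer_int M t (k : int) : fejer M (t + k%:~R) = fejer M t.
Proof.
congr (_ * _); apply: eq_bigr => i _; apply: eq_bigr => j _.
rewrite -[RHS](cos_int _ ((Posz i - Posz j) * k)).
by congr cos; rewrite intrM intrB !pmulrn; ring.
Qed.

Lemma sin_ratio_neq0 (M : nat) (i j : 'I_M) : i != j ->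
  sin (pi * (- ((i%:R - j%:R) / M%:R))) != 0 :> R.
Proof.
have pos (a b : 'I_M) : (a < b)%N -> 0 < sin (pi * ((b%:R - a%:R) / M%:R)) :> R.
  move=> ab; have M0 : 0 < M%:R :> R by rewrite ltr0n (leq_ltn_trans _ (ltn_ord a)).
  have p0 := pi_gt0 R; apply: sin_gt0_pi.
  have h1 : 0 < (b%:R - a%:R) / M%:R :> R by rewrite divr_gt0 // subr_gt0 ltr_nat.
  have h2 : (b%:R - a%:R) / M%:R < 1 :> R.
    rewrite ltr_pdivrMr // mul1r ltrBlDr -natrD ltr_nat.
    by rewrite (leq_trans (ltn_ord b)) // leq_addr.
  by apply/andP; split; nra.
rewrite -val_eqE neq_ltn => /orP[] /pos h.
  by rewrite -mulNr opprB gt_eqF.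
by rewrite mulrN sinN oppr_eq0 gt_eqF.
Qed.

(** For distinct i and j the telescoped sum ends at the angle where it starts, modulo 2 pi, and the
    sine factor on its left is nonzero because |i - j| < M. *)
Lemma cos_average (M : nat) (i j : 'I_M) t :
  M%:R^-1 * \sum_(k < M) cos (2 * pi * ((i%:R - j%:R) * (t - k%:R / M%:R))) = (i == j)%:R.
Proof.
have M0 : M%:R != 0 :> R by rewrite pnatr_eq0 -lt0n (leq_ltn_trans _ (ltn_ord i)).
have [->|ij] := eqVneq i j.
  rewrite (eq_bigr (fun=> 1)) => [|k _]; last by rewrite subrr mul0r mulr0 cos0.
  by rewrite sumr_const card_ord -[1 *+ M]/(M%:R) mulVf.
apply/eqP; rewrite mulf_eq0; apply/orP; right; apply/eqP.
have := dirichlet_telescope M (- ((i%:R - j%:R) / M%:R)) (2 * pi * ((i%:R - j%:R) * t)).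
rewrite (_ : (2 * M%:R - 1) * (pi * - ((i%:R - j%:R) / M%:R)) + 2 * pi * ((i%:R - j%:R) * t)
  = 2 * pi * ((i%:R - j%:R) * t) - pi * - ((i%:R - j%:R) / M%:R) + 2 * pi * (Posz j - Posz i)%:~R); last first.
  by rewrite intrB !pmulrn; field.
rewrite sin_int subrr => /eqP; rewrite mulf_eq0 mulf_eq0 pnatr_eq0 /= (negbTE (sin_ratio_neq0 ij)) /=.
by move/eqP => h; rewrite -[RHS]h; apply: eq_bigr => k _; congr cos; field.
Qed.

(** M equally spaced nodes integrate trigonometric polynomials of degree below M exactly. The
    sawtooth can thus be smoothed by a finite sum instead of a convolution integral. *)
Lemma fejer_average M t : (0 < M)%N -> M%:R^-1 * \sum_(k < M) fejer M (t - k%:R / M%:R) = 1.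
Proof.
move=> M0; rewrite /fejer -mulr_sumr exchange_big /=.
have -> : M%:R^-1 * (M%:R^-1 * \sum_(i < M) \sum_(k < M) \sum_(j < M) cos (2 * pi * ((i%:R - j%:R) * (t - k%:R / M%:R))))
   = M%:R^-1 * \sum_(i < M) \sum_(j < M) (i == j)%:R.
  congr (_ * _); rewrite mulr_sumr; apply: eq_bigr => i _.
  by rewrite exchange_big /= mulr_sumr; apply: eq_bigr => j _; rewrite cos_average.
rewrite (eq_bigr (fun=> 1)) => [|i _].
  by rewrite sumr_const card_ord -[1 *+ M]/(M%:R) mulVf // pnatr_eq0 -lt0n.
by rewrite (bigD1 i) //= eqxx big1 ?addr0 // => j; rewrite eq_sym => /negbTE ->.
Qed.

(** The frequencies i - j come in opposite pairs, so the sine part cancels and the product is a mere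
    shift of phase. *)
Lemma fejer_mul_cos M t al : fejer M t * cos al =
  M%:R^-1 * \sum_(i < M) \sum_(j < M) cos (2 * pi * ((i%:R - j%:R) * t) + al).
Proof.
have H : \sum_(i < M) \sum_(j < M) sin (2 * pi * ((i%:R - j%:R) * t)) = 0.
  set S := LHS; suff : S = - S by lra.
  rewrite {1}/S exchange_big /= -sumrN; apply: eq_bigr => i _.
  by rewrite -sumrN; apply: eq_bigr => j _; rewrite -sinN; congr sin; ring.
rewrite /fejer -mulrA; congr (_ * _).
transitivity ((\sum_(i < M) \sum_(j < M) cos (2 * pi * ((i%:R - j%:R) * t))) * cos al
   - (\sum_(i < M) \sum_(j < M) sin (2 * pi * ((i%:R - j%:R) * t))) * sin al).
  by rewrite H mul0r subr0.
rewrite !mulr_suml -sumrB; apply: eq_bigr => i _.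
by rewrite !mulr_suml -sumrB; apply: eq_bigr => j _; rewrite cosD.
Qed.

(** A majorant of the indicator of the near-integers: for such t the Q angles are at most 8 Q d <=
    1, each cosine is at least 1 / 2, and the kernel is at least Q / 4. *)
Lemma fejer_near_integer (Q : nat) d t : (0 < Q)%N -> 8 * Q%:R * d <= 1 ->
  ~~ (d <= frac t <= 1 - d) -> 1 <= 4 / Q%:R * fejer Q t.
Proof.
move=> Q0 hd bad; have Qp : 0 < Q%:R :> R by rewrite ltr0n.
have [x [ex xd]] : exists x, fejer Q t = fejer Q x /\ `|x| <= d.
  have [k ek /andP[f0 f1]] := fracP t.
  move: bad; rewrite negb_and -!ltNge => /orP[h|h].
    exists (frac t); split; first by rewrite {1}ek fejer_int.
    by rewrite ger0_norm // ltW.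
  exists (frac t + (-1)%:~R); split; first by rewrite {1}ek !fejer_int.
  rewrite ler0_norm //; lra.
rewrite ex fejerE {t ex bad}.
have hc : Q%:R / 2 <= \sum_(i < Q) cos (2 * pi * (i%:R * x)).
  apply: (@le_trans _ _ (\sum_(i < Q) 2^-1)).
    by rewrite sumr_const card_ord mulr_natl.
  apply: ler_sum => i _; apply: le_trans (cos_ge_quad _).
  have iQ : i%:R <= Q%:R :> R by rewrite ler_nat ltnW.
  have i0 : 0 <= i%:R :> R by [].
  have : `|2 * pi * (i%:R * x)| <= 1.
    rewrite !normrM (ger0_norm (pi_ge0 R)) (ger0_norm i0) [`|2|]ger0_norm //.
    have p4 := pi_lt4 R; have p0 := pi_gt0 R; have x0 := normr_ge0 x.
    have h : i%:R * `|x| <= Q%:R * d by rewrite ler_pM.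
    have h0 : 0 <= i%:R * `|x| by rewrite mulr_ge0.
    nra.
  rewrite ler_norml; set y := 2 * pi * _; nra.
set S := \sum_(i < Q) cos _ in hc *; set S' := \sum_(i < Q) sin _.
have -> : 4 / Q%:R * (Q%:R^-1 * (S ^+ 2 + S' ^+ 2)) = 4 * (S ^+ 2 + S' ^+ 2) / Q%:R ^+ 2.
  by field; rewrite gt_eqF.
rewrite ler_pdivlMr ?exprn_gt0 // mul1r; have := sqr_ge0 S'; nra.
Qed.

Definition saw t := frac t - 1 / 2.

(** Discrete convolution of the sawtooth with the kernel over the nodes k / M, a trigonometric
    polynomial of degree below M. *)
Definition smooth_saw (M : nat) (t : R) : R :=
  M%:R^-1 * \sum_(k < M) saw (k%:R / M%:R) * fejer M (t - k%:R / M%:R).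

Lemma saw_le t : `|saw t| <= 1 / 2.
Proof. rewrite ler_norml /saw; have := frac_ge0 t; have := frac_lt1 t; lra. Qed.

Lemma saw_ratio (M : nat) (k : 'I_M) : saw (k%:R / M%:R) = k%:R / M%:R - 1 / 2.
Proof.
have M0 : 0 < M%:R :> R by rewrite ltr0n (leq_ltn_trans _ (ltn_ord k)).
by rewrite /saw frac_id // divr_ge0 // ltr_pdivrMr // mul1r ltr_nat ltn_ord.
Qed.

Lemma smooth_saw_bound M t : (0 < M)%N -> `|smooth_saw M t| <= 1 / 2.
Proof.
move=> M0; rewrite -[leRHS]mulr1 -[X in _ * X](fejer_average t M0) mulrCA normrM.
rewrite [`|_^-1|]ger0_norm ?invr_ge0 // ler_wpM2l ?invr_ge0 // mulr_sumr.
apply: le_trans (ler_norm_sum _ _ _) _; apply: ler_sum => k _.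
by rewrite normrM [`|fejer _ _|]ger0_norm ?fejer_ge0 // ler_wpM2r ?fejer_ge0 // saw_le.
Qed.

(** Nodes within d of the fractional part contribute at most d, because no jump lies in between; for
    the other nodes the distance lies between d and 1 - d, where the kernel is at most 2 / (M
    d^2). *)
Lemma smooth_saw_approx M t d : (0 < M)%N -> 0 < d <= 1 / 4 -> d <= frac t <= 1 - d ->
  `|saw t - smooth_saw M t| <= d + 2 / (M%:R * d ^+ 2).
Proof.
move=> M0 /andP[d0 d1] /andP[dt td].
have Mp : 0 < M%:R :> R by rewrite ltr0n.
have Mi : 0 <= M%:R^-1 :> R by rewrite invr_ge0 ltW.
have -> : saw t - smooth_saw M t =
   M%:R^-1 * \sum_(k < M) (saw t - saw (k%:R / M%:R)) * fejer M (t - k%:R / M%:R).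
  rewrite -{1}[saw t]mulr1 -[X in saw t * X](fejer_average t M0) mulrCA /smooth_saw -mulrBr mulr_sumr.
  by rewrite -sumrB; congr (_ * _); apply: eq_bigr => k _; ring.
have -> : d + 2 / (M%:R * d ^+ 2) = M%:R^-1 * \sum_(k < M)
    (d * fejer M (t - k%:R / M%:R) + 2 / (M%:R * d ^+ 2)).
  rewrite big_split /= -mulr_sumr sumr_const card_ord mulrDr [M%:R^-1 * (d * _)]mulrCA fejer_average // mulr1.
  by rewrite -[(2 / _) *+ M]mulr_natl mulKf // gt_eqF.
rewrite normrM ger0_norm // ler_wpM2l //.
apply: le_trans (ler_norm_sum _ _ _) _; apply: ler_sum => k _.
rewrite saw_ratio /saw normrM [`|fejer _ _|]ger0_norm ?fejer_ge0 //.
have [m em _] := fracP t.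
have -> : fejer M (t - k%:R / M%:R) = fejer M (frac t - k%:R / M%:R).
  by rewrite {1}em addrAC fejer_int.
move: (frac t) dt td => {em m}{}t dt td.
have -> : t - 1 / 2 - (k%:R / M%:R - 1 / 2) = t - k%:R / M%:R by ring.
have k0 : 0 <= k%:R / M%:R :> R by rewrite divr_ge0.
have k1 : k%:R / M%:R < 1 :> R by rewrite ltr_pdivrMr // mul1r ltr_nat ltn_ord.
move: (k%:R / M%:R) k0 k1 => r k0 k1.
have F0 := fejer_ge0 M (t - r).
have C0 : 0 <= 2 / (M%:R * d ^+ 2) by rewrite divr_ge0 // mulr_ge0 ?sqr_ge0 // ltW.
have [h|h] := leP `|t - r| d.
  by apply: le_trans (_ : d * fejer M (t - r) <= _); rewrite ?ler_wpM2r // lerDl.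
have n1 : `|t - r| <= 1 - d by rewrite ler_norml; lra.
have : fejer M (t - r) <= 2 / (M%:R * d ^+ 2).
  apply: fejer_le => //; rewrite norm_sin_frac.
  have hh : d <= sin (pi * `|t - r|) by apply: sin_pi_ge; rewrite ?(ltW d0) // (ltW h).
  rewrite -norm_sin_frac; apply: le_trans hh _.
  have [_|_] := ger0P (t - r); first exact: ler_norm.
  by rewrite mulrN sinN -normrN ler_norm.
nra.
Qed.

End Fejer.

(** * From exponential sums to sums of kernels and sawtooths *)

Section FejerSums.
Set Implicit Arguments.
Unset Strict Implicit.
Variable R : realType.
Implicit Types x y t d al : R.
Local Notation frac := (@Defs.frac R).

Lemma norm_double_sum_le (M : nat) (D T : R) (F : 'I_M -> 'I_M -> R) : 0 <= T ->
  (forall i, `|F i i| <= D) -> (forall i j, i != j -> `|F i j| <= T) ->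
  `|\sum_(i < M) \sum_(j < M) F i j| <= M%:R * (D + M%:R * T).
Proof.
move=> T0 hD hT.
apply: (@le_trans _ _ (\sum_(i < M) (D + M%:R * T))); last first.
  by rewrite sumr_const card_ord [leRHS]mulr_natl.
apply: le_trans (ler_norm_sum _ _ _) _; apply: ler_sum => i _.
rewrite (bigD1 i) //=; apply: le_trans (ler_normD _ _) _; apply: lerD (hD i) _.
apply: le_trans (ler_norm_sum _ _ _) _.
apply: (@le_trans _ _ (\sum_(j < M) T)); last by rewrite sumr_const card_ord mulr_natl.
rewrite [leRHS](bigD1 i) //= -[leLHS]add0r; apply: lerD => //.
by apply: ler_sum => j ji; apply: hT; rewrite eq_sym.
Qed.

Variables (z tau : nat -> R) (a b : nat) (T : R).
Hypothesis T0 : 0 <= T.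
Local Notation N := ((b - a)%N%:R : R).

Lemma sum_nat_const_le (u : nat -> R) (c : R) : (forall n, `|u n| <= c) ->
  `|\sum_(a <= n < b) u n| <= N * c.
Proof.
move=> h; apply: le_trans (ler_norm_sum _ _ _) _.
apply: (@le_trans _ _ (\sum_(a <= n < b) c)); first by apply: ler_sum.
by rewrite sumr_const_nat mulr_natl.
Qed.

(** The M diagonal pairs reproduce the plain sum of cosines. Each of the other pairs, fewer than
    M^2, is an exponential sum bounded by T, and the kernel divides by M. *)
Lemma fejer_sum_le (M : nat) (x : R) : (0 < M)%N ->
  (forall (k : int) al, k != 0 -> (`|k| < M)%N ->
     `|\sum_(a <= n < b) cos (2 * pi * (k%:~R * z n) + tau n + al)| <= T) ->
  `|\sum_(a <= n < b) fejer M (z n - x) * cos (tau n) - \sum_(a <= n < b) cos (tau n)|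
    <= M%:R * T.
Proof.
move=> M0 hT; have Mp : 0 < M%:R :> R by rewrite ltr0n.
pose F (i j : 'I_M) := \sum_(a <= n < b) cos (2 * pi * ((i%:R - j%:R) * (z n - x)) + tau n).
have -> : \sum_(a <= n < b) fejer M (z n - x) * cos (tau n) - \sum_(a <= n < b) cos (tau n)
   = M%:R^-1 * \sum_(i < M) \sum_(j < M) (if i == j then 0 else F i j).
  have -> : \sum_(a <= n < b) fejer M (z n - x) * cos (tau n)
      = M%:R^-1 * \sum_(i < M) \sum_(j < M) F i j.
    under eq_bigr do rewrite fejer_mul_cos.
    rewrite -mulr_sumr exchange_big /=; congr (_ * _); apply: eq_bigr => i _.
    by rewrite exchange_big.
  have -> : \sum_(a <= n < b) cos (tau n) =
      M%:R^-1 * \sum_(i < M) \sum_(j < M) (if i == j then \sum_(a <= n < b) cos (tau n) else 0).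
    rewrite [X in _ * X](eq_bigr (fun=> \sum_(a <= n < b) cos (tau n))) => [|i _].
      by rewrite sumr_const card_ord -[X in _ * X]mulr_natl mulKf // gt_eqF.
    by rewrite -big_mkcond (big_pred1 i) // => j; rewrite eq_sym.
  rewrite -mulrBr -sumrB; congr (_ * _); apply: eq_bigr => i _; rewrite -sumrB.
  apply: eq_bigr => j _; case: eqVneq => [->|]; last by rewrite subr0.
  by apply/eqP; rewrite subr_eq0; apply/eqP/eq_bigr => n _; rewrite subrr mul0r mulr0 add0r.
rewrite normrM [`|_^-1|]ger0_norm ?invr_ge0 // ler_pdivrMl //.
apply: le_trans (@norm_double_sum_le M 0 T _ T0 _ _) _.
- by move=> i; rewrite eqxx normr0.
- move=> i j ij; rewrite (negbTE ij) /F.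
  have := hT (Posz i - Posz j) (- (2 * pi * ((i%:R - j%:R) * x))); rewrite subr_eq0 eqz_nat.
  move/(_ ij) => h; apply: le_trans (h _); last by have := ltn_ord i; have := ltn_ord j; lia.
  rewrite le_eqVlt; apply/orP; left; apply/eqP; congr `|_|.
  by apply: eq_bigr => n _; congr cos; rewrite intrB !pmulrn; ring.
- by rewrite add0r.
Qed.
End FejerSums.

Section SawtoothSums.
Set Implicit Arguments.
Unset Strict Implicit.
Variable R : realType.
Implicit Types x y t d al : R.
Local Notation frac := (@Defs.frac R).

Lemma sum_saw_ratio (M : nat) : (0 < M)%N -> \sum_(k < M) saw (k%:R / M%:R) = - (1 / 2) :> R.
Proof.
move=> M0; have Mp : M%:R != 0 :> R by rewrite pnatr_eq0 -lt0n.
have S n : \sum_(k < n) (k%:R : R) = n%:R * (n%:R - 1) / 2.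
  elim: n => [|n IH]; first by rewrite big_ord0 !mul0r.
  by rewrite big_ord_recr /= IH -natr1; field.
under eq_bigr do rewrite saw_ratio.
rewrite sumrB -mulr_suml S sumr_const card_ord -[(1 / 2) *+ M]mulr_natl; field.
exact: Mp.
Qed.

Variables (z tau : nat -> R) (a b : nat) (T : R).
Hypothesis T0 : 0 <= T.
Local Notation N := ((b - a)%N%:R : R).

(** The sawtooth has mean - 1 / (2 M) over the nodes instead of zero; this is the origin of the term
    N / (2 M). *)
Lemma smooth_saw_sum_le (M : nat) : (0 < M)%N ->
  (forall (k : int) al, k != 0 -> (`|k| < M)%N ->
     `|\sum_(a <= n < b) cos (2 * pi * (k%:~R * z n) + tau n + al)| <= T) ->
  `|\sum_(a <= n < b) smooth_saw M (z n) * cos (tau n)| <= N / (2 * M%:R) + M%:R * T / 2.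
Proof.
move=> M0 hT; have Mp : 0 < M%:R :> R by rewrite ltr0n.
pose S0 := \sum_(a <= n < b) cos (tau n).
pose E (k : 'I_M) := \sum_(a <= n < b) fejer M (z n - k%:R / M%:R) * cos (tau n) - S0.
have hE k : `|E k| <= M%:R * T by exact: fejer_sum_le.
have -> : \sum_(a <= n < b) smooth_saw M (z n) * cos (tau n)
   = M%:R^-1 * (- (1 / 2) * S0 + \sum_(k < M) saw (k%:R / M%:R) * E k).
  under eq_bigr do rewrite /smooth_saw -mulrA mulr_suml.
  rewrite -mulr_sumr exchange_big /= -(sum_saw_ratio M0) mulr_suml -big_split /=.
  congr (_ * _); apply: eq_bigr => k _.
  rewrite -[RHS](mulrDr (saw (k%:R / M%:R))) /E [S0 + _]addrC subrK mulr_sumr.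
  by apply: eq_bigr => n _; rewrite mulrA.
have hS : `|S0| <= N.
  by rewrite -[leRHS]mulr1; apply: sum_nat_const_le => n; exact: cos_max.
have hk : `|\sum_(k < M) saw (k%:R / M%:R) * E k| <= M%:R * (1 / 2 * (M%:R * T)).
  apply: le_trans (ler_norm_sum _ _ _) _.
  apply: (@le_trans _ _ (\sum_(k < M) (1 / 2 * (M%:R * T)))).
    by apply: ler_sum => k _; rewrite normrM ler_pM // saw_le.
  by rewrite sumr_const card_ord [leRHS]mulr_natl.
rewrite normrM [`|_^-1|]ger0_norm ?invr_ge0 // ler_pdivrMl //.
apply: le_trans (ler_normD _ _) _; apply: le_trans (lerD (lexx _) hk) _.
rewrite normrM normrN [`|1 / 2|]ger0_norm //.
have -> : M%:R * (N / (2 * M%:R) + M%:R * T / 2) = N / 2 + M%:R * (1 / 2 * (M%:R * T)).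
  by field; rewrite gt_eqF.
lra.
Qed.

(* Away from the integers the sawtooth is within 1 / Q of its Fejer mean of
   order 512 Q^3, and the exceptional points are counted by the kernel of order Q. *)
Lemma saw_sum_le (Q : nat) : (0 < Q)%N ->
  (forall (k : int) al, k != 0 -> (`|k| < 512 * Q ^ 3)%N ->
     `|\sum_(a <= n < b) cos (2 * pi * (k%:~R * z n) + tau n + al)| <= T
  /\ `|\sum_(a <= n < b) cos (2 * pi * (k%:~R * z n) + al)| <= T) ->
  `|\sum_(a <= n < b) saw (z n) * cos (tau n)| <= 5 * N / Q%:R + 260 * Q%:R ^+ 3 * T.
Proof.
move=> Q0 hT; have Qp : 1 <= Q%:R :> R by rewrite ler1n.
(* With d = 1 / (8 Q) this order makes 2 / (M d^2) = 1 / (4 Q), so the pointwise error away from the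
   integers is 3 / (8 Q). *)
set M := (512 * Q ^ 3)%N in hT.
have M0 : (0 < M)%N by rewrite muln_gt0 expn_gt0 Q0.
have ME : M%:R = 512 * Q%:R ^+ 3 :> R by rewrite natrM natrX.
have [d [d8 d0]] : exists d, 8 * Q%:R * d = 1 /\ 0 < d <= 1 / 4.
  exists (8 * Q%:R)^-1; split; first by rewrite divff // gt_eqF //; lra.
  rewrite invr_gt0 -[1 / 4]invf_div lef_pV2 ?posrE; lra.
have dE : d + 2 / (M%:R * d ^+ 2) = 3 / 8 / Q%:R.
  have -> : d = (8 * Q%:R)^-1.
    by apply: (@mulfI _ (8 * Q%:R)); rewrite ?d8 ?divff // gt_eqF //; lra.
  by rewrite ME; field; rewrite gt_eqF //; lra.
pose bad n : R := (~~ (d <= frac (z n) <= 1 - d))%:R.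
have pt n : `|saw (z n) * cos (tau n) - smooth_saw M (z n) * cos (tau n)|
    <= 3 / 8 / Q%:R + 4 / Q%:R * fejer Q (z n).
  rewrite -mulrBl normrM; apply: (@le_trans _ _ (`|saw (z n) - smooth_saw M (z n)| * 1)).
    by rewrite ler_wpM2l // cos_max.
  rewrite mulr1.
  have Fp : 0 <= 4 / Q%:R * fejer Q (z n) by rewrite mulr_ge0 ?fejer_ge0 // divr_ge0.
  have [good|bd] := boolP (d <= frac (z n) <= 1 - d).
    by have := smooth_saw_approx M0 d0 good; rewrite dE; lra.
  have d8' : 8 * Q%:R * d <= 1 by rewrite d8.
  have := fejer_near_integer Q0 d8' bd.
  have := smooth_saw_bound (z n) M0; have := saw_le (z n).
  have : 0 <= 3 / 8 / Q%:R :> R by rewrite divr_ge0.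
  have := ler_normB (saw (z n)) (smooth_saw M (z n)); lra.
have hF : \sum_(a <= n < b) fejer Q (z n) <= N + Q%:R * T.
  have := @fejer_sum_le _ z (fun=> 0) a b T T0 Q 0 Q0.
  under eq_bigr do rewrite subr0 cos0 mulr1.
  under [X in _ - X]eq_bigr do rewrite cos0.
  rewrite sumr_const_nat => H.
  have {H} : `|\sum_(a <= i < b) fejer Q (z i) - N| <= Q%:R * T.
    apply: H => k al k0 kQ; under eq_bigr do rewrite addr0.
    apply: (hT k al k0 _).2; apply: leq_trans kQ _.
    rewrite /M -[X in (X <= _)%N]mul1n; apply: leq_mul => //.
    by rewrite -[X in (X <= _)%N]expn1 leq_pexp2l.
  by rewrite ler_norml => /andP[_]; lra.
have hS : `|\sum_(a <= n < b) smooth_saw M (z n) * cos (tau n)| <= N / (2 * M%:R) + M%:R * T / 2.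
  by apply: smooth_saw_sum_le => // k al k0 kM; exact: (hT k al k0 kM).1.
have hD : `|\sum_(a <= n < b) saw (z n) * cos (tau n) - \sum_(a <= n < b) smooth_saw M (z n) * cos (tau n)|
   <= N * (3 / 8 / Q%:R) + 4 / Q%:R * (N + Q%:R * T).
  rewrite -sumrB; apply: le_trans (ler_norm_sum _ _ _) _.
  apply: le_trans (ler_sum _ (fun n _ => pt n)) _.
  rewrite big_split /= sumr_const_nat -[X in X + _]mulr_natl lerD2l -mulr_sumr.
  by rewrite ler_wpM2l // divr_ge0.
have -> : \sum_(a <= n < b) saw (z n) * cos (tau n) =
  (\sum_(a <= n < b) saw (z n) * cos (tau n) - \sum_(a <= n < b) smooth_saw M (z n) * cos (tau n))
  + \sum_(a <= n < b) smooth_saw M (z n) * cos (tau n) by rewrite subrK.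
apply: le_trans (ler_normD _ _) _; apply: le_trans (lerD hD hS) _.
have N0 : 0 <= N by [].
have hM : N / (2 * M%:R) <= N / Q%:R / 2.
  have -> : N / Q%:R / 2 = N / (2 * Q%:R) by field; rewrite gt_eqF //; lra.
  have P1 : 0 < 2 * M%:R :> R by rewrite mulr_gt0 // ltr0n.
  have P2 : 0 < 2 * Q%:R :> R by lra.
  have P3 : Q%:R * 1 <= Q%:R * Q%:R ^+ 2 :> R by rewrite ler_wpM2l ?exprn_ege1.
  rewrite ler_wpM2l // lef_pV2 // ME; move: P3; rewrite -exprS; lra.
have -> : 4 / Q%:R * (N + Q%:R * T) = 4 * (N / Q%:R) + 4 * T by field; rewrite gt_eqF //; lra.
have Q3 : T <= Q%:R ^+ 3 * T by rewrite ler_peMl // exprn_ege1.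
have -> : N * (3 / 8 / Q%:R) = 3 / 8 * (N / Q%:R) by ring.
have -> : 5 * N / Q%:R = 5 * (N / Q%:R) by rewrite mulrA.
have NQ : 0 <= N / Q%:R by rewrite divr_ge0.
move: hM; move: (N / (2 * M%:R)) => X hM; rewrite ME; lra.
Qed.

End SawtoothSums.

(** * Phases with a linear term and a monotone shift *)

Section PhaseSums.
Set Implicit Arguments.
Unset Strict Implicit.
Variable R : realType.
Implicit Types x y t d al xi : R.
Local Notation frac := (@Defs.frac R).

Lemma cos_lipschitz x y : `|cos x - cos y| <= `|x - y|.
Proof.
have -> : cos x - cos y = - (2 * sin ((x + y) / 2) * sin ((x - y) / 2)).
  rewrite {1}(_ : x = (x + y) / 2 + (x - y) / 2); last by field.
  rewrite {3}(_ : y = (x + y) / 2 - (x - y) / 2); last by field.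
  by rewrite cosD cosB; ring.
rewrite normrN !normrM [`|2|]ger0_norm //.
have := norm_sin_le ((x - y) / 2); rewrite normrM [`|2^-1|]ger0_norm ?invr_ge0 //.
have := sin_max ((x + y) / 2); have := normr_ge0 (sin ((x + y) / 2)).
have := normr_ge0 (sin ((x - y) / 2)); have := normr_ge0 (x - y); nra.
Qed.

Lemma sin_lipschitz x y : `|sin x - sin y| <= `|x - y|.
Proof.
rewrite -!cosBpihalf; apply: le_trans (cos_lipschitz _ _) _.
by rewrite opprB addrA subrK.
Qed.

Variables (phi s : nat -> R) (a b : nat) (d Th : R).
Let th n := phi n.+1 - phi n.
Hypothesis ab : (a <= b)%N.
Hypothesis hd : 0 < d <= 1 / 4.
Hypothesis hconc : forall n, (a <= n < b)%N -> d ^+ 2 <= th n - th n.+1.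
Hypothesis hTh : forall n, (a <= n)%N -> 0 <= th n <= Th.

(** The cosine is even, so the phase may be multiplied by the sign of w and becomes concave. The
    linear term drops out of second differences, hence the uniformity in xi, and |w| >= 1 only
    enlarges them. *)
Lemma linear_phase_sum (w M xi al : R) (c : nat) : 1 <= `|w| <= M -> (a <= c <= b)%N ->
  `|\sum_(a <= n < c) cos (2 * pi * (w * phi n) + 2 * pi * (n%:R * xi) + al)|
    <= 40 * (M * Th + 1) / d.
Proof.
move=> /andP[w1 wM] /andP[ac cb]; have /andP[d0 d1] := hd.
have w0 : w != 0 by rewrite -normr_eq0 gt_eqF // (lt_le_trans _ w1).
pose g n := Num.sg w * (w * phi n + n%:R * xi + al / (2 * pi)).
have -> : \sum_(a <= n < c) cos (2 * pi * (w * phi n) + 2 * pi * (n%:R * xi) + al)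
    = \sum_(a <= n < c) cos (2 * pi * g n).
  apply: eq_bigr => n _; rewrite /g [X in _ = cos X]mulrCA cos_sg //; congr cos.
  by have := two_pi_neq0 R; move: (2 * pi) => q q0; field.
have gE n : g n.+1 - g n = `|w| * th n + Num.sg w * xi.
  by rewrite /g normrEsg /th -natr1; ring.
apply: le_trans (@van_der_corput _ d g a c hd ac _) _.
  move=> n /andP[an nc]; rewrite !gE.
  have := hconc (n := n); rewrite an (leq_trans nc cb) => /(_ isT).
  move=> h; rewrite [leRHS](_ : _ = `|w| * (th n - th n.+1)); last by ring.
  by have := exprn_ge0 2 (ltW d0); nra.
rewrite ler_pM2r ?invr_gt0 // ler_pM2l // !gE lerD2r.
rewrite [leLHS](_ : _ = `|w| * (th a - th c)); last by ring.
have /andP[a1 a2] := hTh (leqnn a); have /andP[c1 c2] := hTh ac.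
apply: le_trans (_ : `|w| * Th <= _).
  by rewrite ler_wpM2l //; lra.
by rewrite ler_wpM2r // (le_trans a1).
Qed.

Hypothesis s_noninc : forall n, s n.+1 <= s n.
Hypothesis s_itv : forall n, 0 <= s n <= 1.

(** The addition formula splits off the shift [v], a monotone sequence of total change at most 8 M.
    Its cosine and sine vary no more than [v], so partial summation removes each at the cost of a
    factor 1 + 8 M. *)
Lemma shifted_phase_sum (sg : bool) (k : int) (M xi al : R) :
  k != 0 -> `|k%:~R| <= M ->
  `|\sum_(a <= n < b) cos (2 * pi * (k%:~R * ((-1) ^+ sg * phi n - s n)) + 2 * pi * (n%:R * xi) + al)|
    <= 80 * (M * Th + 1) * (1 + 8 * M) / d.
Proof.
move=> k0 kM; have /andP[d0 d1] := hd.
have k1 : 1 <= `|k%:~R| :> R by rewrite -intr_norm -[1]/(1%:~R) ler_int -gtz0_ge1 normr_gt0.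
set K := 40 * (M * Th + 1) / d.
pose A n := 2 * pi * (k%:~R * (-1) ^+ sg * phi n) + 2 * pi * (n%:R * xi) + al.
have hw : 1 <= `|k%:~R * (-1) ^+ sg : R| <= M by rewrite normrM normr_sign mulr1 k1.
have hK (be : R) c : (a <= c <= b)%N -> `|\sum_(a <= n < c) cos (A n + be)| <= K.
  move=> hc; have := linear_phase_sum xi (al + be) hw hc.
  by congr (`|_| <= _); apply: eq_bigr => n _; rewrite /A addrA.
have K0 : 0 <= K by apply: le_trans (hK 0 a _) => //; rewrite leqnn.
pose v n := 2 * pi * (k%:~R * s n).
have hv n : `|v n.+1 - v n| <= 8 * M * (s n - s n.+1).
  have := s_noninc n => sn.
  rewrite /v -mulrBr -mulrBr !normrM (ger0_norm (pi_ge0 R)) [`|2|]ger0_norm //.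
  rewrite distrC [`|s n - _|]ger0_norm ?subr_ge0 // mulrA ler_wpM2r ?subr_ge0 //.
  have p4 := pi_lt4 R; have p0 := pi_gt0 R; have := normr_ge0 (k%:~R : R); nra.
have bound (w : nat -> R) (be : R) : (forall n, `|w n| <= 1) ->
    (forall n, `|w n.+1 - w n| <= `|v n.+1 - v n|) ->
    `|\sum_(a <= n < b) w n * cos (A n + be)| <= K * (1 + 8 * M).
  move=> w1 wv; apply: le_trans (@abel_bound _ _ _ K _ _ ab _) _.
    by move=> n hn; exact: hK.
  rewrite ler_wpM2l //; apply: lerD => //.
  apply: le_trans (_ : \sum_(a <= n < b) 8 * M * (s n - s n.+1) <= _).
    by apply: ler_sum => n _; apply: le_trans (wv n) (hv n).
  rewrite -mulr_sumr (telescope_sumr_eq (fun n => - s n)) //; last first.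
    by move=> n _; rewrite opprK addrC.
  have /andP[sa0 sa1] := s_itv a; have /andP[sb0 sb1] := s_itv b.
  have M0 : 0 <= M by lra.
  rewrite opprK; nra.
have -> : \sum_(a <= n < b) cos (2 * pi * (k%:~R * ((-1) ^+ sg * phi n - s n)) + 2 * pi * (n%:R * xi) + al)
  = \sum_(a <= n < b) cos (v n) * cos (A n + 0) + \sum_(a <= n < b) sin (v n) * cos (A n + - (pi / 2)).
  rewrite -big_split /=; apply: eq_bigr => n _.
  rewrite addr0 cosBpihalf -cosB -[LHS]cosN.
  by congr cos; rewrite /A /v; ring.
apply: le_trans (ler_normD _ _) _.
apply: le_trans (lerD (bound (fun n => cos (v n)) _ _ _) (bound (fun n => sin (v n)) _ _ _)) _.
- by move=> n; exact: cos_max.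
- by move=> n; exact: cos_lipschitz.
- by move=> n; exact: sin_max.
- by move=> n; exact: sin_lipschitz.
by rewrite /K le_eqVlt; apply/orP; left; apply/eqP; field; rewrite gt_eqF.
Qed.

End PhaseSums.

Section IndicatorSums.
Set Implicit Arguments.
Unset Strict Implicit.
Variable R : realType.
Implicit Types x y t d al xi : R.
Local Notation frac := (@Defs.frac R).

Lemma phase_constant (q Th A : R) : 1 <= q -> 0 <= Th -> 0 <= A ->
  (A * q * Th + 1) * (1 + 8 * (A * q)) <= (A + 1) * (8 * A + 1) * (Th + 1) * q ^+ 2.
Proof.
move=> q1 Th0 A0; have q0 : 0 <= q by lra.
have h1 : A * q * Th + 1 <= (A + 1) * (Th + 1) * q.
  have := mulr_ge0 q0 Th0; have := mulr_ge0 A0 q0; lra.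
have h2 : 1 + 8 * (A * q) <= (8 * A + 1) * q by lra.
have -> : (A + 1) * (8 * A + 1) * (Th + 1) * q ^+ 2 = (A + 1) * (Th + 1) * q * ((8 * A + 1) * q) by ring.
by apply: ler_pM => //; rewrite addr_ge0 // !mulr_ge0.
Qed.

(** Subtracting t lowers the fractional part by t, up to a jump of one exactly when it was below t;
    the jump is the indicator. *)
Lemma saw_shift y t : 0 <= t <= 1 -> (frac y < t)%R%:R - t = saw (y - t) - saw y.
Proof.
move=> /andP[t0 t1]; have [k ek /andP[f0 f1]] := fracP y; rewrite /saw.
have -> : frac (y - t) = frac y - t + (frac y < t)%R%:R.
  case: ltP => h /=.
    rewrite (@fracE _ _ (k - 1)) ?intrB; last by rewrite {1 2}ek; lra.
    by rewrite {1}ek; ring.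
  rewrite (@fracE _ _ k); last by rewrite {1 2}ek; lra.
  by rewrite {1}ek; ring.
ring.
Qed.

(** The 260 of [saw_sum_le] times the 80 of [shifted_phase_sum], with [phase_constant] taken at A =
    512, the coefficient in the kernel order 512 Q^3. *)
Definition phase_const : R := 260 * (80 * (512 + 1) * (8 * 512 + 1)).

Lemma phase_const_ge0 : 0 <= phase_const.
Proof. rewrite /phase_const; lra. Qed.

Variables (phi : nat -> R) (a b : nat) (d Th : R).
Let th n := phi n.+1 - phi n.
Hypothesis ab : (a <= b)%N.
Hypothesis hd : 0 < d <= 1 / 4.
Hypothesis hconc : forall n, (a <= n < b)%N -> d ^+ 2 <= th n - th n.+1.
Hypothesis hTh : forall n, (a <= n)%N -> 0 <= th n <= Th.

(** Frequencies up to 512 Q^3 cost Q^6 in [shifted_phase_sum], and [saw_sum_le] multiplies by Q^3;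
    this is the ninth power. *)
Lemma saw_phase_sum (s : nat -> R) (sg : bool) (xi al : R) (Q : nat) :
  (forall n, s n.+1 <= s n) -> (forall n, 0 <= s n <= 1) -> (0 < Q)%N ->
  `|\sum_(a <= n < b) saw ((-1) ^+ sg * phi n - s n) * cos (2 * pi * (n%:R * xi) + al)|
  <= 5 * (b - a)%:R / Q%:R + phase_const * (Th + 1) * Q%:R ^+ 9 / d.
Proof.
move=> s_noninc s_itv Q0; have /andP[d0 d1] := hd.
have Qp : 1 <= Q%:R ^+ 3 :> R by rewrite exprn_ege1 // ler1n.
set M := (512 * Q ^ 3)%N.
have ME : M%:R = 512 * Q%:R ^+ 3 :> R by rewrite natrM natrX.
have Th0 : 0 <= Th by have /andP[] := hTh (leqnn a); lra.
set T := 80 * (M%:R * Th + 1) * (1 + 8 * M%:R) / d.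
have T0 : 0 <= T.
  have h : 0 <= M%:R * Th by rewrite mulr_ge0.
  by rewrite divr_ge0 ?(ltW d0) // !mulr_ge0 // addr_ge0 // mulr_ge0.
have bnd (k : int) (x be : R) : k != 0 -> (`|k| < M)%N ->
    `|\sum_(a <= n < b) cos (2 * pi * (k%:~R * ((-1) ^+ sg * phi n - s n)) + 2 * pi * (n%:R * x) + be)| <= T.
  move=> k0 kM; apply: shifted_phase_sum => //.
  by rewrite -intr_norm -abszE -pmulrn ler_nat ltnW.
have := @saw_sum_le R (fun n => (-1) ^+ sg * phi n - s n) (fun n => 2 * pi * (n%:R * xi) + al) a b T T0 Q Q0.
move=> /(_ _)/le_trans; apply.
  move=> k be k0 kM; split.
    have := bnd k xi (al + be) k0 kM.
    by congr (`|_| <= _); apply: eq_bigr => n _; rewrite !addrA.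
  have := bnd k 0 be k0 kM.
  by congr (`|_| <= _); apply: eq_bigr => n _; rewrite !mulr0 addr0.
rewrite lerD2l (_ : Q%:R ^+ 9 = (Q%:R ^+ 3) ^+ 3); last by rewrite -exprM.
rewrite /T ME [leLHS]mulrA ler_pM2r ?invr_gt0 //.
move: (Q%:R ^+ 3) Qp => q Qp; have := phase_constant Qp Th0 (ler0n R 512).
have q0 : 0 <= 260 * q * 80 by lra.
rewrite /phase_const; move/(ler_wpM2l q0); move: (512 : R) => A h.
apply: le_trans (_ : 260 * q * 80 * ((A * q * Th + 1) * (1 + 8 * (A * q))) <= _).
  by rewrite le_eqVlt; apply/orP; left; apply/eqP; ring.
apply: le_trans h _.
by rewrite le_eqVlt; apply/orP; left; apply/eqP; ring.
Qed.

Lemma indicator_phase_sum (B : set nat) (s : nat -> R) (sg : bool) (xi al : R) (Q : nat) :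
  (forall n, s n.+1 <= s n) -> (forall n, 0 <= s n <= 1) -> (0 < Q)%N ->
  (forall n, (a <= n < b)%N -> (n \in B) = (frac ((-1) ^+ sg * phi n) < s n)) ->
  `|\sum_(a <= n < b) ((n \in B)%:R - s n) * cos (2 * pi * (n%:R * xi) + al)|
  <= 2 * (5 * (b - a)%:R / Q%:R + phase_const * (Th + 1) * Q%:R ^+ 9 / d).
Proof.
move=> s_noninc s_itv Q0 hB.
pose F s := \sum_(a <= n < b) saw ((-1) ^+ sg * phi n - s n) * cos (2 * pi * (n%:R * xi) + al).
have -> : \sum_(a <= n < b) ((n \in B)%:R - s n) * cos (2 * pi * (n%:R * xi) + al)
    = F s - F (fun=> 0).
  rewrite -sumrB; apply: eq_big_nat => n /hB ->.
  by rewrite -mulrBl saw_shift // subr0.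
apply: le_trans (ler_normB _ _) _.
have h1 := @saw_phase_sum s sg xi al Q s_noninc s_itv Q0.
have h2 := @saw_phase_sum (fun=> 0) sg xi al Q (fun=> lexx 0) _ Q0.
apply: le_trans (lerD h1 (h2 _)) _; first by move=> _; rewrite lexx ler01.
by rewrite [leRHS]mulr_natl mulr2n.
Qed.

End IndicatorSums.

Section PowerSaving.
Set Implicit Arguments.
Unset Strict Implicit.
Variable R : realType.
Local Notation frac := (@Defs.frac R).

Lemma power_saving (phi s : nat -> R) (B : set nat) (sg : bool) (kappa c Th : R) (n0 : nat)
    (th := fun n => phi n.+1 - phi n) :
  0 < kappa < 2 -> 0 < c -> (0 < n0)%N ->
  (forall n, (n0 <= n)%N -> c * n%:R `^ (- kappa) <= th n - th n.+1) ->
  (forall n, (n0 <= n)%N -> 0 <= th n <= Th) ->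
  (forall n, s n.+1 <= s n) -> (forall n, 0 <= s n <= 1) ->
  (forall n, (n0 <= n)%N -> (n \in B) = (frac ((-1) ^+ sg * phi n) < s n)) ->
  exists C chi : R, [/\ 0 < C, 0 < chi < 1 & forall (N : nat) (xi al : R), (0 < N)%N ->
    `|\sum_(1 <= n < N.+1) ((n \in B)%:R - s n) * cos (2 * pi * (n%:R * xi) + al)|
      <= C * N%:R `^ (1 - chi)].
Proof.
move=> /andP[k0 k2] c0 n00 hconc hTh s_noninc s_itv hB.
(* With Q of size N^chi and d of size N^(- kappa / 2) the error terms are N^(1 - chi) and N^(9 chi +
   kappa / 2); this value equates them. *)
pose chi : R := (2 - kappa) / 20.
have chi01 : 0 < chi < 1 by rewrite /chi; lra.
have /andP[chi0 chi1] := chi01.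
pose c' : R := Num.min (Num.sqrt c) (1 / 4).
have c'0 : 0 < c' by rewrite lt_min sqrtr_gt0 c0; lra.
have c'4 : c' <= 1 / 4 by rewrite ge_min lexx orbT.
have c'c : c' ^+ 2 <= c.
  rewrite -[leRHS](sqr_sqrtr (ltW c0)) lerXn2r ?nnegrE ?sqrtr_ge0 ?(ltW c'0) //.
  by rewrite ge_min lexx.
have Th0 : 0 <= Th by have /andP[] := hTh n0 (leqnn _); lra.
have [K KE] : exists K : R, K = phase_const R * (Th + 1) by eexists.
have K0 : 0 <= K by rewrite KE mulr_ge0 ?phase_const_ge0 //; lra.
pose C : R := n0%:R + 2 * (5 + K * 2 ^+ 9 / c').
have C1 : 0 <= K * 2 ^+ 9 / c' by rewrite divr_ge0 ?(ltW c'0) // mulr_ge0.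
exists C, chi; split => //.
  by rewrite /C; have : 0 <= n0%:R :> R by []; lra.
move=> N xi al N0.
have x1 : 1 <= N%:R :> R by rewrite ler1n.
have x0 : 0 < N%:R :> R by lra.
have px (r : R) : 0 < N%:R `^ r by rewrite powR_gt0.
have px1 : 1 <= N%:R `^ (1 - chi).
  by rewrite -[leLHS](powRr0 N%:R) ler_powR //; lra.
pose u n := ((n \in B)%:R - s n) * cos (2 * pi * (n%:R * xi) + al).
have u1 n : `|u n| <= 1.
  rewrite normrM -[leRHS]mulr1 ler_pM // ?cos_max //.
  by have := s_itv n; case: (n \in B) => /= /andP[]; rewrite ler_norml; lra.
have first m : (m <= n0)%N -> `|\sum_(1 <= n < m) u n| <= n0%:R * N%:R `^ (1 - chi).
  move=> mn; apply: le_trans (sum_nat_const_le 1 m u1) _.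
  rewrite mulr1 -[leLHS]mulr1; apply: ler_pM => //; rewrite ler_nat.
  by rewrite (leq_trans (leq_subr _ _)).
have [Nn|nN] := leqP N.+1 n0.
  apply: le_trans (first _ Nn) _; rewrite ler_wpM2r ?powR_ge0 // /C; lra.
have nN' := ltnW nN; rewrite (@big_cat_nat _ _ _ n0) //=.
apply: le_trans (ler_normD _ _) _; rewrite /C [leRHS]mulrDl; apply: lerD; first exact: first.
pose d : R := c' * N%:R `^ (- (kappa / 2)).
have dk : 0 < d <= 1 / 4.
  rewrite /d mulr_gt0 //=; apply: le_trans c'4; rewrite ler_piMr ?(ltW c'0) //.
  by rewrite -[leRHS](powRr0 N%:R) ler_powR //; lra.
have d0 : 0 < d by have /andP[] := dk.
pose Q := (Num.truncn (N%:R `^ chi)).+1.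
have /andP[Q1 Q2] := truncn_itv (ltW (px chi)).
have Qx : N%:R `^ chi <= Q%:R by rewrite ltW.
have Q2x : Q%:R <= 2 * N%:R `^ chi.
  have : 1 <= N%:R `^ chi by rewrite -[leLHS](powRr0 N%:R) ler_powR //; lra.
  rewrite /Q -natr1; lra.
have hconc' n : (n0 <= n < N.+1)%N -> d ^+ 2 <= th n - th n.+1.
  move=> /andP[h1 h2]; apply: le_trans (hconc n h1).
  rewrite /d exprMn -[(N%:R `^ _) ^+ 2]powR_mulrn ?powR_ge0 // -powRrM.
  rewrite (_ : - (kappa / 2) * 2%:R = - kappa); last by field.
  apply: ler_pM => //; first by rewrite sqr_ge0.
  rewrite !powRN lef_pV2 ?posrE ?powR_gt0 //; last by rewrite ltr0n (leq_trans n00).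
  by rewrite ge0_ler_powR ?nnegrE ?(ltW k0) // ler_nat -ltnS.
have hB' n : (n0 <= n < N.+1)%N -> (n \in B) = (frac ((-1) ^+ sg * phi n) < s n).
  by move=> /andP[h1 h2]; exact: hB.
apply: le_trans (@indicator_phase_sum R phi n0 N.+1 d Th nN' dk hconc' hTh B s sg xi al Q s_noninc s_itv isT hB') _.
rewrite -KE -[leRHS]mulrA ler_wpM2l // [leRHS]mulrDl; apply: lerD.
  rewrite -!mulrA ler_wpM2l // powRD; last by rewrite (gt_eqF x0) implybT.
  rewrite powRr1 ?(ltW x0) // powRN; apply: ler_pM => //.
  - by rewrite ler_nat leq_subLR addnC -addn1 leq_add2l.
  - by rewrite lef_pV2 ?posrE ?px // ltr0n.
rewrite -[leLHS]mulrA -[K * _ / c']mulrA -[leRHS]mulrA ler_wpM2l //.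
have -> : N%:R `^ (1 - chi) = (N%:R `^ chi) ^+ 9 * N%:R `^ (kappa / 2).
  rewrite -[(N%:R `^ _) ^+ 9]powR_mulrn ?powR_ge0 // -powRrM -powRD; last by rewrite (gt_eqF x0) implybT.
  by congr (_ `^ _); rewrite /chi; field.
have -> : d^-1 = c'^-1 * N%:R `^ (kappa / 2).
  by rewrite /d invfM powRN invrK.
have Q9 : Q%:R ^+ 9 <= 2 ^+ 9 * (N%:R `^ chi) ^+ 9.
  by rewrite -exprMn lerXn2r ?nnegrE // mulr_ge0 // powR_ge0.
have E0 : 0 <= c'^-1 * N%:R `^ (kappa / 2) by rewrite mulr_ge0 ?powR_ge0 // invr_ge0 ltW.
apply: le_trans (ler_wpM2r E0 Q9) _; move: (2 ^+ 9) ((N%:R `^ chi) ^+ 9) => x y.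
by rewrite le_eqVlt; apply/orP; left; apply/eqP; ring.
Qed.

End PowerSaving.

(** * Inverses of regularly varying functions *)

Section DerivFrom.
Set Implicit Arguments.
Unset Strict Implicit.
Variable R : realType.
Implicit Types (x y b : R) (f g : R -> R).

Lemma near_gt b x : b < x -> \forall y \near x, b < y.
Proof. by move=> bx; exact: (cvgr_gt x (@cvg_id _ (nbhs x)) b bx). Qed.

Lemma increments_interior x0 x : x0 < x -> increments x0 x = ((0 : R)^')%classic.
Proof.
move=> xx; apply/seteqP; split => P; rewrite /increments /within /=; last first.
  by apply: filterS => u Pu _.
move=> H; near=> u; apply: (near H u) => //=.
rewrite -lerBlDl; apply: ltW; near: u; apply: nbhs_dnbhs; apply: near_gt; lra.
Unshelve. all: by end_near. Qed.

Lemma diff_quotE f x : diff_quot f x = (fun u => u^-1 *: (f (u + x) - f x)).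
Proof. by apply/funext => u; rewrite /diff_quot [x + u]addrC mulrC. Qed.

Lemma deriv_from_interior x0 f x : x0 < x -> deriv_from x0 f x = f^`()%classic x.
Proof. by move=> xx; rewrite /deriv_from (increments_interior xx) diff_quotE. Qed.

Lemma differentiable_from_is_derive x0 f x : differentiable_from x0 f -> x0 < x ->
  is_derive x 1 f (deriv_from x0 f x).
Proof.
move=> hf xx; rewrite deriv_from_interior // derive1E; apply: DeriveDef => //.
have := hf x (ltW xx); rewrite (increments_interior xx) diff_quotE /derivable.
by under [X in _ -> cvg (X @ _)]funext do rewrite [_ *: 1]mulr1.
Qed.

Lemma is_derive_deriv_from x0 f x d : x0 < x -> is_derive x 1 f d -> deriv_from x0 f x = d.
Proof. by move=> xx hf; rewrite deriv_from_interior // derive1E derive_val. Qed.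

(** At the endpoint, boundedness of the one-sided difference quotient gives continuity from the
    right. This makes theta t / t integrable from x0 on. *)
Lemma differentiable_from_continuous x0 f : differentiable_from x0 f ->
  {within `[x0, +oo[, continuous f}.
Proof.
move=> hf; apply/continuous_within_itvcyP; split.
  move=> x; rewrite in_itv /= andbT => xx.
  have /@ex_derive := differentiable_from_is_derive hf xx.
  by move=> /derivable1_diffP /differentiable_continuous.
have /cvg_ex[l /cvgrPdist_le /(_ _ ltr01)] := hf x0 (lexx _).
rewrite /increments /within /= => /nbhs_ballP[e /= e0 he].
apply/cvgrPdist_lt => eps eps0; near=> y.
have y0 : x0 < y by near: y; exact: nbhs_right_gt.
have yx : 0 < y - x0 by rewrite subr_gt0.
have : `|l - diff_quot f x0 (y - x0)| <= 1.
  apply: he => /=; last 2 first.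
  - by rewrite gt_eqF.
  - by rewrite addrC subrK ltW.
  rewrite -ball_normE /= sub0r normrN gtr0_norm //.
  by rewrite ltrBlDl; near: y; apply: nbhs_right_lt; rewrite ltrDl.
rewrite /diff_quot [x0 + _]addrC subrK => hq.
have -> : f x0 - f y = - ((f y - f x0) / (y - x0) * (y - x0)).
  by rewrite divfK ?gt_eqF // opprB.
rewrite normrN normrM (gtr0_norm yx).
apply: (@le_lt_trans _ _ ((`|l| + 1) * (y - x0))).
  rewrite ler_wpM2r ?(ltW yx) //.
  set r := (f y - f x0) / _ in hq *.
  rewrite (_ : r = l - (l - r)); last by rewrite opprB addrC subrK.
  by apply: le_trans (ler_normB _ _) _; rewrite lerD2l.
have l1 : 0 < `|l| + 1 by have := normr_ge0 l; lra.
rewrite mulrC -ltr_pdivlMr // ltrBlDl; near: y; apply: nbhs_right_lt.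
by rewrite ltrDl divr_gt0.
Unshelve. all: by end_near. Qed.

Lemma is_derive_mul f g x a b : is_derive x 1 f a -> is_derive x 1 g b ->
  is_derive x 1 (fun t => f t * g t) (a * g x + f x * b).
Proof.
move=> hf hg; have h := is_deriveM hf hg.
have -> : a * g x + f x * b = f x *: b + g x *: a by rewrite addrC [a * _]mulrC.
exact: h.
Qed.

Lemma is_derive_inv f x a : is_derive x 1 f a -> f x != 0 ->
  is_derive x 1 (fun t => (f t)^-1) (- a / f x ^+ 2).
Proof.
move=> hf fx; have h := is_deriveV fx hf.
have -> : - a / f x ^+ 2 = - f x ^- 2 *: a by rewrite scaleNr mulNr mulrC.
exact: h.
Qed.

Lemma is_derive_near_eq f g x a : (\forall y \near x, f y = g y) ->
  is_derive x 1 g a -> is_derive x 1 f a.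
Proof.
move=> h hg; apply: DeriveDef.
  have h' : \forall y \near x, g y = f y by apply: filterS h => y ->.
  by apply: (near_eq_derivable h'); exact: ex_derive.
by rewrite (near_eq_derive _ h) derive_val.
Qed.

End DerivFrom.

Section ClassR.
Set Implicit Arguments.
Unset Strict Implicit.
Variable R : realType.
Implicit Types (x y b c : R) (h L th dth : R -> R).

Lemma exp_rep_is_derive x0 th L x : 0 < x0 -> differentiable_from x0 th ->
  exp_rep x0 th L -> x0 < x -> is_derive x 1 L (L x * (th x / x)).
Proof.
move=> x00 hth hL xx.
have xp : 0 < x by exact: lt_trans xx.
pose g t := th t / t.
have gder t : x0 < t -> derivable g t 1.
  move=> tx; have t0 : t != 0 by rewrite gt_eqF // (lt_trans x00).
  have h := is_derive_mul (differentiable_from_is_derive hth tx)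
    (is_derive_inv (is_derive_id t 1) t0).
  exact: (@ex_derive _ _ _ _ _ _ _ h).
have gcont t : x0 < t -> {for t, continuous g}.
  by move=> /gder/derivable1_diffP/differentiable_continuous.
(* The interval reaches to x + 1 so that x is interior and the fundamental theorem gives a two-sided
   derivative. *)
have ig : lebesgue_measure.-integrable `[x0, x + 1] (EFin \o g).
  apply: continuous_compact_integrable; first exact: segment_compact.
  have x1 : x0 < x + 1 by rewrite (lt_trans xx) // ltrDl.
  apply/(continuous_within_itvP _ x1); split.
  - by move=> t; rewrite in_itv /= => /andP[t0 _]; exact: gcont.
  - have /continuous_within_itvcyP[_ cth] := differentiable_from_continuous hth.
    apply: cvgM; first exact: cth.
    apply: cvgV; first by rewrite gt_eqF.
    exact: cvg_at_right_filter cvg_id.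
  - exact: cvg_at_left_filter (gcont _ x1).
have xlt : x < x + 1 by rewrite ltrDl.
have [dF F'] := continuous_FTC1_closed xlt ig xx (gcont _ xx).
have hF : is_derive x 1 (fun y => \int[lebesgue_measure]_(t in `[x0, y]) g t) (g x).
  by apply: DeriveDef; [exact: dF|rewrite -derive1E].
have hE := is_derive1_comp (is_derive_expR _) hF.
rewrite (hL x (ltW xx)); apply: is_derive_near_eq hE.
by apply: filterS (near_gt xx) => y /ltW /hL.
Qed.

(** Brings both classes to one form, x h'(x) / h(x) = c + th x. For c = 1 the limit of x th' is
    deduced from those of x th' / th and th. *)
Lemma class_R_log_derivative c x0 h : class_R c x0 h -> exists th dth : R -> R,
  [/\ forall x, x0 < x -> is_derive x 1 h (h x * ((c + th x) / x)),
      forall x, x0 < x -> is_derive x 1 th (dth x),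
      th x @[x --> +oo] --> (0 : R),
      x * dth x @[x --> +oo] --> (0 : R) &
      c = 1 -> [/\ forall x, x0 <= x -> 0 < th x,
        x * dth x / th x @[x --> +oo] --> (0 : R) &
        forall eps : R, 0 < eps -> exists C : R, 0 < C /\
           forall x, x0 <= x -> 1 <= C * th x * x `^ eps]].
Proof.
move=> [x00 hc hge hmon [L [hL hE]]].
suff [th [hrep hdiff]] : exists th : R -> R, [/\ exp_rep x0 th L, differentiable_from x0 th,
   th x @[x --> +oo] --> (0 : R),
   x * deriv_from x0 th x @[x --> +oo] --> (0 : R) &
   c = 1 -> [/\ forall x, x0 <= x -> 0 < th x,
        x * deriv_from x0 th x / th x @[x --> +oo] --> (0 : R) &
        forall eps : R, 0 < eps -> exists C : R, 0 < C /\
           forall x, x0 <= x -> 1 <= C * th x * x `^ eps]].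
  move=> h0 h1 h2; exists th, (deriv_from x0 th); split=> // x xx; last first.
    exact: differentiable_from_is_derive.
  have xp : 0 < x by exact: lt_trans xx.
  have hd := is_derive_mul (is_derive1_powR c xp) (exp_rep_is_derive x00 hdiff hrep xx).
  have -> : h x * ((c + th x) / x) = c * x `^ (c - 1) * L x + x `^ c * (L x * (th x / x)).
    rewrite (hE x (ltW xx)) powRD; last by rewrite (gt_eqF xp) implybT.
    by rewrite powR_inv1 ?(ltW xp) //; ring.
  apply: is_derive_near_eq hd.
  by apply: filterS (near_gt xx) => y /ltW /hE.
move: hL; case: eqP => [c1 [_ [th [hrep [[hd _] _] hpos _ [h1 h2 _ h3]]]]|c1 [th [hrep [[hd _] _] h1 h2 _]]]; last by exists th.
exists th; split => //.
have hx := cvgM h2 h1; rewrite mulr0 in hx;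
apply: cvg_trans (hx _); apply: near_eq_cvg.
near=> x; rewrite /= divfK // gt_eqF // hpos //.
Unshelve. all: by end_near. Qed.

End ClassR.

Section Inverse.
Set Implicit Arguments.
Unset Strict Implicit.
Variable R : realType.
Implicit Types (f g E : R -> R).

Lemma eventually_gt (P : R -> Prop) : (\forall x \near +oo, P x) ->
  forall A : R, exists2 X, A < X & forall x, X <= x -> P x.
Proof.
move=> [M [_ HM]] A; exists (Num.max A M + 1) => [|x hx].
  by rewrite ltr_pwDr // le_max lexx.
by apply: HM; apply: lt_le_trans hx; rewrite ltr_pwDr // le_max lexx orbT.
Qed.

Lemma cvg_eventually f (l : R) : f x @[x --> +oo] --> l -> forall eps, 0 < eps ->
  forall A : R, exists2 X, A < X & forall x, X <= x -> `|f x - l| < eps.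
Proof.
move=> /cvgrPdist_lt hf eps e0; apply: eventually_gt.
by apply: filterS (hf eps e0) => x; rewrite distrC.
Qed.

Lemma is_derive_continuous f (x d : R) : is_derive x 1 f d -> {for x, continuous f}.
Proof.
move=> h; apply: differentiable_continuous; apply/derivable1_diffP.
exact: (@ex_derive _ _ _ _ _ _ _ h).
Qed.

Lemma is_derive_within f (df : R -> R) (a b : R) :
  (forall x, a <= x -> is_derive x 1 f (df x)) -> {within `[a, b], continuous f}.
Proof.
move=> hf; apply: derivable_within_continuous => x; rewrite in_itv /= => /andP[ax _].
by have h := hf x ax; exact: (@ex_derive _ _ _ _ _ _ _ h).
Qed.

Lemma mean_value f (df : R -> R) (a b : R) : a <= b ->
  (forall x, a <= x -> is_derive x 1 f (df x)) ->
  exists2 c, a <= c <= b & f b - f a = df c * (b - a).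
Proof.
move=> ab hf; have [||c] := @MVT_segment R f df a b ab.
- by move=> x; rewrite in_itv /= => /andP[/ltW ax _]; exact: hf.
- exact: is_derive_within hf.
by rewrite in_itv /= => hc e; exists c.
Qed.

(* [E] is the elasticity x f'(x) / f(x). *)
Lemma elasticity_ge f E (X a : R) : 0 < X ->
  (forall x, X <= x -> 0 < f x) ->
  (forall x, X <= x -> is_derive x 1 f (f x * (E x / x))) ->
  (forall x, X <= x -> a <= E x) ->
  forall u v, X <= u <= v -> f u * u `^ (- a) <= f v * v `^ (- a).
Proof.
move=> X0 f0 hf hE u v /andP[Xu uv].
have hd x : u <= x -> is_derive x 1 (fun t => f t * t `^ (- a))
    (f x * (E x / x) * x `^ (- a) + f x * (- a * x `^ (- a - 1))).
  move=> ux; have Xx := le_trans Xu ux.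
  by apply: is_derive_mul; [exact: hf|apply: is_derive1_powR; exact: lt_le_trans Xx].
have [c /andP[uc cv] e] := mean_value uv hd.
rewrite -subr_ge0 e mulr_ge0 ?subr_ge0 //.
have Xc := le_trans Xu uc; have c0 : 0 < c by exact: lt_le_trans Xc.
rewrite powRD; last by rewrite (gt_eqF c0) implybT.
rewrite powR_inv1 ?(ltW c0) //.
rewrite [leRHS](_ : _ = f c * c `^ (- a) * c^-1 * (E c - a)); last by ring.
by rewrite !mulr_ge0 ?powR_ge0 ?invr_ge0 ?subr_ge0 ?hE // ltW // f0.
Qed.

(** The reciprocal of f has elasticity - E, and the lower bound applies to it. *)
Lemma elasticity_le f E (X a : R) : 0 < X ->
  (forall x, X <= x -> 0 < f x) ->
  (forall x, X <= x -> is_derive x 1 f (f x * (E x / x))) ->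
  (forall x, X <= x -> E x <= a) ->
  forall u v, X <= u <= v -> f v * v `^ (- a) <= f u * u `^ (- a).
Proof.
move=> X0 f0 hf hE u v uv; have /andP[Xu uv'] := uv.
have u0 : 0 < u by exact: lt_le_trans Xu.
have v0 : 0 < v by exact: lt_le_trans uv'.
have fu : 0 < f u by exact: f0.
have fv : 0 < f v by apply: f0; exact: le_trans uv'.
have := @elasticity_ge (fun x => (f x)^-1) (fun x => - E x) X (- a) X0 _ _ _ u v uv.
rewrite opprK => H; have {}H : (f u)^-1 * u `^ a <= (f v)^-1 * v `^ a.
  apply: H.
  - by move=> x /f0; rewrite invr_gt0.
  - move=> x Xx; have fx := f0 x Xx.
    have := is_derive_inv (hf x Xx); rewrite (gt_eqF fx) => /(_ isT).
    congr (is_derive _ _ _ _); field.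
    by rewrite !gt_eqF // (lt_le_trans X0).
  - by move=> x Xx; rewrite lerN2 hE.
rewrite !powRN -[f v]invrK -[f u]invrK -!invfM lef_pV2 ?posrE //.
  by rewrite mulr_gt0 ?invr_gt0 ?powR_gt0.
by rewrite mulr_gt0 ?invr_gt0 ?powR_gt0.
Qed.

End Inverse.

Section RegularInverse.
Set Implicit Arguments.
Unset Strict Implicit.
Variable R : realType.
Variables (c x0 X : R) (h th dth phi : R -> R).
Hypothesis x00 : 0 < x0.
Hypothesis X0 : x0 < X.
Hypothesis h_gt0 : forall x, x0 <= x -> 0 < h x.
Hypothesis h_der : forall x, x0 < x -> is_derive x 1 h (h x * ((c + th x) / x)).
Hypothesis th_der : forall x, x0 < x -> is_derive x 1 th (dth x).
Hypothesis th_itv : forall x, X <= x -> 1 / 2 <= c + th x <= 3.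
Hypothesis phiK : inverse_from x0 h phi.

Let X_gt0 : 0 < X. Proof. exact: lt_trans X0. Qed.

Lemma h_der_from x : X <= x -> is_derive x 1 h (h x * ((c + th x) / x)).
Proof. by move=> Xx; apply: h_der; exact: lt_le_trans Xx. Qed.

Lemma h_pos x : X <= x -> 0 < h x.
Proof. by move=> Xx; apply: h_gt0; apply: le_trans Xx; exact: ltW. Qed.

(** Elasticity at least 1 / 2 forces growth at least like the square root; the intermediate value
    theorem is applied up to a point [b] where that lower bound has reached y. *)
Lemma h_surjective y : h X < y -> exists2 x, X < x & h x = y.
Proof.
move=> hy.
have hX : 0 < h X by exact: h_pos.
have sX : 0 < X `^ (- (1 / 2)) by rewrite powR_gt0.
have grow x : X <= x -> h X * X `^ (- (1 / 2)) * x `^ (1 / 2) <= h x.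
  move=> Xx; have x_gt0 : 0 < x by exact: lt_le_trans Xx.
  have := @elasticity_ge R h (fun x => c + th x) X (1 / 2) X_gt0 h_pos h_der_from.
  move=> /(_ _ X x)H; have {}H := H (fun z hz => proj1 (andP (th_itv hz))).
  have := H (introT andP (conj (lexx _) Xx)).
  by rewrite [x `^ (- _)]powRN ler_pdivlMr ?powR_gt0.
pose k := h X * X `^ (- (1 / 2)).
have k0 : 0 < k by rewrite mulr_gt0.
have y0 : 0 < y by exact: lt_trans hy.
pose b := Num.max X ((y / k) `^ 2).
have Xb : X <= b by rewrite le_max lexx.
have hb : y <= h b.
  apply: le_trans (grow b Xb); rewrite mulrC -ler_pdivrMr //.
  have -> : y / k = ((y / k) `^ 2) `^ (1 / 2).
    rewrite -powRrM (_ : 2 * (1 / 2) = 1); last by field.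
    by rewrite powRr1 // ltW // divr_gt0.
  apply: ge0_ler_powR; rewrite ?nnegrE ?powR_ge0 //.
    by rewrite (le_trans (ltW X_gt0)).
  by rewrite /b le_max lexx orbT.
have hyb : Num.min (h X) (h b) <= y <= Num.max (h X) (h b).
  by rewrite ge_min (ltW hy) /= le_max hb orbT.
have [x] := IVT Xb (is_derive_within (b := b) h_der_from) hyb.
rewrite in_itv /= => /andP[Xx xb] e; exists x => //.
by rewrite lt_neqAle Xx andbT; apply: contraTneq hy => ->; rewrite e ltxx.
Qed.

Lemma phi_spec y : h X < y -> X < phi y /\ h (phi y) = y.
Proof.
move=> /h_surjective[x Xx <-]; rewrite phiK //.
by apply: ltW; exact: lt_trans Xx.
Qed.

Definition elast (x : R) := c + th x.
Definition dphi (y : R) := phi y / (y * elast (phi y)).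
(** This is x^2 h''(x) / h(x), found by differentiating h' = h elast / x; it has the sign of - phi''
    at h x. *)
Definition curv (x : R) := elast x * (elast x - 1) + x * dth x.

Lemma phi_der y : h X < y -> is_derive y 1 phi (dphi y).
Proof.
move=> hy; have [Xp e] := phi_spec hy.
have p0 : 0 < phi y by exact: lt_trans Xp.
have y0 : 0 < y by rewrite -e h_pos // ltW.
have /andP[t1 t2] := th_itv (ltW Xp).
have el0 : 0 < elast (phi y) by rewrite /elast; lra.
have hd := h_der_from (ltW Xp).
have := @is_derive_inverse R h phi _ (phi y) _ _ hd.
rewrite e (_ : (y * ((c + th (phi y)) / phi y))^-1 = dphi y); last first.
  by rewrite /dphi /elast; field; rewrite !gt_eqF.
apply.
- by apply: filterS (near_gt Xp) => x Xx; apply: phiK; apply: ltW; exact: lt_trans Xx.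
- apply: filterS (near_gt Xp) => x Xx.
  by apply: (@is_derive_continuous _ h x _ (h_der_from (ltW Xx))).
- by rewrite mulf_neq0 ?gt_eqF // divr_gt0.
Qed.

Lemma dphi_der y : h X < y ->
  is_derive y 1 dphi (- dphi y * curv (phi y) / (y * elast (phi y) ^+ 2)).
Proof.
move=> hy; have [Xp e] := phi_spec hy.
have p0 : 0 < phi y by exact: lt_trans Xp.
have y0 : 0 < y by rewrite -e h_pos // ltW.
have /andP[t1 t2] := th_itv (ltW Xp).
have el0 : 0 < elast (phi y) by rewrite /elast; lra.
have hp := phi_der hy.
have hth : is_derive y 1 (fun t => elast (phi t)) (dth (phi y) * dphi y).
  have h1 := is_derive1_comp (th_der (lt_trans X0 Xp)) hp.
  have h2 := is_deriveD (is_derive_cst c y 1) h1.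
  by rewrite add0r in h2; exact: h2.
have hm := is_derive_mul (is_derive_id y 1) hth.
have hn : y * elast (phi y) != 0 by rewrite mulf_neq0 ?gt_eqF.
have hv := is_derive_mul hp (is_derive_inv hm hn).
have -> : - dphi y * curv (phi y) / (y * elast (phi y) ^+ 2) =
  dphi y * (y * elast (phi y))^-1 + phi y * (- (1 * elast (phi y) + y * (dth (phi y) * dphi y)) / (y * elast (phi y)) ^+ 2).
  by rewrite /curv /dphi; field; rewrite !gt_eqF.
exact: hv.
Qed.

End RegularInverse.

Section InverseConcave.
Set Implicit Arguments.
Unset Strict Implicit.
Variable R : realType.

Section Differences.
Variables (phi dphi ddphi : R -> R) (Y k kappa : R).
Hypothesis phi_der : forall y, Y < y -> is_derive y 1 phi (dphi y).
Hypothesis dphi_der : forall y, Y < y -> is_derive y 1 dphi (ddphi y).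
Hypothesis dphi_gt0 : forall y, Y < y -> 0 < dphi y.
Hypothesis ddphi_le : forall y, Y < y -> k * y `^ (- kappa) <= - ddphi y.
Hypothesis k0 : 0 <= k.
Hypothesis kappa0 : 0 <= kappa.
Hypothesis Y0 : 0 <= Y.

Lemma dphi_nonincreasing u v : Y < u -> u <= v -> dphi v <= dphi u.
Proof.
move=> Yu uv; have hd x : u <= x -> is_derive x 1 dphi (ddphi x).
  by move=> ux; apply: dphi_der; exact: lt_le_trans ux.
have [z /andP[uz _] e] := mean_value uv hd.
have Yz : Y < z by exact: lt_le_trans uz.
rewrite -subr_le0 e mulr_le0_ge0 ?subr_ge0 // -oppr_ge0.
by apply: le_trans (ddphi_le Yz); rewrite mulr_ge0 ?powR_ge0.
Qed.

Lemma first_difference u : Y < u -> exists2 z, u <= z & phi (u + 1) - phi u = dphi z.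
Proof.
move=> Yu; have hd x : u <= x -> is_derive x 1 phi (dphi x).
  by move=> ux; apply: phi_der; exact: lt_le_trans ux.
have u1 : u <= u + 1 by rewrite lerDl.
have [z /andP[uz _] ->] := mean_value u1 hd; exists z => //.
by rewrite [u + 1]addrC addrK mulr1.
Qed.

(** The mean value theorem, once for phi (t + 1) - phi t and once for the derivative of phi, gives -
    phi''(w) with w <= u + 2 <= 3 u. *)
Lemma second_difference u : Y < u -> 1 <= u ->
  k * 3 `^ (- kappa) * u `^ (- kappa)
    <= (phi (u + 1) - phi u) - (phi (u + 1 + 1) - phi (u + 1)).
Proof.
move=> Yu u1.
have hd x : u <= x -> is_derive x 1 (fun t => phi (t + 1) - phi t) (dphi (x + 1) - dphi x).
  move=> ux; have Yx : Y < x by exact: lt_le_trans ux.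
  have Yx1 : Y < x + 1 by rewrite ltr_wpDr.
  have hs : is_derive x 1 (fun t : R => t + 1) 1.
    have := is_deriveD (is_derive_id x 1) (is_derive_cst (1 : R) x 1).
    by rewrite addr0.
  have hc := @is_derive1_comp R phi (fun t => t + 1) x _ _ (phi_der Yx1) hs.
  rewrite mulr1 in hc.
  exact: is_deriveB hc (phi_der Yx).
have uu1 : u <= u + 1 by rewrite lerDl.
have [z /andP[uz zu] e] := mean_value uu1 hd.
rewrite -opprB [X in _ <= - X]e [u + 1]addrC addrK mulr1 opprB.
have hd2 x : z <= x -> is_derive x 1 dphi (ddphi x).
  by move=> zx; apply: dphi_der; rewrite (lt_le_trans Yu) // (le_trans uz).
have zz1 : z <= z + 1 by rewrite lerDl.
have [w /andP[zw wz] e2] := mean_value zz1 hd2.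
rewrite -opprB e2 [z + 1]addrC addrK mulr1.
have Yw : Y < w by rewrite (lt_le_trans Yu) // (le_trans uz).
have u0 : 0 < u by exact: lt_le_trans u1.
have w0 : 0 < w by rewrite (lt_le_trans u0) // (le_trans uz).
apply: le_trans (ddphi_le Yw); rewrite -mulrA ler_wpM2l //.
rewrite -powRM ?(ltW u0) // !powRN lef_pV2 ?posrE ?powR_gt0 ?mulr_gt0 //.
rewrite ge0_ler_powR ?nnegrE ?(ltW w0) //; last by lra.
by rewrite mulr_ge0 // ltW.
Qed.

End Differences.

(** With E = [elast], - phi'' = phi curv / (y^2 E^3). From curv >= k1 x^(- 1/2) and E <= 3 it is at
    least of order phi^(1/2) / y^2; E <= 3 also gives h x <= C3 x^3, hence phi at least of order
    y^(1/3). The exponent is 1/6 - 2 = - 11/6, the same for all c in [1, 2). *)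
Lemma class_R_inverse_concave (c x0 : R) (h phi : R -> R) :
  1 <= c < 2 -> class_R c x0 h -> inverse_from x0 h phi ->
  exists (kappa k Th : R) (n0 : nat),
    [/\ 0 < kappa < 2, 0 < k, (0 < n0)%N /\ h x0 <= n0%:R,
      forall n, (n0 <= n)%N -> k * n%:R `^ (- kappa)
        <= (phi n.+1%:R - phi n%:R) - (phi n.+2%:R - phi n.+1%:R) &
      forall n, (n0 <= n)%N -> 0 <= phi n.+1%:R - phi n%:R <= Th].
Proof.
move=> /andP[c1 c2] hR phiK.
have [x00 _ hge _ _] := hR.
have [th [dth [hder thder hth hdth hc1]]] := class_R_log_derivative hR.
have h_gt0 x : x0 <= x -> 0 < h x by move=> /hge; apply: lt_le_trans.
have [X1 [k1 [X1x X11 k10 hcurv]]] : exists X k1 : R, [/\ x0 < X, 1 <= X, 0 < k1 &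
    forall x, X <= x -> (1 / 2 <= c + th x <= 3) /\ k1 * x `^ (- (1 / 2)) <= curv c th dth x].
  move: c1; rewrite le_eqVlt => /orP[/eqP ec|c1].
    have [thpos hq heps] := hc1 (esym ec).
    have e4 : 0 < 1 / 4 :> R by [].
    have [X2 X2g H2] := cvg_eventually hth e4 (Num.max x0 1).
    have [X3 X3g H3] := cvg_eventually hq e4 (Num.max X2 1).
    have e2 : 0 < 1 / 2 :> R by [].
    have [C [C0 HC]] := heps _ e2.
    exists X3, (2 * C)^-1.
    move: X2g X3g; rewrite !gt_max => /andP[a1 a2] /andP[a3 a4].
    split; [exact: lt_trans a3|exact: ltW|by rewrite invr_gt0 mulr_gt0|].
    move=> x xx; have x0x : x0 <= x by apply: ltW; rewrite (lt_trans a1) // (lt_le_trans a3).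
    have x_gt0 : 0 < x by exact: lt_le_trans x0x.
    have thx := thpos x x0x.
    have := H3 x xx; have := H2 x (le_trans (ltW a3) xx).
    rewrite !subr0 !ltr_norml => /andP[b1 b2] /andP[b3 b4].
    split; first by lra.
    (* For c = 1 the leading part c (c - 1) of the curvature vanishes. What is left has the size of
       th, which is positive and at least x^(- 1/2) / C. *)
    rewrite /curv /elast -ec.
    have -> : (1 + th x) * (1 + th x - 1) + x * dth x = th x * (1 + th x + x * dth x / th x).
      by field; rewrite gt_eqF.
    apply: (@le_trans _ _ (th x / 2)); last by rewrite ler_wpM2l ?(ltW thx) //; lra.
    rewrite powRN -invfM -[leRHS]invrK lef_pV2 ?posrE ?invr_gt0 ?mulr_gt0 ?powR_gt0 //.
    rewrite invfM invrK mulrC ler_pdivrMr //.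
    have := HC x x0x; lra.
  have d0 : 0 < (c - 1) / 8 by lra.
  have [X2 X2g H2] := cvg_eventually hth d0 (Num.max x0 1).
  have [X3 X3g H3] := cvg_eventually hdth d0 (Num.max X2 1).
  move: X2g X3g; rewrite !gt_max => /andP[a1 a2] /andP[a3 a4].
  exists X3, ((c - 1) / 2); split; [exact: lt_trans a3|exact: ltW|lra|].
  move=> x xx; have := H3 x xx; have := H2 x (le_trans (ltW a3) xx).
  rewrite !subr0 !ltr_norml => /andP[b1 b2] /andP[b3 b4].
  split; first by lra.
  have px : x `^ (- (1 / 2)) <= 1.
    by rewrite -[leRHS](powRr0 x) ler_powR //; lra.
  apply: (@le_trans _ _ ((c - 1) / 2)); first by rewrite ler_piMr //; lra.
  rewrite /curv /elast; nra.
have th_itv x (xx : X1 <= x) := proj1 (hcurv x xx).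
have X1_gt0 : 0 < X1 by exact: lt_le_trans X11.
pose Y := h X1.
have Y0 : 0 < Y by apply: h_gt0; exact: ltW.
pose C3 := h X1 * X1 `^ (- 3).
have C30 : 0 < C3 by rewrite mulr_gt0 // powR_gt0.
have hC3 x : X1 <= x -> h x <= C3 * x `^ 3.
  move=> xx; have x_gt0 : 0 < x by exact: lt_le_trans xx.
  have := @elasticity_le R h (fun x => c + th x) X1 3 X1_gt0 (h_pos X1x h_gt0) (h_der_from X1x hder)
    (fun z hz => proj2 (andP (th_itv z hz))) X1 x (introT andP (conj (lexx _) xx)).
  by rewrite [x `^ (- _)]powRN ler_pdivrMr ?powR_gt0.
have spec y (hy : Y < y) := phi_spec x00 X1x h_gt0 hder th_itv phiK hy.
have el y : Y < y -> 1 / 2 <= elast c th (phi y) <= 3.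
  by move=> /spec[Xp _]; apply: th_itv; exact: ltW.
have pder y (hy : Y < y) := phi_der x00 X1x h_gt0 hder th_itv phiK hy.
have ppder y (hy : Y < y) := dphi_der x00 X1x h_gt0 hder thder th_itv phiK hy.
have ypos y : Y < y -> 0 < y by move=> hy; exact: lt_trans hy.
have ppos y : Y < y -> 0 < phi y by move=> /spec[Xp _]; exact: lt_trans Xp.
have dpos y : Y < y -> 0 < dphi c th phi y.
  move=> hy; have /andP[e1 _] := el y hy.
  have e0 : 0 < elast c th (phi y) by apply: lt_le_trans e1.
  exact: divr_gt0 (ppos y hy) (mulr_gt0 (ypos y hy) e0).
pose k2 := k1 / 27 * (C3 `^ (- (1 / 6))).
have k20 : 0 < k2 by rewrite mulr_gt0 ?powR_gt0 //; lra.
have dd y : Y < y -> k2 * y `^ (- (11 / 6)) <=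
   - (- dphi c th phi y * curv c th dth (phi y) / (y * elast c th (phi y) ^+ 2)).
  move=> hy; have [Xp e] := spec y hy; have /andP[e1 e2] := el y hy.
  have y_gt0 := ypos y hy; have p_gt0 := ppos y hy.
  rewrite /dphi; move: (elast c th (phi y)) e1 e2 => E e1 e2.
  have E0 : 0 < E by lra.
  have E3 : E ^+ 3 <= 27.
    by rewrite (_ : 27 = 3 ^+ 3); [rewrite lerXn2r ?nnegrE // ltW|ring].
  have -> : - (- (phi y / (y * E)) * curv c th dth (phi y) / (y * E ^+ 2))
     = phi y * curv c th dth (phi y) / (y ^+ 2 * E ^+ 3).
    by field; rewrite !gt_eqF.
  have hcv := proj2 (hcurv (phi y) (ltW Xp)).
  apply: (@le_trans _ _ (phi y * (k1 * phi y `^ (- (1 / 2))) / (y ^+ 2 * 27))); last first.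
    apply: ler_pM.
    - by rewrite !mulr_ge0 ?powR_ge0 // ltW.
    - by rewrite invr_ge0 mulr_ge0 // sqr_ge0.
    - by rewrite ler_wpM2l // ltW.
    - by rewrite lef_pV2 ?posrE ?mulr_gt0 ?exprn_gt0 // ler_wpM2l // sqr_ge0.
  have p12 : phi y * phi y `^ (- (1 / 2)) = phi y `^ (1 / 2).
    rewrite -{1}[phi y]powRr1 ?(ltW p_gt0) // -powRD; last by rewrite (gt_eqF p_gt0) implybT.
    by congr (_ `^ _); field.
  rewrite mulrCA p12.
  have -> : y ^+ 2 = y `^ 2 by rewrite -powR_mulrn // ltW.
  rewrite [leRHS](_ : _ = k1 / 27 * (phi y `^ (1 / 2) * y `^ (- 2))); last first.
    by rewrite powRN; field; rewrite gt_eqF // powR_gt0.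
  rewrite /k2 -mulrA ler_wpM2l //; first by lra.
  have -> : y `^ (- (11 / 6)) = y `^ (1 / 6) * y `^ (- 2).
    rewrite -powRD; last by rewrite (gt_eqF y_gt0) implybT.
    by congr (_ `^ _); field.
  rewrite mulrA ler_wpM2r ?powR_ge0 // powRN ler_pdivrMl ?powR_gt0 //.
  have hy3 : y <= C3 * phi y `^ 3 by rewrite -{1}e hC3 // ltW.
  have -> : phi y `^ (1 / 2) = (phi y `^ 3) `^ (1 / 6).
    by rewrite -powRrM; congr (_ `^ _); field.
  rewrite -powRM ?powR_ge0 ?(ltW C30) //.
  by rewrite ge0_ler_powR ?nnegrE ?(ltW y_gt0) // mulr_ge0 ?powR_ge0 // ltW.
pose n0 := (Num.truncn (Num.max Y (h x0))).+1.
have m0 : 0 <= Num.max Y (h x0) by rewrite le_max (ltW Y0).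
have /andP[_ hn0] := truncn_itv m0.
have Yn n : (n0 <= n)%N -> Y < n%:R.
  move=> hn; apply: (@lt_le_trans _ _ n0%:R); last by rewrite ler_nat.
  by apply: le_lt_trans hn0; rewrite le_max lexx.
exists (11 / 6), (k2 * 3 `^ (- (11 / 6))), (dphi c th phi n0%:R), n0; split.
- lra.
- by rewrite mulr_gt0 ?powR_gt0.
- by split => //; apply: ltW; apply: le_lt_trans hn0; rewrite le_max lexx orbT.
- move=> n hn; rewrite -[n.+2%:R]natr1 -[n.+1%:R]natr1.
  apply: (second_difference pder ppder dd); rewrite ?(ltW k20) ?(ltW Y0) //; last 2 first.
  + exact: Yn.
  + by rewrite ler1n (leq_trans _ hn).
- move=> n hn; rewrite -natr1.
  have [z nz ->] := first_difference pder (Yn n hn).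
  have Yz : Y < z by rewrite (lt_le_trans (Yn n hn)).
  rewrite ltW ?dpos //=.
  apply: (dphi_nonincreasing ppder dd); rewrite ?(ltW k20) //; first exact: Yn.
  by rewrite (le_trans _ nz) // ler_nat.
Qed.

End InverseConcave.

(** * Slow variation of psi when c_2 = 1 *)

Section PsiRegular.
Set Implicit Arguments.
Unset Strict Implicit.
Variable R : realType.

(** Here F and - F q / (y E^2) stand for phi_2' and phi_2'', so y s' / s is - q / E^2 times a
    quotient of two numbers near one. The quotient and 1 / E^2 are each at most 4. *)
Lemma ratio_bound (y s s' F q E : R) : 0 < y -> 0 < s -> 0 < F -> 0 < q -> 1 / 2 <= E ->
  `|s' / (- F * q / (y * E ^+ 2)) - 1| < 1 / 2 -> `|s / F - 1| < 1 / 2 ->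
  - (16 * q) <= y * s' / s <= 0.
Proof.
move=> yp s0 F0 q0 E1; have E0 : 0 < E by lra.
have F1 : - F * q / (y * E ^+ 2) != 0.
  by rewrite !mulf_neq0 ?invr_eq0 ?mulf_neq0 ?oppr_eq0 ?expf_neq0 ?gt_eqF.
have -> : y * s' / s = - ((s' / (- F * q / (y * E ^+ 2))) / (s / F) * (q / E ^+ 2)).
  by field; rewrite !gt_eqF.
move: (s' / _) (s / F) => A B; rewrite !ltr_norml => /andP[a1 a2] /andP[b1 b2].
have B0 : 0 < B by lra.
have A0 : 0 < A by lra.
have AB0 : 0 <= A / B by rewrite divr_ge0 // ltW.
have AB4 : A / B <= 4 by rewrite ler_pdivrMr //; lra.
have E2 : 1 / 4 <= E ^+ 2.
  by rewrite (_ : 1 / 4 = (1 / 2) ^+ 2); [rewrite lerXn2r ?nnegrE // ltW|field].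
have qE0 : 0 <= q / E ^+ 2 by rewrite divr_ge0 ?sqr_ge0 // ltW.
have qE4 : q / E ^+ 2 <= 4 * q.
  rewrite ler_pdivrMr ?exprn_gt0 // -mulrA mulrCA ler_peMr ?(ltW q0) //; lra.
have h1 : A / B * (q / E ^+ 2) <= 4 * (4 * q) by apply: ler_pM.
have h2 : 0 <= A / B * (q / E ^+ 2) by rewrite mulr_ge0.
lra.
Qed.

(** For c = 1 the curvature of h tends to zero through positive values; by comparison with phi'' /
    phi' the elasticity of psi tends to zero and is eventually nonpositive. *)
Lemma approximates_derivative_elasticity (x0 y0 : R) (h phi psi : R -> R) :
  class_R 1 x0 h -> inverse_from x0 h phi -> 0 < y0 ->
  (forall y, y0 <= y -> 0 < psi y) ->
  approximates_derivative y0 psi (h x0) phi ->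
  forall eps, 0 < eps -> exists2 Y, y0 < Y & forall y, Y <= y ->
    - eps <= y * deriv_from y0 psi y / psi y <= 0.
Proof.
move=> hR phiK y00 psi0 [lim1 lim2 _] eps eps0.
have [x00 _ hge _ _] := hR.
have [th [dth [hder thder hth hdth /(_ erefl)[thpos hq _]]]] := class_R_log_derivative hR.
have h_gt0 x : x0 <= x -> 0 < h x by move=> /hge; apply: lt_le_trans.
(* Both |th| and |x th'| below d bound the curvature by 4 d <= eps / 16, and [ratio_bound]
   multiplies by 16. *)
pose d := Num.min (1 / 4) (eps / 64).
have d0 : 0 < d by rewrite lt_min; lra.
have d4 : d <= 1 / 4 by rewrite ge_min lexx.
have d64 : d <= eps / 64 by rewrite ge_min lexx orbT.
have [X1 X1g H1] := cvg_eventually hth d0 x0.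
have [X2 X2g H2] := cvg_eventually hdth d0 X1.
have [X X3g H3] := cvg_eventually hq d0 X2.
have X1x : x0 < X by rewrite (lt_trans X1g) // (lt_trans X2g).
have X_gt0 : 0 < X by exact: lt_trans X1x.
have bnd x : X <= x -> (1 / 2 <= 1 + th x <= 3) /\ 0 < curv 1 th dth x <= eps / 16.
  move=> xx; have xx2 : X2 <= x by rewrite (le_trans (ltW X3g)).
  have xx1 : X1 <= x by rewrite (le_trans (ltW X2g)).
  have thx : 0 < th x by apply: thpos; rewrite (le_trans (ltW X1g)).
  have := H3 x xx; have := H2 x xx2; have := H1 x xx1.
  rewrite !subr0 !ltr_norml => /andP[b1 b2] /andP[b3 b4] /andP[b5 b6].
  split; first by lra.
  rewrite /curv /elast; apply/andP; split; last by nra.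
  have -> : (1 + th x) * (1 + th x - 1) + x * dth x = th x * (1 + th x + x * dth x / th x).
    by field; rewrite gt_eqF.
  by rewrite mulr_gt0 //; lra.
have th_itv x (xx : X <= x) := proj1 (bnd x xx).
have half0 : 0 < 1 / 2 :> R by [].
have [Y1 Y1g L1] := cvg_eventually lim1 half0 (Num.max (h X) (Num.max (h x0) y0)).
have [Y Yg L2] := cvg_eventually lim2 half0 Y1.
move: Y1g; rewrite !gt_max => /and3P[hX1 hx1 y01].
exists Y => [|y yY]; first exact: lt_trans Yg.
have yY1 : Y1 <= y by rewrite (le_trans (ltW Yg)).
have hXy : h X < y by exact: lt_le_trans yY1.
have hxy : h x0 < y by exact: lt_le_trans yY1.
have y0y : y0 < y by exact: lt_le_trans yY1.
have pder t (ht : h X < t) := phi_der x00 X1x h_gt0 hder th_itv phiK ht.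
have ppder := dphi_der x00 X1x h_gt0 hder thder th_itv phiK hXy.
have [Xp e] := phi_spec x00 X1x h_gt0 hder th_itv phiK hXy.
have e1 : derivn_from (h x0) 1 phi y = dphi 1 th phi y.
  exact: is_derive_deriv_from hxy (pder y hXy).
have e2 : derivn_from (h x0) 2 phi y
    = - dphi 1 th phi y * curv 1 th dth (phi y) / (y * elast 1 th (phi y) ^+ 2).
  apply: (is_derive_deriv_from hxy); apply: is_derive_near_eq ppder.
  near=> t; apply: is_derive_deriv_from; first by near: t; exact: near_gt.
  by apply: pder; near: t; exact: near_gt.
have [/andP[el1 el2] /andP[cv0 cv1]] := bnd (phi y) (ltW Xp).
have p0 : 0 < phi y by exact: lt_trans Xp.
have yp : 0 < y by exact: lt_trans y0y.
have psiy : 0 < psi y by apply: psi0; exact: ltW.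
have := L1 y yY1; have := L2 y yY; rewrite e1 e2 [derivn_from y0 1 psi y]/=.
have : dphi 1 th phi y = phi y / (y * elast 1 th (phi y)) by [].
have : 1 / 2 <= elast 1 th (phi y) by [].
move: (elast 1 th (phi y)) (dphi 1 th phi y) (curv 1 th dth (phi y)) cv0 cv1 => E F q q0 q1 E1 FE.
have F0 : 0 < F by rewrite FE divr_gt0 // mulr_gt0 //; exact: lt_le_trans E1.
move=> L2' L1'; have := ratio_bound yp psiy F0 q0 E1 L2' L1'; lra.
Unshelve. all: by end_near. Qed.

Lemma psi_regular (x0 y0 : R) (h phi psi : R -> R) :
  class_R 1 x0 h -> inverse_from x0 h phi -> 0 < y0 ->
  (forall y, y0 <= y -> 0 < psi y) -> differentiable_from y0 psi ->
  approximates_derivative y0 psi (h x0) phi ->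
  forall eps, 0 < eps -> exists2 Y, y0 < Y & forall u v, Y <= u <= v ->
    psi v <= psi u /\ psi u * u `^ eps <= psi v * v `^ eps.
Proof.
move=> hR phiK y00 psi0 psid happ eps eps0.
have [Y Yg HE] := approximates_derivative_elasticity hR phiK y00 psi0 happ eps0.
have Y0 : 0 < Y by exact: lt_trans Yg.
have pY y : Y <= y -> 0 < psi y by move=> yY; apply: psi0; rewrite (le_trans (ltW Yg)).
have dY y : Y <= y -> is_derive y 1 psi (psi y * (y * deriv_from y0 psi y / psi y / y)).
  move=> yY; have -> : psi y * (y * deriv_from y0 psi y / psi y / y) = deriv_from y0 psi y.
    by field; rewrite !gt_eqF ?pY // (lt_le_trans Y0).
  by apply: differentiable_from_is_derive => //; exact: lt_le_trans yY.
exists Y => // u v uv; split.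
  have := @elasticity_le R psi _ Y 0 Y0 pY dY (fun y hy => proj2 (andP (HE y hy))) u v uv.
  by rewrite oppr0 !powRr0 !mulr1.
have := @elasticity_ge R psi _ Y (- eps) Y0 pY dY (fun y hy => proj1 (andP (HE y hy))) u v uv.
by rewrite opprK.
Qed.

End PsiRegular.

(** * The large values estimate *)

Section BoundedMeasurable.
Set Implicit Arguments.
Unset Strict Implicit.
Variables (R : realType) (d : measure_display) (T : measurableType d).
Variable mu : {measure set T -> \bar R}.
Hypothesis mu1 : mu setT = 1%E.
Implicit Types f g u v : T -> R.

(** On a space of total mass one these functions are integrable and closed under sums and products,
    so integrability conditions reduce to closure lemmas. *)
Definition bounded_measurable f :=
  measurable_fun setT f /\ exists M : R, forall x, `|f x| <= M.

Local Notation bm := bounded_measurable.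
Local Notation "'Int' f" := (\int[mu]_x f x) (at level 10).

Lemma bm_integrable f : bm f -> mu.-integrable setT (EFin \o f).
Proof.
move=> [mf [M hM]]; apply: measurable_bounded_integrable => //.
  by rewrite mu1 ltry.
exists M; split; first exact: num_real.
by move=> z Mz x _; apply: le_trans (hM x) _; exact: ltW.
Qed.

Lemma bm_cst (r : R) : bm (fun=> r).
Proof. by split; [exact: measurable_cst|exists `|r|]. Qed.

Lemma bm_add f g : bm f -> bm g -> bm (fun x => f x + g x).
Proof.
move=> [mf [M hM]] [mg [M' hM']]; split; first exact: measurable_realfun.measurable_funD.
by exists (M + M') => x; apply: le_trans (ler_normD _ _) _; apply: lerD.
Qed.

Lemma bm_mul f g : bm f -> bm g -> bm (fun x => f x * g x).
Proof.
move=> [mf [M hM]] [mg [M' hM']]; split; first exact: measurable_realfun.measurable_funM.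
by exists (M * M') => x; rewrite normrM ler_pM.
Qed.

Lemma bm_opp f : bm f -> bm (fun x => - f x).
Proof.
move=> [mf [M hM]]; split; first exact: measurable_realfun.measurable_funN.
by exists M => x; rewrite normrN.
Qed.

Lemma bm_sub f g : bm f -> bm g -> bm (fun x => f x - g x).
Proof. by move=> hf hg; apply: bm_add => //; exact: bm_opp. Qed.

Lemma bm_norm f : bm f -> bm (fun x => `|f x|).
Proof.
move=> [mf [M hM]]; split; first exact: measurableT_comp.
by exists M => x; rewrite normr_id.
Qed.

Lemma bm_sum (I : Type) (r : seq I) (F : I -> T -> R) :
  (forall i, bm (F i)) -> bm (fun x => \sum_(i <- r) F i x).
Proof.
move=> hF; elim: r => [|i r IH].
  by under eq_fun do rewrite big_nil; exact: bm_cst.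
by under eq_fun do rewrite big_cons; exact: bm_add.
Qed.

Lemma bm_indic (G : set T) : measurable G -> bm (\1_G : T -> R).
Proof.
move=> mG; split; first exact: measurable_realfun.measurable_indic.
by exists 1 => x; rewrite ger0_norm ?indicE //; case: (_ \in _).
Qed.

Lemma bm_sqrt_powR f (p : R) : bm f -> 0 <= p -> bm (fun t => Num.sqrt (f t) `^ p).
Proof.
move=> [mf [M hM]] p0; split.
  apply: (measurableT_comp (measurable_realfun.measurable_powR p)).
  exact: (measurableT_comp (measurable_realfun.continuous_measurable_fun (@sqrt_continuous R))).
exists (Num.sqrt M `^ p) => t; rewrite ger0_norm ?powR_ge0 //.
rewrite ge0_ler_powR ?nnegrE ?sqrtr_ge0 //.
by apply: ler_wsqrtr; apply: le_trans (ler_norm _) (hM t).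
Qed.

Lemma Int_add f g : bm f -> bm g -> Int (fun x => f x + g x) = Int f + Int g.
Proof. by move=> hf hg; rewrite RintegralD //; exact: bm_integrable. Qed.

Lemma Int_sub f g : bm f -> bm g -> Int (fun x => f x - g x) = Int f - Int g.
Proof. by move=> hf hg; rewrite RintegralB //; exact: bm_integrable. Qed.

Lemma Int_scale (r : R) f : bm f -> Int (fun x => r * f x) = r * Int f.
Proof. by move=> hf; rewrite RintegralZl //; exact: bm_integrable. Qed.

Lemma Int_sum (I : Type) (r : seq I) (F : I -> T -> R) :
  (forall i, bm (F i)) -> Int (fun x => \sum_(i <- r) F i x) = \sum_(i <- r) Int (F i).
Proof.
move=> hF; elim: r => [|i r IH].
  under eq_Rintegral do rewrite big_nil.
  by rewrite big_nil Rintegral_cst // mul0r.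
under eq_Rintegral do rewrite big_cons.
by rewrite big_cons -IH Int_add //; exact: bm_sum.
Qed.

Lemma Int_le f g : bm f -> bm g -> (forall x, f x <= g x) -> Int f <= Int g.
Proof. by move=> hf hg h; apply: le_Rintegral => //; exact: bm_integrable. Qed.

Lemma Int_ge0 f : (forall x, 0 <= f x) -> 0 <= Int f.
Proof. by move=> h; exact: Rintegral_ge0. Qed.

Lemma Int_norm f : bm f -> `|Int f| <= Int (fun x => `|f x|).
Proof. by move=> hf; apply: le_normr_Rintegral => //; exact: bm_integrable. Qed.

Lemma Int_eq f g : f =1 g -> Int f = Int g.
Proof. by move=> h; apply: eq_Rintegral => x _; exact: h. Qed.

End BoundedMeasurable.

(** * Parseval, Bessel and quadratic forms for an abstract trigonometric system *)

Section TrigonometricSystem.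
Set Implicit Arguments.
Unset Strict Implicit.
Variables (R : realType) (d : measure_display) (T : measurableType d).
Variable mu : {measure set T -> \bar R}.
Hypothesis mu1 : mu setT = 1%E.
Local Notation bm := (@bounded_measurable R d T).
Local Notation "'Int' f" := (\int[mu]_x f x) (at level 10).

(* [cs n + i sn n] plays the role of [e(n xi)]. *)
Variables cs sn : nat -> T -> R.
Hypothesis bm_cs : forall n, bm (cs n).
Hypothesis bm_sn : forall n, bm (sn n).
Hypothesis orth1 : forall n m,
  Int (fun t => cs n t * cs m t + sn n t * sn m t) = (n == m)%:R.
Hypothesis orth2 : forall n m,
  Int (fun t => sn n t * cs m t - cs n t * sn m t) = 0.

Variable r : seq nat.
Hypothesis r_uniq : uniq r.

(** [re_sum] and [im_sum] are the two parts of the sum of (x n + i y n) (cs n + i sn n). *)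
Definition re_sum (x y : nat -> R) (t : T) := \sum_(n <- r) (x n * cs n t - y n * sn n t).
Definition im_sum (x y : nat -> R) (t : T) := \sum_(n <- r) (x n * sn n t + y n * cs n t).

Lemma bm_re_sum x y : bm (re_sum x y).
Proof.
by apply: bm_sum => n; apply: bm_sub; apply: bm_mul => //; exact: bm_cst.
Qed.

Lemma bm_im_sum x y : bm (im_sum x y).
Proof.
by apply: bm_sum => n; apply: bm_add; apply: bm_mul => //; exact: bm_cst.
Qed.

Lemma parseval (x y : nat -> R) :
  Int (fun t => re_sum x y t ^+ 2 + im_sum x y t ^+ 2) = \sum_(n <- r) (x n ^+ 2 + y n ^+ 2).
Proof.
pose F n m t := (x n * x m + y n * y m) * (cs n t * cs m t + sn n t * sn m t)
  + (x n * y m - y n * x m) * (sn n t * cs m t - cs n t * sn m t).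
have bF1 n m : bm (fun t => cs n t * cs m t + sn n t * sn m t).
  by apply: bm_add; apply: bm_mul.
have bF2 n m : bm (fun t => sn n t * cs m t - cs n t * sn m t).
  by apply: bm_sub; apply: bm_mul.
have bF n m : bm (F n m).
  by apply: bm_add; apply: bm_mul => //; exact: bm_cst.
have -> : Int (fun t => re_sum x y t ^+ 2 + im_sum x y t ^+ 2)
    = Int (fun t => \sum_(n <- r) \sum_(m <- r) F n m t).
  apply: Int_eq => t; rewrite !expr2 /re_sum /im_sum !mulr_suml -big_split /=.
  apply: eq_bigr => n _; rewrite !mulr_sumr -big_split /=; apply: eq_bigr => m _.
  by rewrite /F; ring.
rewrite Int_sum //; last by move=> n; exact: bm_sum.
rewrite big_seq [RHS]big_seq; apply: eq_bigr => n nr.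
rewrite Int_sum // (bigD1_seq n) //= big1 ?addr0.
  rewrite /F Int_add //; last 2 first.
  - by apply: bm_mul => //; exact: bm_cst.
  - by apply: bm_mul => //; exact: bm_cst.
  by rewrite !Int_scale // orth1 orth2 eqxx /=; ring.
move=> m mn; rewrite /F Int_add //; last 2 first.
- by apply: bm_mul => //; exact: bm_cst.
- by apply: bm_mul => //; exact: bm_cst.
by rewrite !Int_scale // orth1 orth2 eq_sym (negbTE mn) /=; ring.
Qed.

Section Coefficients.
Variables u v : T -> R.
Hypothesis bu : bm u.
Hypothesis bv : bm v.

(** [re_coef] and [im_coef] are the two parts of the n-th Fourier coefficient of u + i v. *)
Definition re_coef n := Int (fun t => u t * cs n t + v t * sn n t).
Definition im_coef n := Int (fun t => v t * cs n t - u t * sn n t).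

Lemma bm_re_coef n : bm (fun t => u t * cs n t + v t * sn n t).
Proof. by apply: bm_add; apply: bm_mul. Qed.

Lemma bm_im_coef n : bm (fun t => v t * cs n t - u t * sn n t).
Proof. by apply: bm_sub; apply: bm_mul. Qed.

Lemma coef_pairing x y : Int (fun t => u t * re_sum x y t + v t * im_sum x y t)
  = \sum_(n <- r) (x n * re_coef n + y n * im_coef n).
Proof.
have b1 n : bm (fun t => x n * (u t * cs n t + v t * sn n t)).
  by apply: bm_mul; [exact: bm_cst|exact: bm_re_coef].
have b2 n : bm (fun t => y n * (v t * cs n t - u t * sn n t)).
  by apply: bm_mul; [exact: bm_cst|exact: bm_im_coef].
transitivity (Int (fun t => \sum_(n <- r) (x n * (u t * cs n t + v t * sn n t)
     + y n * (v t * cs n t - u t * sn n t)))).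
  apply: Int_eq => t; rewrite /re_sum /im_sum !mulr_sumr -big_split /=.
  by apply: eq_bigr => n _; ring.
rewrite Int_sum //; last by move=> n; exact: bm_add.
apply: eq_bigr => n _; rewrite Int_add // !Int_scale //.
  exact: bm_im_coef.
exact: bm_re_coef.
Qed.

(** Expands the squared distance from u + i v to its partial Fourier sum, which is nonnegative. *)
Lemma bessel : \sum_(n <- r) (re_coef n ^+ 2 + im_coef n ^+ 2)
  <= Int (fun t => u t ^+ 2 + v t ^+ 2).
Proof.
set S := leLHS.
pose U := re_sum re_coef im_coef; pose V := im_sum re_coef im_coef.
have bU : bm U by exact: bm_re_sum.
have bV : bm V by exact: bm_im_sum.
have hp : Int (fun t => U t ^+ 2 + V t ^+ 2) = S by exact: parseval.
have hc : Int (fun t => u t * U t + v t * V t) = S.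
  by rewrite coef_pairing; apply: eq_bigr => n _; rewrite !expr2.
have b1 : bm (fun t => u t ^+ 2 + v t ^+ 2) by apply: bm_add; apply: bm_mul.
have b2 : bm (fun t => U t ^+ 2 + V t ^+ 2) by apply: bm_add; apply: bm_mul.
have b3 : bm (fun t => u t * U t + v t * V t) by apply: bm_add; apply: bm_mul.
have b4 : bm (fun t => 2 * (u t * U t + v t * V t)).
  by apply: bm_mul => //; exact: bm_cst.
have : 0 <= Int (fun t => (u t ^+ 2 + v t ^+ 2) + (U t ^+ 2 + V t ^+ 2) - 2 * (u t * U t + v t * V t)).
  apply: Int_ge0 => t.
  rewrite [leRHS](_ : _ = (u t - U t) ^+ 2 + (v t - V t) ^+ 2); last by ring.
  by rewrite addr_ge0 // sqr_ge0.
rewrite Int_sub //; last exact: bm_add.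
rewrite Int_add // Int_scale // hp hc; lra.
Qed.

(** With g = u + i v, the left side is the double integral of conj g(s) g(t) against the kernel sum
    of w n e(n (s - t)); a kernel bounded by K costs K times the squared L^1 norm. The two parts of
    the kernel are taken at pairs of points because [T] carries no subtraction. *)
Lemma weighted_coef_bound (w : nat -> R) (K : R) :
  (forall s t, `|\sum_(n <- r) w n * (cs n s * cs n t + sn n s * sn n t)| <= K) ->
  (forall s t, `|\sum_(n <- r) w n * (sn n s * cs n t - cs n s * sn n t)| <= K) ->
  \sum_(n <- r) w n * (re_coef n ^+ 2 + im_coef n ^+ 2)
    <= K * (Int (fun t => `|u t| + `|v t|)) ^+ 2.
Proof.
move=> hC hS; set I1 := Int _.
have bI : bm (fun t => `|u t| + `|v t|) by apply: bm_add; exact: bm_norm.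
have I0 : 0 <= I1 by apply: Int_ge0 => t; rewrite addr_ge0.
pose P s := \sum_(n <- r) w n * (cs n s * re_coef n - sn n s * im_coef n).
pose Q s := \sum_(n <- r) w n * (sn n s * re_coef n + cs n s * im_coef n).
(* Integrates out one variable. It is applied with the other point s fixed, to the real part [P] and
   the imaginary part [Q] of the kernel acting on g. *)
have inner (a b : nat -> R) :
   (forall t, `|\sum_(n <- r) w n * (a n * cs n t - b n * sn n t)| <= K) ->
   (forall t, `|\sum_(n <- r) w n * (b n * cs n t + a n * sn n t)| <= K) ->
   `|\sum_(n <- r) w n * (a n * re_coef n + b n * im_coef n)| <= K * I1.
  move=> h1 h2.
  pose A t := \sum_(n <- r) w n * (a n * cs n t - b n * sn n t).
  pose B t := \sum_(n <- r) w n * (b n * cs n t + a n * sn n t).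
  have bA : bm A.
    apply: bm_sum => n; apply: bm_mul; first exact: bm_cst.
    by apply: bm_sub; apply: bm_mul => //; exact: bm_cst.
  have bB : bm B.
    apply: bm_sum => n; apply: bm_mul; first exact: bm_cst.
    by apply: bm_add; apply: bm_mul => //; exact: bm_cst.
  have b1 n : bm (fun t => w n * a n * (u t * cs n t + v t * sn n t)).
    by apply: bm_mul; [exact: bm_cst|exact: bm_re_coef].
  have b2 n : bm (fun t => w n * b n * (v t * cs n t - u t * sn n t)).
    by apply: bm_mul; [exact: bm_cst|exact: bm_im_coef].
  have -> : \sum_(n <- r) w n * (a n * re_coef n + b n * im_coef n)
      = Int (fun t => u t * A t + v t * B t).
    transitivity (Int (fun t => \sum_(n <- r) (w n * a n * (u t * cs n t + v t * sn n t)
        + w n * b n * (v t * cs n t - u t * sn n t)))).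
      rewrite Int_sum //; last by move=> n; exact: bm_add.
      apply: eq_bigr => n _; rewrite Int_add // !Int_scale //.
      - by rewrite -/(re_coef n) -/(im_coef n); ring.
      - exact: bm_im_coef.
      - exact: bm_re_coef.
    apply: Int_eq => t; rewrite /A /B !mulr_sumr -big_split /=.
    by apply: eq_bigr => n _; ring.
  have bAB : bm (fun t => u t * A t + v t * B t) by apply: bm_add; apply: bm_mul.
  apply: le_trans (Int_norm mu1 bAB) _; rewrite -Int_scale //.
  apply: Int_le => //.
  - exact: bm_norm.
  - by apply: bm_mul => //; exact: bm_cst.
  move=> t; apply: le_trans (ler_normD _ _) _.
  rewrite !normrM mulrDr [K * _]mulrC [K * `|v t|]mulrC.
  by apply: lerD; apply: ler_wpM2l => //; [exact: h1|exact: h2].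
have hP s : `|P s| <= K * I1.
  have := inner (fun n => cs n s) (fun n => - sn n s).
  rewrite /P; under [X in _ -> _ -> `|X| <= _]eq_bigr do rewrite mulNr.
  apply.
  - by move=> t; have := hC s t; congr (`|_| <= _); apply: eq_bigr => n _; ring.
  - move=> t; have := hS s t; rewrite -normrN -sumrN.
    by congr (`|_| <= _); apply: eq_bigr => n _; ring.
have hQ s : `|Q s| <= K * I1.
  apply: (inner (fun n => sn n s) (fun n => cs n s)) => t.
  - by have := hS s t; congr (`|_| <= _); apply: eq_bigr => n _; ring.
  - by have := hC s t; congr (`|_| <= _); apply: eq_bigr => n _; ring.
have bP : bm P.
  apply: bm_sum => n; apply: bm_mul; first exact: bm_cst.
  by apply: bm_sub; apply: bm_mul => //; exact: bm_cst.
have bQ : bm Q.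
  apply: bm_sum => n; apply: bm_mul; first exact: bm_cst.
  by apply: bm_add; apply: bm_mul => //; exact: bm_cst.
have b1 n : bm (fun t => w n * re_coef n * (u t * cs n t + v t * sn n t)).
  by apply: bm_mul; [exact: bm_cst|exact: bm_re_coef].
have b2 n : bm (fun t => w n * im_coef n * (v t * cs n t - u t * sn n t)).
  by apply: bm_mul; [exact: bm_cst|exact: bm_im_coef].
have bPQ : bm (fun t => u t * P t + v t * Q t) by apply: bm_add; apply: bm_mul.
have -> : \sum_(n <- r) w n * (re_coef n ^+ 2 + im_coef n ^+ 2)
   = Int (fun t => u t * P t + v t * Q t).
  transitivity (Int (fun t => \sum_(n <- r) (w n * re_coef n * (u t * cs n t + v t * sn n t)
      + w n * im_coef n * (v t * cs n t - u t * sn n t)))).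
    rewrite Int_sum //; last by move=> n; exact: bm_add.
    apply: eq_bigr => n _; rewrite Int_add // !Int_scale //.
    - by rewrite -/(re_coef n) -/(im_coef n); ring.
    - exact: bm_im_coef.
    - exact: bm_re_coef.
  apply: Int_eq => t; rewrite /P /Q !mulr_sumr -big_split /=.
  by apply: eq_bigr => n _; ring.
apply: (@le_trans _ _ (Int (fun t => K * I1 * (`|u t| + `|v t|)))); last first.
  by rewrite Int_scale // expr2 mulrA.
apply: Int_le => //; first by apply: bm_mul => //; exact: bm_cst.
move=> t; apply: le_trans (ler_norm _) _; apply: le_trans (ler_normD _ _) _.
rewrite !normrM mulrDr [K * I1 * _]mulrC [_ * `|v t|]mulrC.
by apply: lerD; rewrite ler_wpM2l.
Qed.

End Coefficients.
End TrigonometricSystem.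

Section LargeValues.
Set Implicit Arguments.
Unset Strict Implicit.
Variables (R : realType) (d : measure_display) (T : measurableType d).
Variable mu : {measure set T -> \bar R}.
Hypothesis mu1 : mu setT = 1%E.
Local Notation bm := (@bounded_measurable R d T).
Local Notation "'Int' f" := (\int[mu]_x f x) (at level 10).
Variables cs sn : nat -> T -> R.
Hypothesis bm_cs : forall n, bm (cs n).
Hypothesis bm_sn : forall n, bm (sn n).
Hypothesis orth1 : forall n m,
  Int (fun t => cs n t * cs m t + sn n t * sn m t) = (n == m)%:R.
Hypothesis orth2 : forall n m,
  Int (fun t => sn n t * cs m t - cs n t * sn m t) = 0.
Variable r : seq nat.
Hypothesis r_uniq : uniq r.

Variables (B : pred nat) (s x y : nat -> R) (K lam : R).
Hypothesis s_gt0 : forall n, 0 < s n.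
Hypothesis xy_le : forall n, n \in r -> x n ^+ 2 + y n ^+ 2 <= (B n)%:R.
Let w n := (B n)%:R / s n - 1.
Hypothesis w_cos : forall t t' : T,
  `|\sum_(n <- r) w n * (cs n t * cs n t' + sn n t * sn n t')| <= K.
Hypothesis w_sin : forall t t' : T,
  `|\sum_(n <- r) w n * (sn n t * cs n t' - cs n t * sn n t')| <= K.
Let Nb := \sum_(n <- r) ((B n)%:R : R).
Let A := \sum_(n <- r) (B n)%:R * s n.
Hypothesis K0 : 0 <= K.
Hypothesis lam_gt0 : 0 < lam.
Hypothesis lam_large : 8 * K * Nb <= lam ^+ 2.

Let u := re_sum cs sn r x y.
Let v := im_sum cs sn r x y.
Let G : set T := [set t | lam ^+ 2 < u t ^+ 2 + v t ^+ 2].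

Let bu : bm u. Proof. exact: bm_re_sum. Qed.
Let bv : bm v. Proof. exact: bm_im_sum. Qed.
Let b2 : bm (fun t => u t ^+ 2 + v t ^+ 2).
Proof. by apply: bm_add; apply: bm_mul. Qed.

Lemma mul_norm_add_le (l a b : R) : l ^+ 2 < a ^+ 2 + b ^+ 2 ->
  l * (`|a| + `|b|) <= 2 * (a ^+ 2 + b ^+ 2).
Proof.
rewrite -(real_normK (num_real a)) -(real_normK (num_real b)).
move: `|a| `|b| => {}a {}b h; have := sqr_ge0 (l - a); have := sqr_ge0 (l - b); nra.
Qed.

Lemma measurable_large : measurable G.
Proof.
rewrite -[G]setTI; apply: (@measurable_realfun.measurable_fun_ltr _ _ _ _ (fun=> lam ^+ 2)
  (fun t => u t ^+ 2 + v t ^+ 2)) => //.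
exact: (b2.1).
Qed.

Let gE t : (\1_G t : R) = (lam ^+ 2 < u t ^+ 2 + v t ^+ 2)%R%:R.
Proof. by rewrite indicE; congr (nat_of_bool _)%:R; apply/idP/idP; rewrite inE. Qed.

Let g2 t : (\1_G t : R) ^+ 2 = \1_G t.
Proof. by rewrite gE; case: (_ < _); rewrite ?expr1n ?expr0n. Qed.

Lemma energy_le : Int (fun t => u t ^+ 2 + v t ^+ 2) <= Nb.
Proof.
rewrite (parseval mu1 bm_cs bm_sn orth1 orth2 r_uniq) big_seq /Nb [leRHS]big_seq.
exact: ler_sum.
Qed.

(* On the large set |f| is at most |f|^2 / lam, so in the quadratic form of the
   weights w the error is quadratic in the energy and is absorbed. *)
Lemma large_values : Int (fun t => \1_G t * (u t ^+ 2 + v t ^+ 2)) <= 2 * A.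
Proof.
set X := leLHS.
have mG := measurable_large.
have bG : bm (\1_G : T -> R) by exact: bm_indic.
pose gu t := \1_G t * u t; pose gv t := \1_G t * v t.
have bgu : bm gu by exact: bm_mul.
have bgv : bm gv by exact: bm_mul.
pose al n := re_coef mu cs sn gu gv n; pose be n := im_coef mu cs sn gu gv n.
have XE : X = \sum_(n <- r) (x n * al n + y n * be n).
  rewrite -(coef_pairing mu1 bm_cs bm_sn r bgu bgv); apply: Int_eq => t.
  by rewrite /gu /gv -/(u t) -/(v t); ring.
have gg t : gu t ^+ 2 + gv t ^+ 2 = \1_G t * (u t ^+ 2 + v t ^+ 2).
  by rewrite /gu /gv !exprMn g2; ring.
have hB : \sum_(n <- r) (al n ^+ 2 + be n ^+ 2) <= X.
  apply: le_trans (bessel mu1 bm_cs bm_sn orth1 orth2 r_uniq bgu bgv) _.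
  by rewrite (Int_eq mu gg).
have hW := weighted_coef_bound mu1 bm_cs bm_sn bgu bgv w_cos w_sin.
have X0 : 0 <= X.
  by apply: Int_ge0 => t; rewrite mulr_ge0 ?addr_ge0 ?sqr_ge0 // gE.
have XN : X <= Nb.
  apply: le_trans energy_le; apply: Int_le => //; first exact: bm_mul.
  move=> t; rewrite ler_piMl ?addr_ge0 ?sqr_ge0 // gE; by case: (_ < _).
set I1 := Int (fun t => `|gu t| + `|gv t|) in hW.
have hI : lam * I1 <= 2 * X.
  have bI : bm (fun t => `|gu t| + `|gv t|) by apply: bm_add; exact: bm_norm.
  have bX : bm (fun t => \1_G t * (u t ^+ 2 + v t ^+ 2)) by exact: bm_mul.
  rewrite -!Int_scale //; apply: Int_le.
  - exact: mu1.
  - by apply: bm_mul => //; exact: bm_cst.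
  - by apply: bm_mul => //; exact: bm_cst.
  move=> t; rewrite /gu /gv gE; case: ltP => h; last by rewrite !mul0r normr0 addr0 mulr0 mulr0.
  rewrite !mul1r.
  exact: mul_norm_add_le.
have I0 : 0 <= I1 by apply: Int_ge0 => t; rewrite addr_ge0.
(* Termwise. For n in [B] squares are completed with weight s n, using x^2 + y^2 <= 1; outside [B]
   the coefficients vanish and w n = - 1 cancels the Bessel term. *)
have hsum : 2 * X <= A + \sum_(n <- r) ((al n ^+ 2 + be n ^+ 2) + w n * (al n ^+ 2 + be n ^+ 2)).
  rewrite XE mulr_sumr /A -big_split /= big_seq [leRHS]big_seq; apply: ler_sum => n nr.
  have sn0 := s_gt0 n; have := xy_le nr; rewrite /w; case: (B n) => /= h.
    have -> : 1 * s n + (al n ^+ 2 + be n ^+ 2 + (1 / s n - 1) * (al n ^+ 2 + be n ^+ 2))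
      = s n + (al n ^+ 2 + be n ^+ 2) / s n by field; rewrite gt_eqF.
    rewrite -subr_ge0.
    rewrite [leRHS](_ : _ = s n * ((al n / s n - x n) ^+ 2 + (be n / s n - y n) ^+ 2 + (1 - (x n ^+ 2 + y n ^+ 2)))).
      have h1 : 0 <= 1 - (x n ^+ 2 + y n ^+ 2) by rewrite subr_ge0.
      by apply: mulr_ge0 (ltW sn0) _; apply: addr_ge0 h1; rewrite addr_ge0 ?sqr_ge0.
    by field; rewrite gt_eqF.
  have x0 : x n = 0 by apply/eqP; rewrite -sqrf_eq0; apply/eqP; have := sqr_ge0 (x n); have := sqr_ge0 (y n); lra.
  have y0 : y n = 0 by apply/eqP; rewrite -sqrf_eq0; apply/eqP; have := sqr_ge0 (x n); have := sqr_ge0 (y n); lra.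
  by rewrite x0 y0 !mul0r sub0r mulN1r subrr !addr0 mulr0.
rewrite big_split /= in hsum.
(* From I1 <= 2 X / lam and X <= Nb the error is at most 4 K Nb X / lam^2; the factor 8 in
   [lam_large] makes this X / 2. *)
have hK : K * I1 ^+ 2 <= X / 2.
  have l2 : 0 < lam ^+ 2 by rewrite exprn_gt0.
  rewrite -(ler_pM2l l2).
  have h1 : (lam * I1) ^+ 2 <= (2 * X) ^+ 2.
    by rewrite lerXn2r ?nnegrE // ?mulr_ge0 // ltW.
  rewrite !exprMn in h1.
  have h2 : K * (lam ^+ 2 * I1 ^+ 2) <= K * (2 ^+ 2 * X ^+ 2) by rewrite ler_wpM2l.
  have h3 : K * (X * X) <= K * Nb * X by rewrite -mulrA ler_wpM2l // ler_wpM2r.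
  have h4 : 8 * K * Nb * X <= lam ^+ 2 * X by rewrite ler_wpM2r.
  rewrite !expr2 in h2 *; lra.
lra.
Qed.

(** Below lam, |f|^p is at most lam^(p - 2) |f|^2, controlled by the whole energy; above lam it is
    at most Nb^(p - 2) |f|^2, controlled by [large_values]. *)
Lemma moment_bound (p : R) : 2 < p -> (forall t, u t ^+ 2 + v t ^+ 2 <= Nb ^+ 2) ->
  Int (fun t => Num.sqrt (u t ^+ 2 + v t ^+ 2) `^ p)
    <= lam `^ (p - 2) * Nb + Nb `^ (p - 2) * (2 * A).
Proof.
move=> p2 hN.
have N0 : 0 <= Nb by apply: sumr_ge0 => n _; case: (B n).
have bG : bm (\1_G : T -> R) by apply: bm_indic; exact: measurable_large.
have b3 : bm (fun t => \1_G t * (u t ^+ 2 + v t ^+ 2)) by exact: bm_mul.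
have b4 : bm (fun t => lam `^ (p - 2) * (u t ^+ 2 + v t ^+ 2)).
  by apply: bm_mul => //; exact: bm_cst.
have b5 : bm (fun t => Nb `^ (p - 2) * (\1_G t * (u t ^+ 2 + v t ^+ 2))).
  by apply: bm_mul => //; exact: bm_cst.
apply: (@le_trans _ _ (Int (fun t => lam `^ (p - 2) * (u t ^+ 2 + v t ^+ 2) +
   Nb `^ (p - 2) * (\1_G t * (u t ^+ 2 + v t ^+ 2))))); last first.
  rewrite Int_add // !Int_scale //; apply: lerD; rewrite ler_wpM2l ?powR_ge0 //.
    exact: energy_le.
  exact: large_values.
have split2 z : 0 < z -> z `^ p = z `^ (p - 2) * z ^+ 2.
  move=> z0; rewrite -powR_mulrn ?(ltW z0) // -powRD; last by rewrite (gt_eqF z0) implybT.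
  by rewrite subrK.
have pt t : Num.sqrt (u t ^+ 2 + v t ^+ 2) `^ p <= lam `^ (p - 2) * (u t ^+ 2 + v t ^+ 2) +
   Nb `^ (p - 2) * (\1_G t * (u t ^+ 2 + v t ^+ 2)).
  have e0 : 0 <= u t ^+ 2 + v t ^+ 2 by rewrite addr_ge0 ?sqr_ge0.
  move: e0 (hN t); rewrite gE; move: (u t ^+ 2 + v t ^+ 2) => e e0 eN.
  have [->|en] := eqVneq e 0.
    by rewrite sqrtr0 !mulr0 addr0 powR0 //; apply/eqP; lra.
  have ep : 0 < Num.sqrt e by rewrite sqrtr_gt0 lt_neqAle eq_sym en.
  rewrite split2 // sqr_sqrtr //.
  case: ltP => h.
    rewrite mul1r; apply: (@le_trans _ _ (Nb `^ (p - 2) * e)).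
      rewrite ler_wpM2r // ge0_ler_powR ?nnegrE ?(ltW ep) //; first by lra.
      by rewrite -(ger0_norm N0) -sqrtr_sqr ler_sqrt // sqr_ge0.
    by rewrite lerDr mulr_ge0 // powR_ge0.
  rewrite mul0r mulr0 addr0 ler_wpM2r // ge0_ler_powR ?nnegrE ?(ltW ep) ?(ltW lam_gt0) //.
    by lra.
  by rewrite -(ger0_norm (ltW lam_gt0)) -sqrtr_sqr ler_sqrt // sqr_ge0.
apply: Int_le => //; last exact: bm_add.
by apply: bm_sqrt_powR => //; lra.
Qed.

End LargeValues.

(** * The characters of the circle *)

Section CircleSystem.
Set Implicit Arguments.
Unset Strict Implicit.
Variable R : realType.
Local Notation mu := (circle_measure R).
Local Notation T := (g_sigma_algebraType (R.-ocitv.-measurable)).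
Local Notation bm := (@bounded_measurable R _ T).
Local Notation "'Int' f" := (\int[mu]_x f x) (at level 10).

Lemma circle_measureE (A : set R) : circle_measure R A = lebesgue_measure (A `&` `[0, 1[).
Proof. by []. Qed.

Lemma circle_measureT : circle_measure R setT = 1%E.
Proof.
by rewrite circle_measureE setTI lebesgue_measure_itv /= lte_fin ltr01 sube0.
Qed.

Lemma bm_continuous (f : R -> R) (M : R) : continuous f -> (forall x, `|f x| <= M) ->
  bm f.
Proof.
move=> cf hM; split; last by exists M.
exact: measurable_realfun.continuous_measurable_fun.
Qed.

(** Passes to Lebesgue measure and closes the interval at 1, the form in which antiderivatives are
    evaluated. *)
Lemma Int_circle (f : R -> R) : bm f ->
  Int f = \int[lebesgue_measure]_(x in `[0, 1]) f x.
Proof.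
move=> bf; have fi := bm_integrable circle_measureT bf.
have mD : measurable (`[0 : R, 1[%classic : set T) by exact: measurable_itv.
have mN : measurable (~` `[0 : R, 1[%classic : set T) by exact: measurableC.
have N0 : circle_measure R (~` `[0, 1[) = 0%E.
  by rewrite circle_measureE setICl measure0.
rewrite /Rintegral (negligible_integral mN measurableT fi N0) setTD setCK.
rewrite (@eq_measure_integral _ _ _ _ lebesgue_measure); last first.
  by move=> A mA AD; rewrite circle_measureE setIidl.
rewrite integral_itv_bndo_bndc //.
apply/measurable_realfun.measurable_EFinP; apply: measurable_funTS; exact: bf.1.
Qed.

Definition cosn (n : nat) (xi : R) : R := cos (2 * pi * (n%:R * xi)).
Definition sinn (n : nat) (xi : R) : R := sin (2 * pi * (n%:R * xi)).

Lemma continuous_linear (k : R) : continuous (fun x : R => 2 * pi * (k * x)).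
Proof.
rewrite (_ : (fun x : R => 2 * pi * (k * x)) = *%R (2 * pi * k)).
  exact: mulrl_continuous.
by apply/funext => x; rewrite mulrA.
Qed.

Lemma bm_cos_linear (k : R) : bm (fun x => cos (2 * pi * (k * x))).
Proof.
apply: (@bm_continuous _ 1) => x; last exact: cos_max.
by apply: continuous_comp; [exact: continuous_linear|exact: continuous_cos].
Qed.

Lemma bm_sin_linear (k : R) : bm (fun x => sin (2 * pi * (k * x))).
Proof.
apply: (@bm_continuous _ 1) => x; last exact: sin_max.
by apply: continuous_comp; [exact: continuous_linear|exact: continuous_sin].
Qed.

Lemma is_derive_linear (q : R) (x : R) : is_derive x 1 (fun t : R => q * t) q.
Proof.
have h := is_derive_mul (is_derive_cst q x 1) (is_derive_id x 1).
by rewrite mul0r add0r mulr1 in h.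
Qed.

Lemma Rintegral_FTC2 (f F : R -> R) : (forall x : R, is_derive x 1 F (f x)) -> continuous f ->
  \int[lebesgue_measure]_(x in `[0, 1]) f x = F 1 - F 0.
Proof.
move=> hF cf; have cF x := is_derive_continuous (hF x).
rewrite /Rintegral (@continuous_FTC2 _ f F 0 1) //.
- exact: continuous_subspaceT.
- split; first by move=> x _; exact: (@ex_derive _ _ _ _ _ _ _ (hF x)).
  + exact: cvg_at_right_filter (cF 0).
  + exact: cvg_at_left_filter (cF 1).
- by move=> x _; rewrite derive1E (@derive_val _ _ _ _ _ _ _ (hF x)).
Qed.

Lemma Int_cos_int (k : int) : Int (fun x => cos (2 * pi * (k%:~R * x))) = (k == 0)%:R.
Proof.
have [->|k0] := eqVneq k 0.
  rewrite (Int_eq mu (g := fun=> 1)); first by rewrite Rintegral_cst // circle_measureT mul1r.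
  by move=> x; rewrite mul0r mulr0 cos0.
set q : R := 2 * pi * k%:~R.
have q0 : q != 0 by rewrite mulf_neq0 ?two_pi_neq0 // intr_eq0.
rewrite Int_circle; last exact: bm_cos_linear.
have hd (x : R) : is_derive x 1 (fun t => q^-1 * sin (q * t)) (cos (2 * pi * (k%:~R * x))).
  have h1 := is_derive1_comp (is_derive_sin (q * x)) (is_derive_linear q x).
  have h := is_derive_mul (is_derive_cst q^-1 x 1) h1.
  rewrite mul0r add0r mulrC mulfK // in h.
  by rewrite mulrA -/q; exact: h.
rewrite (Rintegral_FTC2 hd).
  rewrite mulr1 mulr0 sin0 mulr0 subr0 -[X in sin X]add0r /q sin_int sin0 mulr0.
  by [].
move=> x; apply: continuous_comp; [exact: continuous_linear|exact: continuous_cos].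
Qed.

Lemma Int_sin_int (k : int) : Int (fun x => sin (2 * pi * (k%:~R * x))) = 0.
Proof.
have [->|k0] := eqVneq k 0.
  rewrite (Int_eq mu (g := fun=> 0)); first by rewrite Rintegral_cst // mul0r.
  by move=> x; rewrite mul0r mulr0 sin0.
set q : R := 2 * pi * k%:~R.
have q0 : q != 0 by rewrite mulf_neq0 ?two_pi_neq0 // intr_eq0.
rewrite Int_circle; last exact: bm_sin_linear.
have hd (x : R) : is_derive x 1 (fun t => - q^-1 * cos (q * t)) (sin (2 * pi * (k%:~R * x))).
  have h1 := is_derive1_comp (is_derive_cos (q * x)) (is_derive_linear q x).
  have h := is_derive_mul (is_derive_cst (- q^-1) x 1) h1.
  rewrite mul0r add0r mulNr mulNr mulrN opprK mulrC mulfK // in h.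
  by rewrite mulrA -/q; exact: h.
rewrite (Rintegral_FTC2 hd).
  by rewrite mulr1 mulr0 cos0 -[X in cos X]add0r /q cos_int cos0 subrr.
move=> x; apply: continuous_comp; [exact: continuous_linear|exact: continuous_sin].
Qed.

Lemma bm_cosn n : bm (cosn n). Proof. exact: bm_cos_linear. Qed.
Lemma bm_sinn n : bm (sinn n). Proof. exact: bm_sin_linear. Qed.

Lemma cosn_diff n m x y :
  cosn n x * cosn m y + sinn n x * sinn m y = cos (2 * pi * (n%:R * x - m%:R * y)).
Proof. by rewrite -cosB; congr cos; ring. Qed.

Lemma sinn_diff n m x y :
  sinn n x * cosn m y - cosn n x * sinn m y = sin (2 * pi * (n%:R * x - m%:R * y)).
Proof. by rewrite -sinB; congr sin; ring. Qed.

Lemma orth_cosn n m : Int (fun t => cosn n t * cosn m t + sinn n t * sinn m t) = (n == m)%:R.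
Proof.
transitivity (Int (fun t => cos (2 * pi * ((Posz n - Posz m)%:~R * t)))).
  apply: Int_eq => t; rewrite cosn_diff; congr cos; rewrite intrB !pmulrn; ring.
by rewrite Int_cos_int subr_eq0 eqz_nat.
Qed.

Lemma orth_sinn n m : Int (fun t => sinn n t * cosn m t - cosn n t * sinn m t) = 0.
Proof.
transitivity (Int (fun t => sin (2 * pi * ((Posz n - Posz m)%:~R * t)))).
  apply: Int_eq => t; rewrite sinn_diff; congr sin; rewrite intrB !pmulrn; ring.
by rewrite Int_sin_int.
Qed.

End CircleSystem.

(** * Exponential sums over [B] in the trigonometric system *)

Section ExpSums.
Set Implicit Arguments.
Unset Strict Implicit.
Variable R : realType.
Local Notation mu := (circle_measure R).
Local Notation T := (g_sigma_algebraType (R.-ocitv.-measurable)).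
Local Notation bm := (@bounded_measurable R _ T).
Local Notation "'Int' f" := (\int[mu]_x f x) (at level 10).
Local Notation normc := ComplexField.Normc.normc.

Variables (B : set nat) (N : nat).
Let r := index_iota 1 N.+1.
Let Nb : R := \sum_(n <- r) (n \in B)%:R.

(** The indicator of [B] is put into the coefficients, so that sums run over all of 1, ..., N;
    [energy] is then |f|^2. *)
Definition re_coeff (a : nat -> R[i]) n : R := (n \in B)%:R * complex.Re (a n).
Definition im_coeff (a : nat -> R[i]) n : R := (n \in B)%:R * complex.Im (a n).
Definition energy (a : nat -> R[i]) (t : R) : R :=
  re_sum (@cosn R) (@sinn R) r (re_coeff a) (im_coeff a) t ^+ 2
  + im_sum (@cosn R) (@sinn R) r (re_coeff a) (im_coeff a) t ^+ 2.

Lemma exp_sumE a t : exp_sum B N a t =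
  Complex (re_sum (@cosn R) (@sinn R) r (re_coeff a) (im_coeff a) t)
          (im_sum (@cosn R) (@sinn R) r (re_coeff a) (im_coeff a) t).
Proof.
rewrite /exp_sum /re_sum /im_sum -/r; elim: r => [|n l IH]; first by rewrite !big_nil.
rewrite !big_cons IH /re_coeff /im_coeff; case: (n \in B); last by rewrite !mul0r subrr !add0r.
rewrite !mul1r; case: (a n) => x y /=; rewrite /e1 /cosn /sinn.
by apply/eqP; rewrite eq_complex /= !eqxx.
Qed.

Lemma normc_exp_sum a t : normc (exp_sum B N a t) = Num.sqrt (energy a t).
Proof. by rewrite exp_sumE. Qed.

Lemma coeff_le a n : (forall n, (0 < n)%N -> `|a n| <= 1) -> n \in r ->
  re_coeff a n ^+ 2 + im_coeff a n ^+ 2 <= (n \in B)%:R.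
Proof.
move=> ha; rewrite mem_index_iota => /andP[n1 _]; rewrite /re_coeff /im_coeff !exprMn.
case: (n \in B) => /=; last by rewrite expr0n !mul0r addr0.
rewrite expr1n !mul1r; have := ha n n1; rewrite normc_def -[X in _ <= X]/(1%:C)%C lecR.
move: (_ ^+ 2 + _) => e he; have [e0|e0] := leP e 0; first by rewrite (le_trans e0).
by rewrite -[1](sqrtr1) ler_sqrt // in he.
Qed.

Lemma energy_bound a t : (forall n, (0 < n)%N -> `|a n| <= 1) -> energy a t <= Nb ^+ 2.
Proof.
move=> ha.
have e0 : 0 <= energy a t by rewrite addr_ge0 ?sqr_ge0.
have : normc (exp_sum B N a t) <= Nb.
  rewrite /exp_sum /Nb -/r.
  have : {subset r <= index_iota 1 N.+1} by [].
  elim: r => [|n l IH] hl; first by rewrite !big_nil ComplexField.Normc.normc0.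
  have {}IH : _ := IH (fun m ml => hl m (@mem_behead _ (n :: l) m ml)).
  have := hl n (mem_head n l); rewrite mem_index_iota => /andP[n1 _].
  rewrite !big_cons; case: (n \in B); last by rewrite add0r.
  apply: le_trans (le_normcD _ _) _; apply: lerD => //.
  rewrite ComplexField.Normc.normcM.
  have -> : normc (e1 (n%:R * t)) = 1 by rewrite /= cos2Dsin2 sqrtr1.
  rewrite mulr1; have := ha n n1.
  by rewrite -[`|a n|]/((normc (a n))%:C)%C -[X in _ <= X -> _]/(1%:C)%C lecR.
rewrite normc_exp_sum => h.
by rewrite -[leLHS](sqr_sqrtr e0) lerXn2r ?nnegrE ?sqrtr_ge0 // (le_trans _ h) ?sqrtr_ge0.
Qed.

Lemma bm_energy a : bm (energy a).
Proof.
have bc := @bm_cosn R; have bs := @bm_sinn R.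
apply: bm_add; apply: bm_mul; (exact: bm_re_sum || exact: bm_im_sum).
Qed.

Lemma Lp_circle_exp_sum (p : R) a : 0 < p ->
  Lp_circle p (exp_sum B N a) = ((Int (fun t => Num.sqrt (energy a t) `^ p)) `^ p^-1)%:E.
Proof.
move=> p0; have bp : bm (fun t => Num.sqrt (energy a t) `^ p).
  by apply: bm_sqrt_powR; [exact: bm_energy|exact: ltW].
rewrite /Lp_circle unlock /Rintegral -poweR_EFin fineK; last first.
  by apply: integrable_fin_num => //; exact: (bm_integrable (circle_measureT R) bp).
congr (poweR _ _); apply: eq_integral => t _.
by rewrite normc_exp_sum /= ger0_norm ?sqrtr_ge0.
Qed.

Lemma energy_one_le a : (forall n, (0 < n)%N -> `|a n| <= 1) -> Int (energy a) <= Nb.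
Proof.
move=> ha; have bc := @bm_cosn R; have bs := @bm_sinn R.
rewrite (parseval (circle_measureT R) bc bs (@orth_cosn R) (@orth_sinn R) (iota_uniq _ _)).
by rewrite big_seq /Nb [leRHS]big_seq; apply: ler_sum => n; exact: coeff_le.
Qed.

Lemma energy_one : Int (energy (fun=> 1)) = Nb.
Proof.
have bc := @bm_cosn R; have bs := @bm_sinn R.
rewrite (parseval (circle_measureT R) bc bs (@orth_cosn R) (@orth_sinn R) (iota_uniq _ _)).
apply: eq_bigr => n _; rewrite /re_coeff /im_coeff /= mulr1 mulr0 expr0n addr0.
by case: (n \in B); rewrite ?expr1n ?expr0n.
Qed.

Lemma lower_bound (p : R) : 0 < p -> (0 < N)%N ->
  (Nb / 2) `^ p / (8 * N%:R) <= Int (fun t => Num.sqrt (energy (fun=> 1) t) `^ p).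
Proof.
move=> p0 N0; have Np : 0 < N%:R :> R by rewrite ltr0n.
(* Since pi < 4, this length keeps the angle 2 pi n t at most 1 for n <= N, and there the cosine is
   at least 1 / 2. *)
pose G : set R := [set` `[0, (8 * N%:R)^-1[].
have mG : measurable (G : set T) by exact: measurable_itv.
have bG : bm (\1_G : T -> R) by exact: bm_indic.
have N8 : 0 < (8 * N%:R)^-1 :> R by rewrite invr_gt0 mulr_gt0.
have N81 : (8 * N%:R)^-1 <= 1 :> R.
  rewrite invf_le1 ?mulr_gt0 //; have : 1 <= N%:R :> R by rewrite ler1n.
  lra.
have muG : Int (\1_G : T -> R) = (8 * N%:R)^-1.
  rewrite /Rintegral integral_indic // setIT circle_measureE setIidl.
    by rewrite lebesgue_measure_itv /= lte_fin N8 sube0.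
  by move=> t; rewrite /G /= !in_itv /= => /andP[-> t1] /=; exact: lt_le_trans N81.
have Nb0 : 0 <= Nb by apply: sumr_ge0 => n _; case: (n \in B).
rewrite -muG -Int_scale //; last exact: circle_measureT.
apply: Int_le.
- exact: circle_measureT.
- by apply: bm_mul => //; exact: bm_cst.
- by apply: bm_sqrt_powR; [exact: bm_energy|exact: ltW].
move=> t; rewrite indicE; case: (boolP (t \in G)) => [|_]; last by rewrite mulr0 powR_ge0.
rewrite inE /G /= in_itv /= => /andP[t0 t1]; rewrite mulr1.
have hu : Nb / 2 <= re_sum (@cosn R) (@sinn R) r (re_coeff (fun=> 1)) (im_coeff (fun=> 1)) t.
  rewrite /Nb mulr_suml /re_sum big_seq [leRHS]big_seq; apply: ler_sum => n.
  rewrite mem_index_iota ltnS => /andP[_ nN].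
  rewrite /re_coeff /im_coeff /= mulr0 mul0r subr0 mulr1.
  case: (n \in B); rewrite ?mul0r // !mul1r /cosn.
  apply: le_trans (cos_ge_quad _).
  have nN' : n%:R <= N%:R :> R by rewrite ler_nat.
  have : 0 <= 2 * pi * (n%:R * t) <= 1.
    have p4 := pi_lt4 R; have pp := pi_gt0 R.
    have nt0 : 0 <= n%:R * t by rewrite mulr_ge0.
    have nt : n%:R * t <= 1 / 8.
      apply: le_trans (_ : N%:R * (8 * N%:R)^-1 <= _); first by rewrite ler_pM // ltW.
      by rewrite invfM mulrCA mulfV ?mulr1 ?gt_eqF // div1r.
    by apply/andP; split; nra.
  move: (2 * pi * _) => z /andP[z0 z1]; nra.
rewrite ge0_ler_powR ?nnegrE ?sqrtr_ge0 ?(ltW p0) ?divr_ge0 //.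
have hb : 0 <= Nb / 2 by rewrite divr_ge0.
rewrite -[leLHS](ger0_norm hb) -sqrtr_sqr; apply: ler_wsqrtr.
by rewrite /energy -[leLHS]addr0 lerD ?sqr_ge0 // lerXn2r ?nnegrE // (le_trans hb).
Qed.

End ExpSums.

(** * The restriction inequality from discrepancy and slow variation *)

Section Restriction.
Set Implicit Arguments.
Unset Strict Implicit.
Variable R : realType.
Local Notation mu := (circle_measure R).
Local Notation "'Int' f" := (\int[mu]_x f x) (at level 10).

(** Freezing w from N on removes the increment from N to N + 1 that summation by parts over the
    half-open range would add. *)
Lemma abel_clamped (w u : nat -> R) (K V : R) (N : nat) : (0 < N)%N ->
  (forall n, (n <= N)%N -> `|\sum_(1 <= i < n.+1) u i| <= K) ->
  \sum_(1 <= i < N) `|w i.+1 - w i| = V ->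
  `|\sum_(1 <= i < N.+1) w i * u i| <= K * (`|w N| + V).
Proof.
move=> N0 hK hV; pose w' n := w (minn n N).
have w'E i : (1 <= i < N.+1)%N -> w' i = w i.
  by move=> /andP[_ iN]; rewrite /w' (minn_idPl _).
rewrite (@eq_big_nat _ _ _ _ _ _ (fun i => w' i * u i)); last by move=> i /w'E ->.
apply: le_trans (@abel_bound _ w' u K 1 N.+1 _ _) _ => //.
  move=> [//|n] /andP[_ nN]; exact: hK.
rewrite big_nat_recr //= /w' minnn (minn_idPr (leqnSn N)) subrr normr0 addr0 -hV.
rewrite (@eq_big_nat _ _ _ _ _ _ (fun i => `|w i.+1 - w i|)) // => i /andP[i1 iN].
by rewrite !(minn_idPl _) // ltnW.
Qed.

Variables (B : set nat) (s : nat -> R) (C3 C4 chi : R).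
Hypothesis s_gt0 : forall n, 0 < s n.
Hypothesis s_le1 : forall n, s n <= 1.
Hypothesis s_noninc : forall n, s n.+1 <= s n.
Hypothesis s_lower : forall eps : R, 0 < eps ->
  exists2 c : R, 0 < c & forall n, (0 < n)%N -> c <= s n * n%:R `^ eps.
Hypothesis C3_gt0 : 0 < C3.
Hypothesis s_square : forall N, (0 < N)%N ->
  \sum_(1 <= n < N.+1) s n ^+ 2 <= C3 * (N%:R * s N ^+ 2).
Hypothesis C4_gt0 : 0 < C4.
Hypothesis chi_gt0 : 0 < chi < 1.
Hypothesis discrepancy : forall (N : nat) (xi al : R), (0 < N)%N ->
  `|\sum_(1 <= n < N.+1) ((n \in B)%:R - s n) * cos (2 * pi * (n%:R * xi) + al)|
    <= C4 * N%:R `^ (1 - chi).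

Let Nb N : R := \sum_(1 <= n < N.+1) (n \in B)%:R.

Lemma s_anti m n : (m <= n)%N -> s n <= s m.
Proof. by move=> mn; apply: (nonincreasing_seqP s).1 mn. Qed.

Lemma discrepancy_le (N : nat) (xi al : R) n : (n <= N)%N ->
  `|\sum_(1 <= i < n.+1) ((i \in B)%:R - s i) * cos (2 * pi * (i%:R * xi) + al)|
    <= C4 * N%:R `^ (1 - chi).
Proof.
case: n => [|n] nN; first by rewrite big_geq // normr0 mulr_ge0 ?powR_ge0 // ltW.
apply: le_trans (discrepancy _ _ _) _ => //; rewrite ler_pM2l //.
by apply: ge0_ler_powR; rewrite ?nnegrE ?ler_nat //; case/andP: chi_gt0; lra.
Qed.

(** The weight 1 / s is nondecreasing, so its variation telescopes and together with the last value
    stays below 2 / s N. *)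
Lemma weighted_discrepancy (N : nat) (xi al : R) : (0 < N)%N ->
  `|\sum_(1 <= n < N.+1) ((n \in B)%:R / s n - 1) * cos (2 * pi * (n%:R * xi) + al)|
    <= 2 * (C4 * N%:R `^ (1 - chi)) / s N.
Proof.
move=> N0.
rewrite (eq_bigr (fun n => (s n)^-1 * (((n \in B)%:R - s n) * cos (2 * pi * (n%:R * xi) + al)))); last first.
  by move=> n _; rewrite [RHS]mulrA mulrBr mulVf ?(gt_eqF (s_gt0 n)) // [_^-1 * _]mulrC.
apply: le_trans (abel_clamped N0 (fun n => @discrepancy_le N xi al n) erefl) _.
rewrite [leRHS](_ : _ = C4 * N%:R `^ (1 - chi) * (2 * (s N)^-1)); last by ring.
rewrite ler_wpM2l ?mulr_ge0 ?powR_ge0 ?(ltW C4_gt0) //.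
rewrite (eq_bigr (fun i => (s i.+1)^-1 - (s i)^-1)); last first.
  by move=> i _; rewrite ger0_norm // subr_ge0 lef_pV2 ?posrE.
rewrite telescope_sumr // ger0_norm ?invr_ge0 ?(ltW (s_gt0 _)) //.
have : 0 < (s 1)^-1 by rewrite invr_gt0.
lra.
Qed.

(** Writes 1_B s as s^2 + (1_B - s) s. The weight s is nonincreasing, so its last value and its
    variation add up to s 1 <= 1. *)
Lemma weighted_mass (N : nat) : (0 < N)%N ->
  \sum_(1 <= n < N.+1) (n \in B)%:R * s n
    <= C3 * (N%:R * s N ^+ 2) + C4 * N%:R `^ (1 - chi).
Proof.
move=> N0.
have := abel_clamped (w := s) N0 (fun n => @discrepancy_le N 0 0 n) erefl.
rewrite (eq_bigr (fun n => (n \in B)%:R * s n - s n ^+ 2)); last first.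
  by move=> n _; rewrite mulr0 mulr0 addr0 cos0; ring.
rewrite sumrB (eq_bigr (fun i => s i - s i.+1) (F1 := fun i => `|_ - _|)); last first.
  by move=> i _; rewrite ler0_norm ?opprB // subr_le0.
have -> : \sum_(1 <= i < N) (s i - s i.+1) = s 1 - s N.
  by rewrite -[RHS]opprB -telescope_sumr // -sumrN; apply: eq_bigr => i _; rewrite opprB.
rewrite (ger0_norm (ltW (s_gt0 N))) [s N + _]addrC subrK => h.
have := le_trans (ler_norm _) h; have := s_square N0.
have : C4 * N%:R `^ (1 - chi) * s 1 <= C4 * N%:R `^ (1 - chi).
  by rewrite ler_piMr // mulr_ge0 ?powR_ge0 // ltW.
lra.
Qed.

Lemma mass_lower (N : nat) : (0 < N)%N ->
  N%:R * s N - C4 * N%:R `^ (1 - chi) <= Nb N.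
Proof.
move=> N0; have := discrepancy_le 0 0 (leqnn N).
rewrite (eq_bigr (fun n => (n \in B)%:R - s n)); last first.
  by move=> n _; rewrite mulr0 mulr0 addr0 cos0 mulr1.
rewrite sumrB -/(Nb N) ler_norml => /andP[h _].
have : N%:R * s N <= \sum_(1 <= n < N.+1) s n.
  rewrite -[X in X%:R](subn1 N.+1) mulr_natl -sumr_const_nat.
  by apply: ler_sum_nat => i /andP[_ iN]; exact: s_anti.
move: h; set S := \sum_(_ <= _ < _) _; lra.
Qed.

(* With nu = N^(chi/4) the discrepancy is C4 N / nu^4 while N s_N^2 is at least
   c^2 N / nu, so for nu >= M it is negligible and lam = |B_N| / nu is admissible;
   for nu < M the range of N is bounded. *)
Lemma moment_le (p : R) : 2 < p -> exists2 D : R, 0 < D &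
  forall N a, (0 < N)%N -> (forall n, (0 < n)%N -> `|a n| <= 1) ->
  Int (fun t => Num.sqrt (energy B N a t) `^ p) <= D * (Nb N `^ p / N%:R).
Proof.
move=> p2; have /andP[c0 c1] := chi_gt0.
(* The exponents are read off from nu = N^(chi/4): squaring the first bound gives c^2 <= s_N^2 nu,
   and the second is b <= s_N nu^(p - 2), available since p > 2. *)
have [|c cp hc] := @s_lower (chi / 8); first by lra.
have [|b bp hb] := @s_lower (chi * (p - 2) / 4); first by nra.
have c2 : 0 < c ^+ 2 by rewrite exprn_gt0.
(* Chosen so that nu >= M implies 32 C4 <= c^2 nu <= (s_N nu)^2. *)
pose M := 32 * C4 / c ^+ 2 + 1.
have M1 : 1 <= M by rewrite lerDr divr_ge0 ?mulr_ge0 // ltW.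
(* The summands serve, in order, the range nu < M, where N <= M^(4 / chi), the contribution below
   lam, and the one above it. *)
pose D := M `^ (4 / chi) + (2 / b + 8 * (C3 + 1)).
have D1 : 0 <= M `^ (4 / chi) by exact: powR_ge0.
have D2 : 0 <= 2 / b by rewrite divr_ge0 // ltW.
have D0 : 0 < D by have h3 := C3_gt0; rewrite /D; lra.
exists D => // N a N0 ha.
have Np : 0 < N%:R :> R by rewrite ltr0n.
have Nb0 : 0 <= Nb N by apply: sumr_ge0 => n _; case: (n \in B).
pose nu := N%:R `^ (chi / 4) : R.
have nup : 0 < nu by exact: powR_gt0.
have nu4 : C4 * N%:R `^ (1 - chi) = C4 * N%:R / nu ^+ 4.
  rewrite -powR_mulrn ?(ltW nup) // -powRrM -powRN -mulrA; congr (_ * _).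
  rewrite powRD ?(gt_eqF Np) ?implybT // powRr1 ?(ltW Np) //; congr (_ * _ `^ _).
  by field.
have [nuM|nuM] := ltP nu M.
  have NM : N%:R <= M `^ (4 / chi).
    have -> : N%:R = nu `^ (4 / chi).
      rewrite -powRrM (_ : chi / 4 * (4 / chi) = 1) ?powRr1 ?(ltW Np) //.
      by field; rewrite gt_eqF.
    by apply: ge0_ler_powR; rewrite ?nnegrE ?divr_ge0 ?(ltW nup) ?(ltW nuM) ?(ltW c0) //; lra.
  apply: (@le_trans _ _ (Nb N `^ p)).
    have bE := @bm_energy R B N a.
    rewrite -[leRHS](_ : Int (fun=> Nb N `^ p) = _); last first.
      by rewrite Rintegral_cst //; rewrite circle_measureT mulr1.
    apply: (Int_le (circle_measureT R)).
    - by apply: bm_sqrt_powR => //; lra.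
    - exact: bm_cst.
    move=> t; apply: ge0_ler_powR; rewrite ?nnegrE ?sqrtr_ge0 //; first by lra.
    by rewrite -(ger0_norm Nb0) -sqrtr_sqr ler_wsqrtr // energy_bound.
  rewrite mulrA ler_pdivlMr // mulrC ler_wpM2r ?powR_ge0 //.
  by have h3 := C3_gt0; apply: le_trans NM _; rewrite /D; lra.
have nu1 : 1 <= nu by exact: le_trans nuM.
have sp := s_gt0 N; have sp1 := s_le1 N.
have hs : c ^+ 2 <= s N ^+ 2 * nu.
  have := hc N N0; rewrite -(@ler_pXn2r _ 2%N) ?nnegrE ?mulr_ge0 ?powR_ge0 ?(ltW cp) ?(ltW sp) //.
  rewrite exprMn; congr (_ <= _ * _); rewrite -powR_mulrn ?powR_ge0 // -powRrM.
  by congr (_ `^ _); field.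
have hM : 32 * C4 <= c ^+ 2 * nu.
  have : M * c ^+ 2 <= nu * c ^+ 2 by rewrite ler_pM2r.
  rewrite /M mulrDl divfK ?gt_eqF // mul1r => h; lra.
have hE2 : 32 * C4 <= s N ^+ 2 * nu ^+ 2.
  apply: le_trans hM _; rewrite (expr2 nu) mulrA ler_wpM2r //; exact: ltW.
have hE4 : 32 * C4 <= s N ^+ 2 * nu ^+ 4.
  apply: le_trans hE2 _; rewrite ler_wpM2l ?sqr_ge0 // ler_weXn2l //.
have ss : s N ^+ 2 <= s N by rewrite expr2 ler_piMl // ltW.
set E := C4 * N%:R `^ (1 - chi) in nu4.
have E0 : 0 < E by rewrite mulr_gt0 // powR_gt0.
have hE : E <= N%:R * s N ^+ 2 / 2.
  rewrite nu4 ler_pdivrMr ?exprn_gt0 //.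
  have -> : N%:R * s N ^+ 2 / 2 * nu ^+ 4 = s N ^+ 2 * nu ^+ 4 / 2 * N%:R by ring.
  rewrite ler_pM2r //; have := C4_gt0; lra.
have hEs : N%:R * s N ^+ 2 <= N%:R * s N by rewrite ler_pM2l.
have hN : N%:R * s N / 2 <= Nb N.
  have := mass_lower N0; rewrite -/E; lra.
have Nsp : 0 < N%:R * s N by exact: mulr_gt0.
have Nbp : 0 < Nb N by apply: lt_le_trans hN; exact: divr_gt0.
have hA := weighted_mass N0; rewrite -/E in hA.
pose lam := Nb N / nu.
have lamp : 0 < lam by exact: divr_gt0.
pose K := 2 * E / s N.
have K0 : 0 <= K by rewrite divr_ge0 ?mulr_ge0 // ltW.
have hK : 8 * K * Nb N <= lam ^+ 2.
  have -> : lam ^+ 2 = Nb N / nu ^+ 2 * Nb N by rewrite /lam; field; rewrite gt_eqF.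
  rewrite ler_pM2r //.
  apply: le_trans (_ : N%:R * s N / 2 / nu ^+ 2 <= _); last first.
    by rewrite ler_wpM2r // invr_ge0 exprn_ge0 // ltW.
  rewrite /K nu4.
  have -> : 8 * (2 * (C4 * N%:R / nu ^+ 4) / s N)
    = 16 * C4 * (N%:R / (nu ^+ 4 * s N)) by field; rewrite !gt_eqF.
  have -> : N%:R * s N / 2 / nu ^+ 2
    = s N ^+ 2 * nu ^+ 2 / 2 * (N%:R / (nu ^+ 4 * s N)) by field; rewrite !gt_eqF.
  apply: ler_wpM2r; last by lra.
  by rewrite divr_ge0 ?mulr_ge0 ?exprn_ge0 // ltW.
have hmom := @moment_bound R _ _ mu (circle_measureT R) _ _ (@bm_cosn R) (@bm_sinn R)
  (@orth_cosn R) (@orth_sinn R) _ (iota_uniq 1 (N.+1 - 1)) (fun n => n \in B) s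
  (re_coeff B a) (im_coeff B a) K lam s_gt0.
rewrite -/(index_iota 1 N.+1) in hmom.
apply: le_trans (hmom _ _ _ K0 lamp hK p p2 _) _.
- by move=> n; exact: coeff_le.
- move=> t t'; have := weighted_discrepancy (t - t') 0 N0; congr (`|_| <= _).
  by apply: eq_bigr => n _; rewrite cosn_diff addr0 mulrBr.
- move=> t t'; have := weighted_discrepancy (t - t') (- (pi / 2)) N0; congr (`|_| <= _).
  by apply: eq_bigr => n _; rewrite sinn_diff cosBpihalf // mulrBr.
- by move=> t; exact: energy_bound.
rewrite -/(Nb N).
pose P := Nb N `^ (p - 2); pose V := nu `^ (p - 2).
have Pp : 0 < P by exact: powR_gt0.
have Vp : 0 < V by exact: powR_gt0.
have PE : Nb N `^ p = P * Nb N ^+ 2.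
  rewrite -powR_mulrn // -powRD ?(gt_eqF Nbp) ?implybT //.
  by rewrite subrK.
have lamE : lam `^ (p - 2) = P / V.
  apply: (canRL (mulfK _)); first by rewrite gt_eqF.
  by rewrite /P /V -powRM ?(ltW lamp) ?(ltW nup) // divfK ?gt_eqF.
have hV : b <= s N * V.
  have := hb N N0; rewrite /V /nu -powRrM; congr (_ <= _ * _ `^ _); lra.
rewrite lamE PE -/P.
(* The loss 1 / s_N in passing from N to |B_N| is repaid by V = nu^(p - 2); here p > 2 is
   essential. *)
have e1 : P / V * Nb N <= 2 / b * (P * Nb N ^+ 2 / N%:R).
  have -> : P / V * Nb N = P * Nb N / (b * N%:R * V) * (b * N%:R).
    by field; rewrite !gt_eqF.
  have -> : 2 / b * (P * Nb N ^+ 2 / N%:R) = P * Nb N / (b * N%:R * V) * (2 * Nb N * V).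
    by field; rewrite !gt_eqF.
  apply: ler_wpM2l; first by rewrite divr_ge0 ?mulr_ge0 // ltW.
  have h1 : b * N%:R <= s N * V * N%:R by rewrite ler_pM2r.
  have h2 : (N%:R * s N / 2) * V <= Nb N * V by rewrite ler_pM2r.
  lra.
have e2 : P * (2 * \sum_(1 <= n < N.+1) (n \in B)%:R * s n)
    <= 8 * (C3 + 1) * (P * Nb N ^+ 2 / N%:R).
  have -> : 8 * (C3 + 1) * (P * Nb N ^+ 2 / N%:R) = P * (2 * (C3 + 1) * (4 * Nb N ^+ 2 / N%:R)).
    by ring.
  rewrite ler_pM2l // -mulrA ler_pM2l //.
  have h1 : N%:R * s N ^+ 2 <= 4 * Nb N ^+ 2 / N%:R.
    rewrite ler_pdivlMr //.
    have : (N%:R * s N / 2) ^+ 2 <= Nb N ^+ 2.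
      by rewrite ler_pXn2r ?nnegrE // ltW // divr_gt0.
    rewrite !expr2; lra.
  have h2 : (C3 + 1) * (N%:R * s N ^+ 2) <= (C3 + 1) * (4 * Nb N ^+ 2 / N%:R).
    by rewrite ler_wpM2l // addr_ge0 // ltW.
  have : 0 < N%:R * s N ^+ 2 by rewrite mulr_gt0 // exprn_gt0.
  lra.
have Q0 : 0 <= P * Nb N ^+ 2 / N%:R by rewrite divr_ge0 ?mulr_ge0 ?sqr_ge0 // ltW.
have := mulr_ge0 D1 Q0.
by rewrite /D mulrDl mulrDl; lra.
Qed.

Lemma Lp_circle_restriction (p : R) : 2 <= p -> exists2 C : R, 0 < C &
  forall N a, (forall n, (0 < n)%N -> `|a n| <= 1) ->
  (Lp_circle p (exp_sum B N a) <= C%:E * Lp_circle p (exp_sum B N (fun=> 1%R)))%E.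
Proof.
move=> p2; have p0 : 0 < p by lra.
have I0 N a : 0 <= Int (fun t => Num.sqrt (energy B N a t) `^ p).
  by apply: Int_ge0 => t; exact: powR_ge0.
have reduce C : 0 <= C -> (forall N a, (forall n, (0 < n)%N -> `|a n| <= 1) ->
    Int (fun t => Num.sqrt (energy B N a t) `^ p)
      <= C * Int (fun t => Num.sqrt (energy B N (fun=> 1) t) `^ p)) ->
    forall N a, (forall n, (0 < n)%N -> `|a n| <= 1) ->
    (Lp_circle p (exp_sum B N a)
      <= (C `^ p^-1)%:E * Lp_circle p (exp_sum B N (fun=> 1%R)))%E.
  move=> C0 hC N a ha; rewrite !Lp_circle_exp_sum // -EFinM lee_fin -powRM //.
  apply: ge0_ler_powR; rewrite ?nnegrE ?invr_ge0 ?mulr_ge0 ?(ltW p0) //; exact: hC.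
have [p2'|pn2] := eqVneq p 2.
  have sqE N a : Int (fun t => Num.sqrt (energy B N a t) `^ p) = Int (energy B N a).
    apply: Int_eq => t; rewrite p2' powR_mulrn ?sqrtr_ge0 // sqr_sqrtr //.
    by rewrite addr_ge0 ?sqr_ge0.
  exists (1 `^ p^-1); first exact: powR_gt0.
  by apply: reduce => // N a ha; rewrite !sqE mul1r energy_one; exact: energy_one_le.
have {pn2}p2 : 2 < p by rewrite lt_neqAle eq_sym pn2.
have [D D0 hD] := moment_le p2.
(* The factor 8 * 2^p undoes the losses in [lower_bound]: the halved peak and the interval of length
   1 / (8 N). *)
have D' : 0 < D * (8 * 2 `^ p) by rewrite !mulr_gt0 // powR_gt0.
exists ((D * (8 * 2 `^ p)) `^ p^-1); first exact: powR_gt0.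
apply: reduce; first exact: ltW.
move=> [|N] a ha.
  rewrite [leLHS](_ : _ = 0); first by rewrite mulr_ge0 // ltW.
  rewrite -[RHS](_ : Int (fun=> 0) = 0); last by rewrite Rintegral_cst ?mul0r.
  apply: Int_eq => t.
  by rewrite /energy /re_sum /im_sum !big_nil expr0n addr0 sqrtr0 powR0 ?gt_eqF.
apply: le_trans (hD N.+1 a isT ha) _; rewrite -[leRHS]mulrA ler_pM2l //.
have := @lower_bound R B N.+1 p p0 isT; rewrite -/(Nb N.+1) => h.
have Nb0 : 0 <= Nb N.+1 by apply: sumr_ge0 => n _; case: (n \in B).
have q0 : 0 < 8 * 2 `^ p :> R by rewrite mulr_gt0 // powR_gt0.
apply: le_trans (_ : 8 * 2 `^ p * ((Nb N.+1 / 2) `^ p / (8 * N.+1%:R)) <= _); last first.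
  by rewrite ler_pM2l.
have -> : Nb N.+1 `^ p = (Nb N.+1 / 2) `^ p * 2 `^ p by rewrite -powRM ?divr_ge0 // divfK.
have : N.+1%:R != 0 :> R by [].
by move: (N.+1%:R) => x x0; rewrite le_eqVlt; apply/orP; left; apply/eqP; field.
Qed.

End Restriction.

(** * Slowly decreasing weights *)

Section SlowlyDecreasing.
Set Implicit Arguments.
Unset Strict Implicit.
Variable R : realType.

(** If a^2 = b^2 + 1 then 1 / a <= 2 (a - b), so the bound follows by telescoping square roots. *)
Lemma sum_inv_sqrt_le (N : nat) :
  \sum_(1 <= n < N.+1) (Num.sqrt n%:R)^-1 <= 2 * Num.sqrt N%:R :> R.
Proof.
elim: N => [|N IH]; first by rewrite big_geq // mulr_ge0 ?sqrtr_ge0.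
rewrite big_nat_recr //=; apply: le_trans (lerD IH (lexx _)) _.
have a2 : Num.sqrt N.+1%:R ^+ 2 = Num.sqrt N%:R ^+ 2 + 1 :> R by rewrite !sqr_sqrtr // natr1.
have a0 : 0 < Num.sqrt N.+1%:R :> R by rewrite sqrtr_gt0 ltr0n.
move: a2 a0; move: (Num.sqrt N.+1%:R) (Num.sqrt N%:R) => a b a2 a0.
have : a^-1 <= 2 * (a - b); last by lra.
rewrite -(ler_pM2r a0) mulVf ?gt_eqF //.
have : 0 <= (a - b) ^+ 2 by exact: sqr_ge0.
rewrite !expr2 in a2 *; lra.
Qed.

Variable psi : R -> R.
Variable m : nat.
Hypothesis m_gt0 : (0 < m)%N.
Hypothesis psi_gt0 : forall x, m%:R <= x -> 0 < psi x.
Hypothesis psi_noninc : forall u v, m%:R <= u <= v -> psi v <= psi u.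
Let s n := psi (maxn n m)%:R.

Lemma clamp_ge n : m%:R <= (maxn n m)%:R :> R.
Proof. by rewrite ler_nat leq_maxr. Qed.

Lemma clamp_gt0 n : 0 < s n.
Proof. by apply: psi_gt0; exact: clamp_ge. Qed.

Lemma clamp_noninc n k : (n <= k)%N -> s k <= s n.
Proof.
by move=> nk; apply: psi_noninc; rewrite clamp_ge ler_nat geq_max leq_maxr leq_max nk.
Qed.

(** Beyond [k] the product s n n^eps is nondecreasing; up to [k], s n itself is at least s k. *)
Lemma clamp_lower (eps Y : R) : 0 < eps ->
  (forall u v, Y <= u <= v -> psi u * u `^ eps <= psi v * v `^ eps) ->
  exists2 c : R, 0 < c & forall n, (0 < n)%N -> c <= s n * n%:R `^ eps.
Proof.
move=> e0 hY; pose k := maxn (Num.bound `|Y|) m.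
have one_le n : (0 < n)%N -> 1 <= n%:R `^ eps :> R.
  move=> n0; rewrite [leLHS](_ : 1 = 1 `^ eps); last by rewrite powR1.
  by apply: ge0_ler_powR; rewrite ?nnegrE ?ler1n // ltW.
have k0 : (0 < k)%N by rewrite /k leq_max m_gt0 orbT.
have km : maxn k m = k by apply/maxn_idPl; rewrite /k leq_maxr.
have kY : Y <= k%:R.
  apply: le_trans (_ : (Num.bound `|Y|)%:R <= _); last by rewrite ler_nat leq_maxl.
  by apply: ltW; apply: le_lt_trans (ler_norm Y) (archi_boundP (normr_ge0 Y)).
exists (s k) => [|n n0]; first exact: clamp_gt0.
have [nk|kn] := leqP n k.
  apply: le_trans (clamp_noninc nk) _; rewrite ler_peMr ?one_le // ltW //; exact: clamp_gt0.
apply: (@le_trans _ _ (s k * k%:R `^ eps)).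
  by rewrite ler_peMr ?one_le // ltW //; exact: clamp_gt0.
have nm : maxn n m = n by apply/maxn_idPl; rewrite (leq_trans _ (ltnW kn)) // leq_maxr.
by rewrite /s km nm; apply: hY; rewrite kY ler_nat ltnW.
Qed.

Hypothesis psi_nondec : forall u v, m%:R <= u <= v ->
  psi u * u `^ (1 / 4) <= psi v * v `^ (1 / 4).

Lemma clamp_nondec n k : (n <= k)%N -> s n * n%:R `^ (1 / 4) <= s k * k%:R `^ (1 / 4).
Proof.
have mono i j : (i <= j)%N -> i%:R `^ (1 / 4) <= j%:R `^ (1 / 4) :> R.
  by move=> ij; rewrite ge0_ler_powR ?nnegrE ?ler_nat //; lra.
move=> nk; have [km|mk] := leqP k m.
  have -> : s n = s k by rewrite /s !(maxn_idPr _) // (leq_trans nk).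
  by rewrite ler_wpM2l ?mono // ltW // clamp_gt0.
apply: (@le_trans _ _ (s n * (maxn n m)%:R `^ (1 / 4))).
  by rewrite ler_wpM2l ?mono ?leq_maxl // ltW // clamp_gt0.
rewrite {2}/s (maxn_idPl (ltnW mk)); apply: psi_nondec.
by rewrite clamp_ge ler_nat geq_max nk ltnW.
Qed.

(** Monotonicity of s n n^(1/4) gives s n^2 <= s N^2 (N / n)^(1/2), and the sum of n^(- 1/2) is at
    most 2 N^(1/2). *)
Lemma clamp_square N : (0 < N)%N ->
  \sum_(1 <= n < N.+1) s n ^+ 2 <= 2 * (N%:R * s N ^+ 2).
Proof.
move=> N0.
have sq n : (s n * n%:R `^ (1 / 4)) ^+ 2 = s n ^+ 2 * Num.sqrt n%:R.
  rewrite exprMn; congr (_ * _); rewrite -powR_mulrn ?powR_ge0 // -powRrM -powR12_sqrt //.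
  by congr (_ `^ _); lra.
apply: (@le_trans _ _ (\sum_(1 <= n < N.+1)
    s N ^+ 2 * Num.sqrt N%:R * (Num.sqrt n%:R)^-1)).
  apply: ler_sum_nat => n /andP[n0 nN].
  rewrite ler_pdivlMr ?sqrtr_gt0 ?ltr0n // -!sq.
  by rewrite lerXn2r ?nnegrE ?mulr_ge0 ?powR_ge0 ?(ltW (clamp_gt0 _)) // clamp_nondec.
rewrite -mulr_sumr.
apply: (@le_trans _ _ (s N ^+ 2 * Num.sqrt N%:R * (2 * Num.sqrt N%:R))).
  by rewrite ler_wpM2l ?sum_inv_sqrt_le // mulr_ge0 ?sqr_ge0 ?sqrtr_ge0.
have h : Num.sqrt N%:R * Num.sqrt N%:R = N%:R :> R by rewrite -expr2 sqr_sqrtr.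
by rewrite -[in leRHS]h le_eqVlt; apply/orP; left; apply/eqP; ring.
Qed.

End SlowlyDecreasing.

(** Treats both signs through (-1)^sg. [B] is prescribed only where phi_1 and psi are both defined;
    the finitely many other n affect only the constant. *)
Lemma fractional_part_restriction (R : realType) (c1 x1 x2 y0 : R)
    (h1 h2 phi1 phi2 psi : R -> R) (sg : bool) (B : set nat) (p : R) :
  1 <= c1 < 2 -> class_R c1 x1 h1 -> class_R 1 x2 h2 ->
  inverse_from x1 h1 phi1 -> inverse_from x2 h2 phi2 ->
  0 < y0 -> (forall x : R, y0 <= x -> 0 < psi x <= 1 / 2) ->
  differentiable_from y0 psi -> approximates_derivative y0 psi (h2 x2) phi2 ->
  (forall n : nat, h1 x1 <= n%:R -> y0 <= n%:R ->
    (n \in B) = (Defs.frac ((-1) ^+ sg * phi1 n%:R) < psi n%:R)) ->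
  2 <= p -> exists2 C : R, 0 < C &
  forall N (a : nat -> R[i]), (forall n, (0 < n)%N -> `|a n| <= 1) ->
  (Lp_circle p (exp_sum B N a) <= C%:E * Lp_circle p (exp_sum B N (fun=> 1%R)))%E.
Proof.
move=> hc1 hh1 hh2 hphi1 hphi2 hy0 hpsi dpsi apsi hB p2.
have [kappa [k [Th [n0 [hk k0 [n00 hn0] hconc hTh]]]]] := class_R_inverse_concave hc1 hh1 hphi1.
have pos y : y0 <= y -> 0 < psi y by move=> /hpsi /andP[].
have reg := psi_regular hh2 hphi2 hy0 pos dpsi apsi.
have [|Y y0Y hY] := reg (1 / 4); first by lra.
(* From [m] on the phase is concave, psi is defined, and psi and psi u * u^(1/4) are monotone. *)
pose m := maxn n0 (Num.bound `|Y|).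
have mY : Y <= m%:R.
  apply: le_trans (_ : (Num.bound `|Y|)%:R <= _); last by rewrite ler_nat leq_maxr.
  by apply: ltW; apply: le_lt_trans (ler_norm Y) (archi_boundP (normr_ge0 Y)).
have y0m : y0 <= m%:R by apply: le_trans mY; exact: ltW.
have m0 : (0 < m)%N by rewrite leq_max n00.
have nm : (n0 <= m)%N by exact: leq_maxl.
pose s n := psi (maxn n m)%:R.
have mpos x : m%:R <= x -> 0 < psi x by move=> mx; apply/pos/(le_trans y0m).
have mreg u v : m%:R <= u <= v -> Y <= u <= v.
  by move=> /andP[mu ->]; rewrite andbT (le_trans mY).
have mdec u v : m%:R <= u <= v -> psi v <= psi u by move=> /mreg /hY[].
have minc u v : m%:R <= u <= v -> psi u * u `^ (1 / 4) <= psi v * v `^ (1 / 4).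
  by move=> /mreg /hY[].
have s1 n : s n <= 1.
  have /hpsi/andP[_ h] : y0 <= (maxn n m)%:R by rewrite (le_trans y0m) // ler_nat leq_maxr.
  by rewrite /s; lra.
have s0 n : 0 < s n by exact: clamp_gt0.
have sd n : s n.+1 <= s n by apply: clamp_noninc.
have [C4 [chi [C40 hchi hdisc]]] : exists C chi : R,
    [/\ 0 < C, 0 < chi < 1 & forall (N : nat) (xi al : R), (0 < N)%N ->
    `|\sum_(1 <= n < N.+1) ((n \in B)%:R - s n) * cos (2 * pi * (n%:R * xi) + al)|
      <= C * N%:R `^ (1 - chi)].
  apply: (@power_saving R (fun n => phi1 n%:R) s B sg kappa k Th m) => //.
  - by move=> n mn; apply: hconc; exact: leq_trans mn.
  - by move=> n mn; apply: hTh; exact: leq_trans mn.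
  - by move=> n; rewrite s1 ltW.
  move=> n mn; rewrite /s (maxn_idPl mn); apply: hB.
    by apply: le_trans hn0 _; rewrite ler_nat (leq_trans nm).
  by rewrite (le_trans y0m) // ler_nat.
apply: (@Lp_circle_restriction R B s 2 C4 chi) => //.
- move=> eps e0; have [Z _ hZ] := reg eps e0.
  by apply: (@clamp_lower R psi m m0 mpos mdec eps Z e0) => u v /hZ[].
- by move=> N; exact: clamp_square.
Qed.

Theorem theorem1 (R : realType) (c1 c2 x1 x2 y0 : R)
    (h1 h2 phi1 phi2 psi : R -> R)
    (hc1 : 1 <= c1 < 2) (hc2 : c2 = 1)
    (hh1 : class_R c1 x1 h1) (hh2 : class_R c2 x2 h2)
    (hphi1 : inverse_from x1 h1 phi1) (hphi2 : inverse_from x2 h2 phi2)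
    (hy0 : 0 < y0)
    (hpsi : forall x : R, y0 <= x -> 0 < psi x <= 1 / 2)
    (hpsi2 : twice_differentiable_from y0 psi)
    (hpsi_phi2 : approximates_derivative y0 psi (h2 x2) phi2)
    (p : R) (hp : 2 <= p) :
  exists C : R, 0 < C /\
    forall B : set nat,
      B = B_plus (h1 x1) phi1 y0 psi \/ B = B_minus (h1 x1) phi1 y0 psi ->
    forall (N : nat) (a : nat -> R[i]),
      (forall n : nat, (0 < n)%N -> `|a n| <= 1) ->
      (Lp_circle p (exp_sum B N a)
         <= C%:E * Lp_circle p (exp_sum B N (fun=> 1%R)))%E.
Proof.
rewrite hc2 in hh2.
have main sg B := @fractional_part_restriction R c1 x1 x2 y0 h1 h2 phi1 phi2 psi sg B p
  hc1 hh1 hh2 hphi1 hphi2 hy0 hpsi hpsi2.1 hpsi_phi2.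
have [|Cp Cp0 hCp] := main false (B_plus (h1 x1) phi1 y0 psi) _ hp.
  move=> n hn yn; rewrite expr0 mul1r; apply/idP/idP => [|h]; first by rewrite inE => -[].
  by rewrite inE.
have [|Cm Cm0 hCm] := main true (B_minus (h1 x1) phi1 y0 psi) _ hp.
  move=> n hn yn; rewrite expr1 mulN1r; apply/idP/idP => [|h]; first by rewrite inE => -[].
  by rewrite inE.
exists (Cp + Cm); split; first exact: addr_gt0.
move=> B hB N a ha.
have weaken C : C <= Cp + Cm ->
    (Lp_circle p (exp_sum B N a) <= C%:E * Lp_circle p (exp_sum B N (fun=> 1%R)) ->
     Lp_circle p (exp_sum B N a) <= (Cp + Cm)%:E * Lp_circle p (exp_sum B N (fun=> 1%R)))%E.
  by move=> hC h; apply: (le_trans h); rewrite lee_wpmul2r ?Lnorm_ge0 // lee_fin.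
case: hB => -> in weaken *.
- by apply: weaken (hCp N a ha); rewrite lerDl ltW.
- by apply: weaken (hCm N a ha); rewrite lerDr ltW.
Qed.
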